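(* Let $\varepsilon_0>0$ and let $\psi_0^\varepsilon\in X$ be such that $$\|D\psi_0^\varepsilon\|_{\overline Y_\varepsilon}=\sup_{(v,r)\in\mathbb R\times\mathbb R_+}\frac{|\psi_0^\varepsilon(v)-\psi_0^\varepsilon(v-r)|}{\overline\Gamma_\varepsilon(v,r)}<\infty .$$ Let $D\psi_0^\varepsilon(v,r)=\psi_0^\varepsilon(v)-\psi_0^\varepsilon(v-r)$, and let $\psi_t^\varepsilon$ be the solution in $X$ of the regularized evolution equation with initial datum $\psi^\varepsilon_0$. Then there exists, for all $t>0$, a unique solution $D\psi_t^\varepsilon$ of $$D\psi_t^{\varepsilon}=e^{-t\tilde{\mathcal V}^{\varepsilon}}D\psi^{\varepsilon}_0+\int_0^t ds\,e^{-(t-s)\tilde{\mathcal V}^{\varepsilon}}\tilde{\mathcal K}^{\varepsilon}_uD\psi^{\varepsilon}_s-\int_0^t ds\,e^{-(t-s)\tilde{\mathcal V}^{\varepsilon}}\tilde{\mathcal L}^{\varepsilon}_sD\psi^{\varepsilon}_s-\int_0^t ds\,e^{-(t-s)\tilde{\mathcal V}^{\varepsilon}}\tilde{\mathcal K}^{\varepsilon}_b[\psi^{\varepsilon}_s]$$ such that $\sup_{t>0}\|D\psi_t^\varepsilon\|_{\overline Y_\varepsilon}<\infty$.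
   Context: $\mathbb R_+=(0,\infty)$ for the variable $r$; $\mathbf 1(\cdot)$ is the indicator. Parameters: $\bar n>0$, $1/9<\alpha<1/6.5$, $\mu\in[1/3,7/16]$, $c_0=0.52$, $a\ge9$, $a_1=a/c_0$, $\gamma_0\in(0,1/8]$, $\kappa\ge7$, $\mu'>\mu$, $b_0\ge10$, $m_0\ge\max(2a_1,b_0+2)$, $\varepsilon_0>0$, $\varepsilon(v)=\varepsilon_0\exp(-\frac{\mu'}{\gamma_0}\max(a_1,v))$. Kernels. For $v>w$: $K_3^2(v,w)=4\bar n(\ln(1+e^v))^{-3/2}\ln(1+e^w)\frac{e^w+2e^{-(v-w)}}{1+e^w+e^{-(v-w)}}$, $K_3^1=K_3^2\,\frac{e^{-(v-w)}}{1-e^{-(v-w)}}$, $K_3=K_3^1+K_3^2$. For $w>v$: $K_3(v,w)=4\bar n(\ln(1+e^v))^{-3/2}\ln(1+e^w)\frac{e^v+2e^{-(w-v)}}{1+e^v+e^{-(w-v)}}\frac{e^{-(w-v)}}{1-e^{-(w-v)}}$ and $\overline K_3^2(v,w)=K_3(v,w)e^{-(w-v)/2}$. The regularized kernels $K_3^\varepsilon,K_3^{1,\varepsilon},K_3^{2,\varepsilon},\overline K_3^{2,\varepsilon}$ at $(v,w)$ are the corresponding kernels multiplied by $\frac{1-e^{-\min(\varepsilon(\max(v,w)),|v-w|)}}{1-e^{-\varepsilon(\max(v,w))}}$. Spaces. $f(v)=\max((\ln(1+e^v))^{-\alpha},(\ln2)^{-\alpha})$, $\tilde\Gamma(v)=f(v)e^{\mu\max(a,c_0v)}$;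 $X$ = continuous $h:\mathbb R\to\mathbb C$ with $\|h\|_X=\sup|h|/\tilde\Gamma<\infty$. $\overline\Gamma_\varepsilon(v,r)=(f(v)+f(v-r))e^{\mu\max(a,c_0v,v-r)}(1-e^{-\kappa(r+\varepsilon(v))})^{\gamma_0/2}$, $\|h\|_{\overline Y_\varepsilon}=\sup_{(v,r)\in\mathbb R\times\mathbb R_+}|h(v,r)|/\overline\Gamma_\varepsilon(v,r)$ for continuous $h$ on $\mathbb R\times\mathbb R_+$. Solutions are continuous functions of $(t,v,r)$. Regularized equation: $\partial_t\psi_t=-L_3^\varepsilon\psi_t$, $(L_3^\varepsilon\psi)(v)=\int_{\mathbb R}K_3^\varepsilon(v,w)(\psi(v)-\psi(w))dw$. For $\psi_0^\varepsilon\in X$, $\psi_t^\varepsilon$ is its unique solution with $\sup_{t}\|\psi^\varepsilon_t\|_X<\infty$ (in the Duhamel form $\psi_t=e^{-tV^\varepsilon}\psi_0+\int_0^te^{-(t-s)V^\varepsilon}\int K_3^\varepsilon(\cdot,w)\psi_s(w)dw\,ds$, $V^\varepsilon(v)=\int K_3^\varepsilon(v,w)dw$). Operators. $\tilde{\mathcal V}^\varepsilon$ is multiplication by $\int_{-\infty}^{v-r}K_3^\varepsilon(v-r,w)dw+\int_{v-r}^vK_3^\varepsilon(v,w)dw+\int_{v-r}^vK_3^\varepsilon(v-r,w)dw+\int_v^\infty K_3^\varepsilon(v,w)dw$. Write $\varepsilon'=\varepsilon(v-r)$; $\tilde r=\max(-v-b_0,r)$ if $v<-b_0$, $\tilde r=\max(-b_0-v+r,0)$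 if $v\ge-b_0$; $A^j(w)=(K_3^{j,\varepsilon}(v-r,w)-K_3^{j,\varepsilon}(v,w))D(v,v-w)$ for $j=1,2$; $D_w=D(w,w-v+r)$. Then $$(\tilde{\mathcal L}_s^\varepsilon D)(v,r)=-\mathbf 1(v\ge a_1)\int_{-\infty}^{v-r}A^1(w)\mathbf 1(v-w\le\varepsilon')dw-\int_{v-r-\varepsilon'}^{v-r}A^2(w)dw,$$ $$\begin{aligned}(\tilde{\mathcal K}_u^\varepsilon D)(v,r)=\;&\mathbf 1(v<a_1)\int_{-\infty}^{v-r}A^1(w)dw+\mathbf 1(v\ge a_1)\int_{-\infty}^{v-r}A^1(w)\mathbf 1(v-w>\varepsilon')dw\\&+\mathbf 1(v<-b_0)\Big[\int_v^{a_1}(K_3^\varepsilon(v,w)-K_3^\varepsilon(v-r,w))D_wdw+\int_{a_1}^\infty(\overline K_3^{2,\varepsilon}(v,w)-\overline K_3^{2,\varepsilon}(v-r,w))D_wdw\Big]\\&+\mathbf 1(v\ge-b_0)\int_v^\infty(\overline K_3^{2,\varepsilon}(v,w)-\overline K_3^{2,\varepsilon}(v-r,w))D_wdw\\&+\mathbf 1(v-r<-b_0)\int_{v-r}^{\min(v,0)}K_3^\varepsilon(v-r,w)D(v,v-w)dw+\mathbf 1(v-r\ge-b_0)\int_{v-r}^v\overline K_3^{2,\varepsilon}(v-r,w)D(v,v-w)dw\\&+\mathbf 1(v<-m_0)\int_{v-r}^v\mathbf 1(v-w<\min(r,-v-b_0))K_3^{1,\varepsilon}(v,w)D_wdw+\mathbf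 1(v\ge-m_0)\int_{v-r}^vK_3^{1,\varepsilon}(v,w)e^{-(v-w)}D_wdw\\&+\mathbf 1(v-r\le-m_0)\int_{v-r-\max(\tilde r,\varepsilon')}^{v-r-\varepsilon'}A^2(w)dw\\&+\mathbf 1(v-r\ge m_0)\Big[\mathbf 1(v\le3r)\int_0^{v-r-\varepsilon'}A^2(w)dw+\mathbf 1(v>3r)\int_{-\infty}^{c_0v}A^2(w)dw\Big]\\&+\mathbf 1(v\le-m_0)\Big[\mathbf 1(v+r<-b_0)\int_{v-r}^vK_3^{2,\varepsilon}(v,w)D_wdw+\mathbf 1(v+r\ge-b_0)\int_{2v+b_0}^vK_3^{2,\varepsilon}(v,w)D_wdw\Big]\\&+\mathbf 1(v\ge m_0)\Big[\mathbf 1(0<v-r<c_0v)\int_{v-r}^{(v-r)/c_0}K_3^{2,\varepsilon}(v,w)D_wdw+\mathbf 1(v-r\ge c_0v)\int_{v-r}^vK_3^{2,\varepsilon}(v,w)D_wdw\Big].\end{aligned}$$ For $\psi\in X$ with $D\psi(v,r)=\psi(v)-\psi(v-r)$, $\tilde{\mathcal K}_b^\varepsilon[\psi]$ is the remainder, defined by $$(L_3^\varepsilon\psi)(v)-(L_3^\varepsilon\psi)(v-r)=\tilde{\mathcal V}^\varepsilon(v,r)D\psi(v,r)-(\tilde{\mathcal K}_u^\varepsilon D\psi)(v,r)+(\tilde{\mathcal L}_s^\varepsilon D\psi)(v,r)+\tilde{\mathcal K}_b^\varepsilon[\psi](v,r).$$ *)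

(* Defs.v *)
From HB Require Import structures.
From mathcomp Require Import all_boot all_order all_algebra.
From mathcomp Require Import all_classical all_reals all_analysis.
From mathcomp Require Import complex.

Set Implicit Arguments.
Unset Strict Implicit.
Unset Printing Implicit Defensive.

Import Order.TTheory GRing.Theory Num.Theory.
Import numFieldNormedType.Exports.

Local Open Scope classical_set_scope.
Local Open Scope complex_scope.
Local Open Scope ring_scope.

Record params (R : realType) := Params {
  par_nbar : R; par_alpha : R; par_mu : R; par_a : R; par_gamma0 : R;
  par_kappa : R; par_mu' : R; par_b0 : R; par_m0 : R; par_eps0 : R }.

Section Definitions.
Variables (R : realType) (p : params R).

Local Notation nbar := (par_nbar p).
Local Notation alpha := (par_alpha p).
Local Notation mu := (par_mu p).
Local Notation a := (par_a p).
Local Notation gamma0 := (par_gamma0 p).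
Local Notation kappa := (par_kappa p).
Local Notation mu' := (par_mu' p).
Local Notation b0 := (par_b0 p).
Local Notation m0 := (par_m0 p).
Local Notation eps0 := (par_eps0 p).

Definition c0 : R := 52%:R / 100%:R.
Definition a1 : R := a / c0.

(* 1 / 6.5 = 10 / 65 *)
Definition admissible : Prop :=
  [/\ 0 < nbar, 1 / 9%:R < alpha < 10%:R / 65%:R,
      1 / 3%:R <= mu <= 7%:R / 16%:R & 9%:R <= a] /\
  [/\ 0 < gamma0 <= 1 / 8%:R, 7%:R <= kappa, mu < mu' & 10%:R <= b0] /\
  Num.max (2%:R * a1) (b0 + 2%:R) <= m0 /\ 0 < eps0.

Definition eps (v : R) : R := eps0 * expR (- (mu' / gamma0 * Num.max a1 v)).

Definition cint (S : set R) (F : R -> R[i]) : R[i] :=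
  (\int[lebesgue_measure]_(w in S) complex.Re (F w)) +i*
  (\int[lebesgue_measure]_(w in S) complex.Im (F w)).

(* oriented integral from x to y: the sign changes when y < x *)
Definition ocint (x y : R) (F : R -> R[i]) : R[i] :=
  if x <= y then cint `[x, y] F else - cint `[y, x] F.

Definition rint (S : set R) (F : R -> R) : R :=
  \int[lebesgue_measure]_(w in S) F w.

Definition cabs (z : R[i]) : R := complex.Re `|z|.

Definition lnp (v : R) : R := ln (1 + expR v).

(* The diagonal v = w is a null set and the values there are irrelevant; K32
   and K31 are only ever used for w < v, and K3bar2 for v < w. *)
Definition K32 (v w : R) : R :=
  4%:R * nbar * lnp v `^ (- (3%:R / 2%:R)) * lnp w *
  ((expR w + 2%:R * expR (- (v - w))) / (1 + expR w + expR (- (v - w)))).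

Definition K31 (v w : R) : R :=
  K32 v w * (expR (- (v - w)) / (1 - expR (- (v - w)))).

Definition K3 (v w : R) : R :=
  if w < v then K31 v w + K32 v w else
  4%:R * nbar * lnp v `^ (- (3%:R / 2%:R)) * lnp w *
  ((expR v + 2%:R * expR (- (w - v))) / (1 + expR v + expR (- (w - v)))) *
  (expR (- (w - v)) / (1 - expR (- (w - v)))).

Definition K3bar2 (v w : R) : R := K3 v w * expR (- ((w - v) / 2%:R)).

Definition reg (K : R -> R -> R) (v w : R) : R :=
  K v w * ((1 - expR (- Num.min (eps (Num.max v w)) `|v - w|)) /
           (1 - expR (- eps (Num.max v w)))).

Definition K3e := reg K3.
Definition K31e := reg K31.
Definition K32e := reg K32.
Definition K3bar2e := reg K3bar2.

Definition fweight (v : R) : R := Num.max (lnp v `^ (- alpha)) (ln 2%:R `^ (- alpha)).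

Definition Gammat (v : R) : R := fweight v * expR (mu * Num.max a (c0 * v)).

Definition normX (h : R -> R[i]) : \bar R :=
  ereal_sup [set (cabs (h v) / Gammat v)%:E | v in [set: R]].

Definition in_X (h : R -> R[i]) : Prop :=
  continuous (h : R -> R[i]^o) /\ (normX h < +oo)%E.

Definition Gammabar (v r : R) : R :=
  (fweight v + fweight (v - r)) * expR (mu * Num.max a (Num.max (c0 * v) (v - r))) *
  (1 - expR (- (kappa * (r + eps v)))) `^ (gamma0 / 2%:R).

(* Functions on R x (0,oo) are represented by total functions of (v, r); only
   their values at r > 0 matter. *)
Definition normYbar (h : R -> R -> R[i]) : \bar R :=
  ereal_sup [set (cabs (h x.1 x.2) / Gammabar x.1 x.2)%:E
            | x in [set x : R * R | 0 < x.2]].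

Definition increment (psi : R -> R[i]) (v r : R) : R[i] := psi v - psi (v - r).

Definition L3e (psi : R -> R[i]) (v : R) : R[i] :=
  cint setT (fun w => (K3e v w)%:C * (psi v - psi w)).

Definition Ve (v : R) : R := rint setT (K3e v).

Definition evolution_solution (psi0 : R -> R[i]) (psi : R -> R -> R[i]) : Prop :=
  [/\ {within [set x : R * R | 0 <= x.1],
        continuous ((fun x => psi x.1 x.2) : R * R -> R[i]^o)},
      (ereal_sup [set normX (psi t) | t in [set t | (0 <= t)%R]] < +oo)%E &
      forall t v : R, 0 <= t ->
        psi t v = (expR (- (t * Ve v)))%:C * psi0 v +
          cint `[0, t] (fun s => (expR (- ((t - s) * Ve v)))%:C *
            cint setT (fun w => (K3e v w)%:C * psi s w))].

Definition Vt (v r : R) : R :=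
  rint `]-oo, v - r] (K3e (v - r)) + rint `[v - r, v] (K3e v) +
  rint `[v - r, v] (K3e (v - r)) + rint `[v, +oo[ (K3e v).

Definition rt (v r : R) : R :=
  if v < - b0 then Num.max (- v - b0) r else Num.max (- b0 - v + r) 0.

Definition ind (b : bool) : R[i] := b%:R.

Section Operators.
Variables (D : R -> R -> R[i]) (v r : R).

Local Notation eps' := (eps (v - r)).

Definition A1 (w : R) : R[i] := (K31e (v - r) w - K31e v w)%:C * D v (v - w).
Definition A2 (w : R) : R[i] := (K32e (v - r) w - K32e v w)%:C * D v (v - w).
Definition Dw (w : R) : R[i] := D w (w - v + r).

Definition Ls : R[i] :=
  - (ind (a1 <= v) *
     cint `]-oo, v - r] (fun w => A1 w * ind (v - w <= eps')))
  - ocint (v - r - eps') (v - r) A2.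

Definition Ku : R[i] :=
  ind (v < a1) * cint `]-oo, v - r] A1
  + ind (a1 <= v) * cint `]-oo, v - r] (fun w => A1 w * ind (eps' < v - w))
  + ind (v < - b0) *
    (ocint v a1 (fun w => (K3e v w - K3e (v - r) w)%:C * Dw w) +
     cint `[a1, +oo[ (fun w => (K3bar2e v w - K3bar2e (v - r) w)%:C * Dw w))
  + ind (- b0 <= v) *
    cint `[v, +oo[ (fun w => (K3bar2e v w - K3bar2e (v - r) w)%:C * Dw w)
  + ind (v - r < - b0) *
    ocint (v - r) (Num.min v 0) (fun w => (K3e (v - r) w)%:C * D v (v - w))
  + ind (- b0 <= v - r) *
    ocint (v - r) v (fun w => (K3bar2e (v - r) w)%:C * D v (v - w))
  + ind (v < - m0) *
    ocint (v - r) v (fun w => ind (v - w < Num.min r (- v - b0)) *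
                              ((K31e v w)%:C * Dw w))
  + ind (- m0 <= v) *
    ocint (v - r) v (fun w => (K31e v w * expR (- (v - w)))%:C * Dw w)
  + ind (v - r <= - m0) *
    ocint (v - r - Num.max (rt v r) eps') (v - r - eps') A2
  + ind (m0 <= v - r) *
    (ind (v <= 3%:R * r) * ocint 0 (v - r - eps') A2 +
     ind (3%:R * r < v) * cint `]-oo, c0 * v] A2)
  + ind (v <= - m0) *
    (ind (v + r < - b0) * ocint (v - r) v (fun w => (K32e v w)%:C * Dw w) +
     ind (- b0 <= v + r) *
       ocint (2%:R * v + b0) v (fun w => (K32e v w)%:C * Dw w))
  + ind (m0 <= v) *
    (ind (0 < v - r < c0 * v) *
       ocint (v - r) ((v - r) / c0) (fun w => (K32e v w)%:C * Dw w) +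
     ind (c0 * v <= v - r) *
       ocint (v - r) v (fun w => (K32e v w)%:C * Dw w)).

End Operators.

(* remainder in L3e psi v - L3e psi (v - r) = Vt D - Ku D + Ls D + Kb psi,
   where D = increment psi *)
Definition Kb (psi : R -> R[i]) (v r : R) : R[i] :=
  (L3e psi v - L3e psi (v - r))
  - ((Vt v r)%:C * increment psi v r - Ku (increment psi) v r + Ls (increment psi) v r).

(* D is the unknown, not required to be an increment; psi enters only through
   the source term Kb. At t = 0 the equation reads D 0 = increment psi0. *)
Definition difference_solution (psi0 : R -> R[i]) (psi : R -> R -> R[i])
    (D : R -> R -> R -> R[i]) : Prop :=
  [/\ {within [set x : R * R * R | 0 <= x.1.1 /\ 0 < x.2],
        continuous ((fun x => D x.1.1 x.1.2 x.2) : R * R * R -> R[i]^o)},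
      (ereal_sup [set normYbar (D t) | t in [set t | (0 < t)%R]] < +oo)%E &
      forall t v r : R, 0 <= t -> 0 < r ->
        let semigroup s := (expR (- ((t - s) * Vt v r)))%:C in
        D t v r =
          semigroup 0 * increment psi0 v r
          + cint `[0, t] (fun s => semigroup s * Ku (D s) v r)
          - cint `[0, t] (fun s => semigroup s * Ls (D s) v r)
          - cint `[0, t] (fun s => semigroup s * Kb (psi s) v r)].

End Definitions.

(* Main.v *)
Require Import Defs.
From HB Require Import structures.
From mathcomp Require Import all_boot all_order all_algebra.
From mathcomp Require Import all_classical all_reals all_analysis.
From mathcomp Require Import complex measurable_realfun.
From mathcomp Require Import ring lra.
Import Order.TTheory GRing.Theory Num.Theory.
Import numFieldNormedType.Exports.
Local Open Scope classical_set_scope.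
Local Open Scope ring_scope.
Set Implicit Arguments.
Unset Strict Implicit.
Unset Printing Implicit Defensive.

(* Existence: the increments of [psi] satisfy the equation, since both [psi] and the
   increments obey Duhamel formulas whose rate can be changed at will. The point
   is that they stay bounded in [normYbar]. For [v] bounded or [r >= 1] this is
   the bound on [psi] in X. For large [v] and fixed [r < 1], the source of the
   equation for the increment is at most [Ve v * (C + theta N)] times the weight
   when [N] bounds the weighted increments, with [C] and [theta < 1] independent
   of [r]: the jumps shorter than 1 carry at most a fixed share of [Ve v]. So the
   weighted supremum, finite since [r] is fixed, is at most [C / (1 - theta)].

   Uniqueness: in the product weight [gwt v * hwt (v - r)] the kernel of
   [Ku - Ls] has mass at most [Vt + C], so on [e^{(C + 1) t}] times the weight
   the Duhamel map contracts wherever [Vt] is bounded. [Gammabar] is so much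
   smaller than the weight at infinity that the supremum of a difference of two
   solutions is not approached where [Vt] is large. *)


(** * The function ln (1 + e^v) *)

Section Scalar.
Variable R : realType.
Implicit Types a b c d k s t u v w x y z : R.

(** The pieces of [Ku - Ls] collapse because [K = kap] is monotone in its first argument: with
    [u = v - r], [K u w <= K v w] for [w] above [v], and, outside a zone of width [eps u],
    [K v w <= K u w] for [w] below [u]. So each difference of kernels is bounded by the one that
    enters [Vt], and only ratios of weights remain. The exponent 1/2 of [gwt] is what the damping
    [e^{-(w-v)/2}] of [K3bar2] can absorb, and it exceeds [mu <= 7/16]. The exponent 1/2 of [hwt]
    exceeds [alpha < 1/6], but makes downward jumps from [u] gain weight; for very negative [u],
    where the kernel is unbounded, this is compensated by reflection in [u].

    The share [theta < 1] depends on the form of [eps]. Jumps from [v] shorter than 1 have mass at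
    most of order [om v * v * ln (1 / eps)]. Since [eps] decays exponentially and no faster, this is
    of order [om v * v^2], and the jumps from [v] into [[v/2, v - 1]] have at least that much mass,
    up to a constant. *)

Lemma le_of_derive_ge0 (f f' : R -> R) a b : a <= b ->
  (forall x, a <= x <= b -> is_derive x 1 f (f' x)) ->
  (forall x, a <= x <= b -> 0 <= f' x) -> f a <= f b.
Proof.
move=> ab df f0.
have h x : x \in `]a, b[ -> a <= x <= b.
  by rewrite in_itv /= => /andP[/ltW -> /ltW ->].
apply: (@ger0_derive1_ndecr R f a b) => //.
- by move=> x /h xab; have [? _] := df _ xab.
- move=> x /h xab; rewrite derive1E; have [_ ->] := df _ xab; exact: f0.
- apply: derivable_within_continuous => x; rewrite in_itv /= => xab.
  by have [? _] := df _ xab.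
Qed.

Lemma subr1_expRN_le z : 1 - expR (- z) <= z.
Proof. by have := expR_ge1Dx (- z); lra. Qed.

Lemma subr1_expRN_ge z : z * expR (- z) <= 1 - expR (- z).
Proof.
have h := expR_ge1Dx z; have e0 := expR_gt0 (- z).
have : (1 + z) * expR (- z) <= expR z * expR (- z) by rewrite ler_pM2r.
by rewrite expRxMexpNx_1; lra.
Qed.

Lemma subr1_expRN_gt0 z : 0 < z -> 0 < 1 - expR (- z).
Proof. by move=> z0; rewrite subr_gt0 expR_lt1; lra. Qed.

Lemma expR1_ge2 : 2 <= expR 1 :> R.
Proof. by have := expR_ge1Dx (1:R); lra. Qed.

Lemma is_derive1Dl k y : is_derive y 1 (fun x => k + x) 1.
Proof.
have := is_deriveD (is_derive_cst k y 1) (is_derive_id y 1).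
by rewrite add0r.
Qed.

Lemma expR_ge_sqr z : 0 <= z -> 1 + z + z ^+ 2 / 2 <= expR z.
Proof.
move=> z0; pose f (x : R) := expR x - (1 + x + x ^+ 2 / 2).
suff : f 0 <= f z by rewrite /f expR0 expr0n /=; lra.
apply: (@le_of_derive_ge0 f (fun x => expR x - (1 + x)) _ _ z0) => x xz.
  apply: is_derive_eq; rewrite /GRing.scale /=; lra.
by have := expR_ge1Dx x; lra.
Qed.

Lemma expR2_ge3 : 5 <= expR 2 :> R.
Proof. by have := @expR_ge_sqr 2 ltac:(lra); lra. Qed.

Lemma ln1D_ge x : 0 <= x -> x / (1 + x) <= ln (1 + x).
Proof.
move=> x0; have x1 : 0 < 1 + x by lra.
have h : ln ((1 + x)^-1) <= (1 + x)^-1 - 1.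
  have := @le_ln1Dx R ((1 + x)^-1 - 1).
  rewrite addrCA subrr addr0; apply.
  have : 0 < (1 + x)^-1 by rewrite invr_gt0.
  lra.
move: h; rewrite lnV ?posrE // => h.
have -> : x / (1 + x) = 1 - (1 + x)^-1 by field; lra.
lra.
Qed.

(** [ln1D_ge] is too weak for [lnp_cube_growth], which needs [ln (1 + y) >= 3y / (3 + 2y)]. The
    difference of the two sides here has derivative [y^2 / ((1 + y) (2 + y)^2)]. *)
Lemma ln1D_ge_pade x : 0 <= x -> 2 * x / (2 + x) <= ln (1 + x).
Proof.
move=> x0; pose f (y : R) := ln (1 + y) + 4 * (2 + y)^-1.
have -> : 2 * x / (2 + x) = 2 - 4 * (2 + x)^-1 by field; lra.
suff : f 0 <= f x by rewrite /f !addr0 ln1; lra.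
pose f' (y : R) := (1 + y)^-1 + 4 * (- ((2 + y)^-1 ^+ 2)).
apply: (@le_of_derive_ge0 f f' _ _ x0) => y /andP[y0 yx].
- have d1 : is_derive (1 + y) 1 (@ln R) (1 + y)^-1 by apply: is_derive1_ln; lra.
  have d2 := is_derive1Dl 1 y; have d3 := is_derive1Dl 2 y.
  have d4 := @is_derive1_comp R (@ln R) (fun y => 1 + y) y _ _ d1 d2.
  have n2 : 2 + y != 0 by lra.
  have d5 := @is_deriveV R (fun y => 2 + y) y 1 _ n2 d3.
  apply: is_derive_eq; rewrite /f' /GRing.scale /= ; field.
  by apply/andP; split; lra.
- rewrite /f'.
  have -> : (1 + y)^-1 + 4 * - ((2 + y)^-1 ^+ 2) = y ^+ 2 / ((1 + y) * (2 + y) ^+ 2).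
    by field; apply/andP; split; lra.
  by rewrite divr_ge0 ?sqr_ge0 // mulr_ge0 ?sqr_ge0 //; lra.
Qed.

Lemma lnp_gt0 v : 0 < lnp v.
Proof. by rewrite /lnp ln_gt0 // ltrDl expR_gt0. Qed.

Lemma lnp_le u v : u <= v -> lnp u <= lnp v.
Proof.
move=> uv; rewrite /lnp ler_ln ?posrE ?lerD2l ?ler_expR //;
  by rewrite addr_gt0 ?expR_gt0.
Qed.

Lemma lnp_le_expR v : lnp v <= expR v.
Proof. by apply: le_ln1Dx; have := expR_gt0 v; lra. Qed.

Lemma lnp_ge_id v : v <= lnp v.
Proof.
rewrite /lnp -{1}(expRK v) ler_ln ?posrE ?expR_gt0 ?lerDr // addr_gt0 ?expR_gt0 //.
Qed.

Lemma lnp_le_1D v : 0 <= v -> lnp v <= 1 + v.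
Proof.
move=> v0; rewrite /lnp -[leRHS]expRK ler_ln ?posrE ?expR_gt0 ?addr_gt0 ?expR_gt0 //.
rewrite expRD; have := expR1_ge2; have : 1 <= expR v by rewrite -expR0 ler_expR.
move: (expR 1) (expR v) => x y; nra.
Qed.

Lemma lnp_ge_sigma v : expR v / (1 + expR v) <= lnp v.
Proof. by apply: ln1D_ge; exact: expR_ge0. Qed.

Lemma is_derive_lnp v : is_derive v 1 (@lnp R) (expR v / (1 + expR v)).
Proof.
have e0 := expR_gt0 v.
have d1 : is_derive (1 + expR v) 1 (@ln R) (1 + expR v)^-1.
  by apply: is_derive1_ln; lra.
have d2 : is_derive v 1 (fun y : R => 1 + expR y) (expR v).
  by have := is_deriveD (is_derive_cst (1 : R) v 1) (is_derive_expR v); rewrite add0r.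
have d4 := @is_derive1_comp R (@ln R) (fun y => 1 + expR y) v _ _ d1 d2.
by apply: is_derive_eq; rewrite mulrC.
Qed.

Lemma is_derive_expRZ k v : is_derive v 1 (fun x => expR (k * x)) (k * expR (k * v)).
Proof.
have d2 : is_derive v 1 (fun y : R => k * y) k.
  have := is_deriveM (is_derive_cst k v 1) (is_derive_id v 1).
  by rewrite /GRing.scale /= mulr1 mulr0 addr0.
have d4 := @is_derive1_comp R (@expR R) (fun y => k * y) v _ _ (is_derive_expR _) d2.
by apply: is_derive_eq; rewrite mulrC.
Qed.

Lemma expRZ_lnp_le k u v : u <= v ->
  (forall x, u <= x <= v -> 0 <= expR x / (1 + expR x) + k * lnp x) ->
  expR (k * u) * lnp u <= expR (k * v) * lnp v.
Proof.
move=> uv h.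
pose f x := expR (k * x) * lnp x.
pose f' x := expR (k * x) * (expR x / (1 + expR x) + k * lnp x).
have df x : u <= x <= v -> is_derive x 1 f (f' x).
  move=> _; have := is_deriveM (is_derive_expRZ k x) (is_derive_lnp x).
  rewrite /GRing.scale /= => d; apply: (is_derive_eq d); rewrite /f'.
  by move: (expR _ / _) (lnp _) (expR _) => A B C; ring.
have f0 x : u <= x <= v -> 0 <= f' x.
  by move=> /h xuv; rewrite /f' mulr_ge0 // expR_ge0.
exact: (le_of_derive_ge0 uv df f0).
Qed.

(** [e^{-x} lnp x] is nonincreasing, by [lnp_ge_sigma]. *)
Lemma lnp_growth u v : u <= v -> lnp v <= expR (v - u) * lnp u.
Proof.
move=> uv.
pose f x := - (expR (-1 * x) * lnp x).
pose f' x := expR (-1 * x) * (lnp x - expR x / (1 + expR x)).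
have df x : u <= x <= v -> is_derive x 1 f (f' x).
  move=> _; have := is_deriveN (is_deriveM (is_derive_expRZ (-1) x) (is_derive_lnp x)).
  rewrite /GRing.scale /= => d; apply: (is_derive_eq d); rewrite /f'.
  by move: (expR _ / _) (lnp _) (expR _) => A B C; ring.
have f0 x : u <= x <= v -> 0 <= f' x.
  by move=> _; rewrite /f' mulr_ge0 ?expR_ge0 // subr_ge0 lnp_ge_sigma.
have := le_of_derive_ge0 uv df f0; rewrite /f lerN2 => h.
have : expR v * (expR (-1 * v) * lnp v) <= expR v * (expR (-1 * u) * lnp u).
  by rewrite ler_pM2l ?expR_gt0.
by rewrite !mulrA -!expRD !mulN1r subrr expR0 mul1r.
Qed.

(** At minus infinity [lnp] grows at rate 1; on [x <= -2] the rate 3/4 survives. It is the rate that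
    [kap_reflect] needs: over a distance [2y] it gives [e^{3y/2}], which leaves [e^{y/2}] after the
    factor [e^{-y}] of an upward jump. *)
Lemma lnp_growth_lower u v : u <= v -> v <= -2 ->
  expR (3 / 4 * (v - u)) * lnp u <= lnp v.
Proof.
move=> uv v2.
have := @expRZ_lnp_le (- (3 / 4)) u v uv.
have -> : expR (3 / 4 * (v - u)) = expR (3 / 4 * v) * expR (- (3 / 4) * u).
  by rewrite -expRD; congr expR; ring.
have e1 : expR (3 / 4 * v) * expR (- (3 / 4) * v) = 1.
  by rewrite -expRD -mulrDl subrr mul0r expR0.
have e0 := expR_gt0 (3 / 4 * v).
move: e1 e0; set A := expR (3 / 4 * v); set B := expR (_ * v); set C := expR (_ * u).
move=> AB A0 h.
have : C * lnp u <= B * lnp v.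
  apply: h => x /andP[_ xv].
  have l1 := lnp_le_expR x.
  have x0 := expR_gt0 x.
  have x5 : 5 * expR x <= 1.
    have : expR x * 5 <= expR x * expR (- x).
      rewrite ler_pM2l //; apply: le_trans expR2_ge3 _; rewrite ler_expR; lra.
    by rewrite expRxMexpNx_1; lra.
  have : 3 / 4 * expR x <= expR x / (1 + expR x).
    by move: (expR x) x0 x5 => y y0 y5; rewrite ler_pdivlMr; [nra|lra].
  by move: (lnp x) (expR x) (expR x / _) l1 => a b c; lra.
rewrite -(ler_pM2l A0) !mulrA AB mul1r //.
Qed.

End Scalar.

(** * Kernel profiles up to exponential factors *)

HB.lock Definition om (R : realType) (v : R) : R := lnp v `^ (- (3 / 2)).
(** With [m = min v w] and [x = |v - w|], this is the bounded fraction shared by the kernels of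
    upward and downward jumps. *)
HB.lock Definition sig (R : realType) (m x : R) : R :=
  (expR m + 2 * expR (- x)) / (1 + expR m + expR (- x)).

(** For positive numbers this says [|ln a - ln b| <= rho]. Being stable under products, sums,
    inverses and maxima, it allows the variation of the kernel to be computed factor by factor. *)
Definition close (R : realType) (rho a b : R) : Prop :=
  a <= expR rho * b /\ b <= expR rho * a.

Section Profiles.
Variable R : realType.
Implicit Types a b c d k m s t u v w x y z rho : R.

Lemma om_gt0 v : 0 < om v.
Proof. by rewrite om.unlock powR_gt0 // lnp_gt0. Qed.

(** Beyond positivity, all facts on [om] come from this identity, which trades the power -3/2 for
    integer powers of [lnp]. *)
Lemma om_sqr v : om v ^+ 2 * lnp v ^+ 3 = 1.
Proof.
have l0 := lnp_gt0 v.
rewrite om.unlock -powR_mulrn ?powR_ge0 // -powRrM -powR_mulrn ?ltW // -powRD.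
  by rewrite (_ : _ + _ = 0) ?powRr0 //; lra.
by rewrite (gt_eqF l0) implybT.
Qed.

Lemma om_le_scaled c u v : 0 <= c -> lnp u ^+ 3 <= c ^+ 2 * lnp v ^+ 3 ->
  om v <= c * om u.
Proof.
move=> c0 h; have ou := om_gt0 u; have ov := om_gt0 v.
have ou' := ltW ou; have ov' := ltW ov.
rewrite -(@ler_pXn2r _ 2) ?nnegrE //; last exact: mulr_ge0.
rewrite exprMn.
have l3u : 0 < lnp u ^+ 3 by rewrite exprn_gt0 // lnp_gt0.
have l3v : 0 < lnp v ^+ 3 by rewrite exprn_gt0 // lnp_gt0.
rewrite -(ler_pM2r l3v) om_sqr -(om_sqr u) mulrAC.
have -> : om u * lnp u ^+ 3 * om u = om u ^+ 2 * lnp u ^+ 3 by ring.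
have -> : c ^+ 2 * om u ^+ 2 * lnp v ^+ 3 = om u ^+ 2 * (c ^+ 2 * lnp v ^+ 3) by ring.
by apply: ler_wpM2l => //; exact: sqr_ge0.
Qed.

Lemma om_le u v : u <= v -> om v <= om u.
Proof.
move=> uv; rewrite -[leRHS]mul1r; apply: om_le_scaled => //.
rewrite expr1n mul1r; apply: lerXn2r; rewrite ?nnegrE ?(ltW (lnp_gt0 _)) //.
exact: lnp_le.
Qed.

Lemma om_growth u v : u <= v -> om u <= expR (3 / 2 * (v - u)) * om v.
Proof.
move=> uv; apply: om_le_scaled; first exact: expR_ge0.
have -> : expR (3 / 2 * (v - u)) ^+ 2 = expR (v - u) ^+ 3.
  by rewrite -!expRM_natl; congr expR; lra.
rewrite -exprMn; apply: lerXn2r; rewrite ?nnegrE ?mulr_ge0 ?expR_ge0 ?(ltW (lnp_gt0 _)) //.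
exact: lnp_growth.
Qed.

Lemma om_lnp_le1 v : 1 <= lnp v -> om v * lnp v <= 1 <= om v * lnp v ^+ 2.
Proof.
move=> l1; have o0 := om_gt0 v; have := om_sqr v.
have e1 : (om v * lnp v) ^+ 2 * lnp v = om v ^+ 2 * lnp v ^+ 3 by ring.
have e2 : (om v * lnp v ^+ 2) ^+ 2 = om v ^+ 2 * lnp v ^+ 3 * lnp v by ring.
move: e1 e2; set a := om v * lnp v; set b := om v * lnp v ^+ 2 => e1 e2 e.
have a0 : 0 <= a by rewrite mulr_ge0 ?ltW // ?lnp_gt0.
have b0 : 0 <= b by rewrite mulr_ge0 ?sqr_ge0 // ltW.
rewrite e in e1 e2; clearbody a b; apply/andP; split; nra.
Qed.

(** [lnp x ^ 3 (1 + e^x) e^{-3x}] is nonincreasing: its derivative has the sign of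
    [3 e^x - (3 + 2 e^x) lnp x], which the Pade bound makes nonpositive. *)
Lemma lnp_cube_growth u v : u <= v ->
  lnp v ^+ 3 * (1 + expR v) * expR (3 * u) <= lnp u ^+ 3 * (1 + expR u) * expR (3 * v).
Proof.
move=> uv.
pose f x := - (lnp x ^+ 3 * (1 + expR x) * expR (- 3 * x)).
pose f' x := lnp x ^+ 2 * expR (- 3 * x) * (lnp x * (3 + 2 * expR x) - 3 * expR x).
have df x : u <= x <= v -> is_derive x 1 f (f' x).
  move=> _.
  have d1 := is_deriveX 3 (is_derive_lnp x).
  have d2 := is_deriveD (is_derive_cst (1 : R) x 1) (is_derive_expR x).
  have := is_deriveN (is_deriveM (is_deriveM d1 d2) (is_derive_expRZ (- 3) x)).
  rewrite /GRing.scale /= => d.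
  have -> : f = - (@lnp R ^+ 3 * (cst 1 + @expR R) * (fun y => expR (- 3 * y))).
    by apply/funext => y; rewrite /f !fctE.
  apply: (is_derive_eq d); rewrite /f' !fctE /=.
  have : 1 + expR x != 0 by have := expR_gt0 x; lra.
  by move: (lnp x) (expR x) (expR (_ * x)) => A B C ?; field.
have f0 x : u <= x <= v -> 0 <= f' x.
  move=> _; rewrite /f' mulr_ge0 //; first by rewrite mulr_ge0 ?expR_ge0 ?sqr_ge0.
  have := @ln1D_ge_pade R (expR x) (expR_ge0 x); rewrite -/(lnp x).
  have := expR_gt0 x; move: (expR x) (lnp x) => y L y0.
  by rewrite ler_pdivrMr; [nra|lra].
have := le_of_derive_ge0 uv df f0; rewrite /f lerN2 => h.
have e x : expR (- 3 * x) * expR (3 * x) = 1.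
  by rewrite -expRD -mulrDl addNr mul0r expR0.
have h1 := ler_wpM2r (ltW (mulr_gt0 (expR_gt0 (3 * u)) (expR_gt0 (3 * v)))) h.
move: h1; rewrite {1}(mulrC (expR (3 * u))) !mulrA.
rewrite -(mulrA _ (expR (-3 * v))) e mulr1.
by rewrite -(mulrA _ (expR (-3 * u))) e mulr1.
Qed.

(** Up to factors of [w] alone, this is how the kernel of an upward jump to [w] depends on its
    starting point, the singular denominator aside. With [x = e^t] and [A = 1 + e^{-w}], squaring
    and [lnp_cube_growth] reduce the claim to the monotonicity of [x (1 + x) / (1 + A x)^2], which
    follows from [A x <= 1 + x], that is, from [t <= w]. *)
Lemma om_expR2_le u v w : u <= v -> v <= w ->
  om u * expR (2 * u) / (1 + (1 + expR (- w)) * expR u) <=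
  om v * expR (2 * v) / (1 + (1 + expR (- w)) * expR v).
Proof.
move=> uv vw.
have x0 := expR_gt0 v; have z0 := expR_gt0 u.
have zx : expR u <= expR v by rewrite ler_expR.
have A1 : 1 <= 1 + expR (- w) by have := expR_gt0 (- w); lra.
have Ax : (1 + expR (- w)) * expR v <= 1 + expR v.
  by rewrite mulrDl mul1r addrC lerD2r -expRD expR_le1; lra.
have := lnp_cube_growth uv.
have e n t : expR (n%:R * t) = expR t ^+ n by rewrite expRM_natl.
rewrite !e.
move: A1 Ax zx x0 z0; set x := expR v; set z := expR u; set A := 1 + expR (- w).
move=> A1 Ax zx x0 z0 h.
have p1 : 0 < 1 + A * z by nra.
have p2 : 0 < 1 + A * x by nra.
rewrite ler_pdivrMr // mulrAC ler_pdivlMr //.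
have key : om u <= (x ^+ 2 * (1 + A * z) / (z ^+ 2 * (1 + A * x))) * om v.
  apply: om_le_scaled.
    by rewrite divr_ge0 // mulr_ge0 ?sqr_ge0 // ltW.
  rewrite exprMn exprVn [leRHS]mulrAC ler_pdivlMr; last first.
    by rewrite exprn_gt0 // mulr_gt0 // exprn_gt0.
  have L0 : 0 < lnp u ^+ 3 by rewrite exprn_gt0 // lnp_gt0.
  have poly : (1 + z) * z * (1 + A * x) ^+ 2 <= (1 + x) * x * (1 + A * z) ^+ 2.
    have -> : (1 + x) * x * (1 + A * z) ^+ 2 = (1 + z) * z * (1 + A * x) ^+ 2 +
       (x - z) * (1 + x + z + 2 * A * x * z - A * A * x * z) by ring.
    rewrite lerDl mulr_ge0 //; first lra.
    have : A * z * (A * x) <= A * z * (1 + x) by rewrite ler_wpM2l //; nra.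
    have : A * z <= A * x by rewrite ler_wpM2l //; lra.
    have : 0 <= A * x * z by rewrite !mulr_ge0 //; lra.
    by nra.
  have x1 : 0 < 1 + x by lra.
  rewrite -(ler_pM2r x1) -(ler_pM2r (exprn_gt0 3 z0)).
  have -> : lnp v ^+ 3 * (z ^+ 2 * (1 + A * x)) ^+ 2 * (1 + x) * z ^+ 3 =
    (lnp v ^+ 3 * (1 + x) * z ^+ 3) * (z ^+ 4 * (1 + A * x) ^+ 2) by ring.
  apply: (@le_trans _ _ ((lnp u ^+ 3 * (1 + z) * x ^+ 3) * (z ^+ 4 * (1 + A * x) ^+ 2))).
    by rewrite ler_wpM2r // mulr_ge0 ?sqr_ge0 // exprn_ge0 // ltW.
  have -> : lnp u ^+ 3 * (1 + z) * x ^+ 3 * (z ^+ 4 * (1 + A * x) ^+ 2) =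
    lnp u ^+ 3 * x ^+ 3 * z ^+ 3 * ((1 + z) * z * (1 + A * x) ^+ 2) by ring.
  have -> : (x ^+ 2 * (1 + A * z)) ^+ 2 * lnp u ^+ 3 * (1 + x) * z ^+ 3 =
    lnp u ^+ 3 * x ^+ 3 * z ^+ 3 * ((1 + x) * x * (1 + A * z) ^+ 2) by ring.
  have x3 := exprn_gt0 3 x0; have z3 := exprn_gt0 3 z0.
  have K0 := ltW (mulr_gt0 (mulr_gt0 L0 x3) z3).
  exact: ler_wpM2l.
have z2 : 0 < z ^+ 2 * (1 + A * x) by rewrite mulr_gt0 // exprn_gt0.
rewrite mulrAC ler_pdivlMr // in key.
move: key; rewrite -!mulrA => key; move: (om u) (om v) key => a b key.
rewrite (mulrA a) -!mulrA; nra.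
Qed.

Lemma sig_gt0 m x : 0 < sig m x.
Proof.
rewrite sig.unlock; have := expR_gt0 m; have := expR_gt0 (- x).
by move=> a0 b0; apply: divr_gt0; lra.
Qed.

Lemma sig_le2 m x : sig m x <= 2.
Proof.
rewrite sig.unlock; have := expR_gt0 m; have := expR_gt0 (- x) => a0 b0.
by rewrite ler_pdivrMr; lra.
Qed.

Lemma sig_le_sum m x : sig m x <= expR m + 2 * expR (- x).
Proof.
rewrite sig.unlock; have := expR_gt0 m; have := expR_gt0 (- x) => a0 b0.
rewrite ler_pdivrMr; last lra.
by move: (expR m) (expR _) a0 b0 => a b; nra.
Qed.

(** The derivative in [e^m] has the sign of [1 - e^{-x}], hence the condition [0 <= x']; in [e^{-x}]
    the fraction always increases. *)
Lemma sig_le m m' x x' : 0 <= x' -> m <= m' -> x' <= x -> sig m x <= sig m' x'.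
Proof.
move=> x0 mm xx; rewrite sig.unlock.
have e1 : expR (- x') <= 1 by rewrite expR_le1; lra.
have := expR_gt0 m; have := expR_gt0 (- x); have := expR_gt0 m'.
have := expR_gt0 (- x') => a0 b0 c0 d0.
have h1 : expR m <= expR m' by rewrite ler_expR.
have h2 : expR (- x) <= expR (- x') by rewrite ler_expR lerN2.
rewrite ler_pdivrMr; last lra.
rewrite mulrAC ler_pdivlMr; last lra.
move: (expR m) (expR m') (expR (- x)) (expR (- x')) a0 b0 c0 d0 h1 h2 e1 => a b c d.
nra.
Qed.

Lemma sig_ge m x : 0 <= x -> expR m / (2 + expR m) <= sig m x.
Proof.
move=> x0; rewrite sig.unlock; have := expR_gt0 m; have := expR_gt0 (- x).
have : expR (- x) <= 1 by rewrite expR_le1; lra.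
move=> h a0 b0; rewrite ler_pdivrMr; last lra.
rewrite mulrAC ler_pdivlMr; last lra.
by move: (expR m) (expR (- x)) h a0 b0 => a b; nra.
Qed.

Lemma closexx a : 0 <= a -> forall rho, 0 <= rho -> close rho a a.
Proof.
move=> a0 rho r0; have : 1 <= expR rho by rewrite -expR0 ler_expR.
by split; nra.
Qed.

Lemma close_sym rho a b : close rho a b -> close rho b a.
Proof. by case. Qed.

Lemma close_le rho rho' a b : 0 <= a -> 0 <= b -> rho <= rho' ->
  close rho a b -> close rho' a b.
Proof.
move=> a0 b0 rr [h1 h2]; have : expR rho <= expR rho' by rewrite ler_expR.
by split; nra.
Qed.

Lemma closeM rho rho' a b c d : 0 <= a -> 0 <= b -> 0 <= c -> 0 <= d ->
  close rho a b -> close rho' c d -> close (rho + rho') (a * c) (b * d).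
Proof.
move=> a0 b0 c0 d0 [h1 h2] [h3 h4]; rewrite /close expRD.
by split; rewrite mulrACA; apply: ler_pM.
Qed.

Lemma closeD rho a b c d : close rho a b -> close rho c d ->
  close rho (a + c) (b + d).
Proof. by move=> [h1 h2] [h3 h4]; split; rewrite mulrDr lerD. Qed.

Lemma closeV rho a b : 0 < a -> 0 < b -> close rho a b -> close rho a^-1 b^-1.
Proof.
move=> a0 b0 [h1 h2]; split.
  by rewrite ler_pdivlMr // mulrC ler_pdivrMr // mulrC.
by rewrite ler_pdivlMr // mulrC ler_pdivrMr // mulrC.
Qed.

Lemma close_expR rho x y : `|x - y| <= rho -> close rho (expR x) (expR y).
Proof.
rewrite ler_norml => /andP[h1 h2].
by split; rewrite -expRD ler_expR; lra.
Qed.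

Lemma close_dist rho a b : close rho a b -> 0 <= a -> 0 <= b -> 0 <= rho ->
  `|a - b| <= rho * expR rho * b.
Proof.
move=> [h1 h2] a0 b0 r0.
have k : expR rho - 1 <= rho * expR rho.
  have := subr1_expRN_le rho; have := expR_gt0 rho.
  rewrite expRN => e0 h.
  have := ler_wpM2r (ltW e0) h; rewrite mulrBl mul1r mulVf ?gt_eqF //.
rewrite ler_norml; apply/andP; split; last nra.
have : b - a <= (expR rho - 1) * a by nra.
have : (expR rho - 1) * a <= rho * expR rho * a by rewrite ler_wpM2r.
have [ab|ba] := leP a b; last by nra.
have : rho * expR rho * a <= rho * expR rho * b.
  by rewrite ler_wpM2l // mulr_ge0 // expR_ge0.
by nra.
Qed.

Lemma close_om u v : close (3 / 2 * `|u - v|) (om u) (om v).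
Proof.
wlog uv : u v / u <= v => [h|].
  have [/h //|/ltW /h] := leP u v.
  by rewrite distrC => /close_sym.
rewrite distrC ger0_norm ?subr_ge0 //.
split; first exact: om_growth.
apply: le_trans (om_le uv) _; rewrite ler_peMl ?(ltW (om_gt0 _)) //.
by rewrite -expR0 ler_expR mulr_ge0 ?subr_ge0.
Qed.

Lemma close_lnp u v : close `|u - v| (lnp u) (lnp v).
Proof.
wlog uv : u v / u <= v => [h|].
  have [/h //|/ltW /h] := leP u v.
  by rewrite distrC => /close_sym.
rewrite distrC ger0_norm ?subr_ge0 //.
split; last exact: lnp_growth.
apply: le_trans (lnp_le uv) _; rewrite ler_peMl ?(ltW (lnp_gt0 _)) //.
by rewrite -expR0 ler_expR; lra.
Qed.

Lemma close_sig m m' x x' :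
  close (2 * (`|m - m'| + `|x - x'|)) (sig m x) (sig m' x').
Proof.
have n1 := normr_ge0 (m - m'); have n2 := normr_ge0 (x - x').
pose rho := `|m - m'| + `|x - x'|.
have c1 : close rho (expR m) (expR m') by apply: close_expR; rewrite /rho; lra.
have c2 : close rho (expR (- x)) (expR (- x')).
  by apply: close_expR; rewrite opprK addrC distrC /rho; lra.
have p1 := expR_gt0 m; have p2 := expR_gt0 m'.
have p3 := expR_gt0 (- x); have p4 := expR_gt0 (- x').
rewrite sig.unlock -/rho (_ : 2 * rho = rho + rho); last by ring.
apply: closeM; rewrite ?invr_ge0; try lra.
  apply: closeD => //.
  by move: c2 => [? ?]; split; lra.
apply: closeV; try lra.
by apply: closeD => //; apply: closeD => //; apply: closexx; rewrite /rho; lra.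
Qed.

(** By concavity, [1 - e^{-kx} <= k (1 - e^{-x})] for [k >= 1]. *)
Lemma close_subr1_expRN rho z z' : 0 <= z -> 0 <= z' -> 0 <= rho -> close rho z z' ->
  close rho (1 - expR (- z)) (1 - expR (- z')).
Proof.
have key k x : 0 <= x -> 1 <= k -> 1 - expR (- (k * x)) <= k * (1 - expR (- x)).
  move=> x0 k1.
  pose f y := y * (1 - expR (- x)) - (1 - expR (- x * y)).
  have : f 1 <= f k.
    pose f' y := 1 - expR (- x) - x * expR (- x * y).
    apply: (@le_of_derive_ge0 _ f f' _ _ k1) => y /andP[y1 _].
      have d1 := is_deriveM (is_derive_id y 1) (is_derive_cst (1 - expR (- x)) y 1).
      have d2 := is_deriveB (is_derive_cst (1 : R) y 1) (is_derive_expRZ (- x) y).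
      have := is_deriveB d1 d2; rewrite /GRing.scale /= => d.
      by apply: (is_derive_eq d); rewrite /f'; ring.
    rewrite /f'; have := subr1_expRN_ge x.
    have : expR (- x * y) <= expR (- x) by rewrite ler_expR; nra.
    by nra.
  by rewrite /f mul1r mulr1 subrr subr_ge0 mulrC mulrN mulrC.
move=> z0 z0' r0 [h1 h2]; have e1 : 1 <= expR rho by rewrite -expR0 ler_expR.
split.
  by apply: le_trans (key _ _ z0' e1); rewrite lerD2l lerN2 ler_expR lerN2.
by apply: le_trans (key _ _ z0 e1); rewrite lerD2l lerN2 ler_expR lerN2.
Qed.

End Profiles.

(** * The kernel *)

Section Continuity.
Variable R : realType.
Implicit Types f g : R -> R.

Lemma contD f g : continuous f -> continuous g -> continuous (fun x => f x + g x).
Proof. by move=> cf cg x; exact: (cvgD (cf x) (cg x)). Qed.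
Lemma contB f g : continuous f -> continuous g -> continuous (fun x => f x - g x).
Proof. by move=> cf cg x; exact: (cvgB (cf x) (cg x)). Qed.
Lemma contN f : continuous f -> continuous (fun x => - f x).
Proof. by move=> cf x; exact: (cvgN (cf x)). Qed.
Lemma contM f g : continuous f -> continuous g -> continuous (fun x => f x * g x).
Proof. by move=> cf cg x; exact: (cvgM (cf x) (cg x)). Qed.
Lemma contV f : (forall x, f x != 0) -> continuous f -> continuous (fun x => (f x)^-1).
Proof. by move=> f0 cf x; exact: (cvgV (f0 x) (cf x)). Qed.
Lemma cont_norm f : continuous f -> continuous (fun x => `|f x|).
Proof. by move=> cf x; exact: (cvg_norm (cf x)). Qed.
Lemma cont_max f g : continuous f -> continuous g ->
  continuous (fun x => Num.max (f x) (g x)).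
Proof. by move=> cf cg x; exact: (continuous_max (cf x) (cg x)). Qed.
Lemma cont_min f g : continuous f -> continuous g ->
  continuous (fun x => Num.min (f x) (g x)).
Proof. by move=> cf cg x; exact: (continuous_min (cf x) (cg x)). Qed.
Lemma cont_cst (c : R) : continuous (fun _ : R => c).
Proof. by move=> x; exact: cvg_cst. Qed.
Lemma cont_id : continuous (fun x : R => x).
Proof. by move=> x; exact: cvg_id. Qed.
Lemma cont_expR f : continuous f -> continuous (fun x => expR (f x)).
Proof. by move=> cf x; exact: (continuous_comp (cf x) (@continuous_expR R (f x))). Qed.
Lemma cont_ln f : (forall x, 0 < f x) -> continuous f -> continuous (fun x => ln (f x)).
Proof. by move=> f0 cf x; exact: (continuous_comp (cf x) (continuous_ln (f0 x))). Qed.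

End Continuity.

Section Admissible.
Variables (R : realType) (p : params R).
Hypothesis adm : admissible p.
Implicit Types u v w x y z : R.
Local Notation nbar := (par_nbar p).
Local Notation alpha := (par_alpha p).
Local Notation mu := (par_mu p).
Local Notation a := (par_a p).
Local Notation gamma0 := (par_gamma0 p).
Local Notation kappa := (par_kappa p).
Local Notation mu' := (par_mu' p).
Local Notation b0 := (par_b0 p).
Local Notation m0 := (par_m0 p).
Local Notation eps0 := (par_eps0 p).
Local Notation E := (eps p).

Lemma nbar_gt0 : 0 < nbar. Proof. by case: adm => -[]. Qed.
Lemma alpha_bounds : 0 < alpha < 1 / 6.
Proof. by case: adm => -[_ /andP[h1 h2] _ _] _; apply/andP; split; lra. Qed.
Lemma mu_bounds : 1 / 3 <= mu <= 7 / 16.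
Proof. by case: adm => -[]. Qed.
Lemma a_ge9 : 9 <= a. Proof. by case: adm => -[]. Qed.
Lemma gamma0_bounds : 0 < gamma0 <= 1 / 8.
Proof. by case: adm => _ [[]]. Qed.
Lemma kappa_ge7 : 7 <= kappa. Proof. by case: adm => _ [[]]. Qed.
Lemma mu'_gt0 : 0 < mu'.
Proof. by case: adm => -[_ _ /andP[h _] _] [[_ _ h' _] _]; lra. Qed.
Lemma b0_ge10 : 10 <= b0. Proof. by case: adm => _ [[]]. Qed.
Lemma m0_bounds : 2 * a1 p <= m0 /\ b0 + 2 <= m0.
Proof. by case: adm => _ [_ [+ _]]; rewrite ge_max => /andP[]. Qed.
Lemma eps0_gt0 : 0 < eps0. Proof. by case: adm => _ [_ []]. Qed.
Lemma a1E : a = 13 / 25 * a1 p.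
Proof. by rewrite /a1 /c0; field. Qed.
Lemma a1_ge17 : 17 <= a1 p.
Proof. by have := a_ge9; rewrite a1E; lra. Qed.

Definition gam : R := mu' / gamma0.

Lemma gam_gt0 : 0 < gam.
Proof. by rewrite divr_gt0 ?mu'_gt0 //; case/andP: gamma0_bounds. Qed.

Lemma eps_gt0 v : 0 < E v.
Proof. by rewrite /eps mulr_gt0 ?eps0_gt0 ?expR_gt0. Qed.

Lemma eps_le u v : u <= v -> E v <= E u.
Proof.
move=> uv; rewrite /eps ler_pM2l ?eps0_gt0 // ler_expR lerN2 ler_pM2l ?gam_gt0 //.
by apply: le_max2 => //.
Qed.

Lemma eps_growth u v : u <= v -> E u <= expR (gam * (v - u)) * E v.
Proof.
move=> uv; rewrite /eps mulrCA ler_pM2l ?eps0_gt0 // -expRD ler_expR -/gam.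
rewrite -!mulrN -mulrDr ler_pM2l ?gam_gt0 //.
by rewrite /Num.max; case: ifP => h1; case: ifP => h2; lra.
Qed.

Lemma close_eps u v : close (gam * `|u - v|) (E u) (E v).
Proof.
have g0 := gam_gt0.
wlog uv : u v / u <= v => [h|].
  have [/h //|/ltW /h] := leP u v.
  by rewrite distrC => /close_sym.
rewrite distrC ger0_norm ?subr_ge0 //.
split; first exact: eps_growth.
apply: le_trans (eps_le uv) _; rewrite ler_peMl ?(ltW (eps_gt0 _)) //.
by rewrite -expR0 ler_expR mulr_ge0 ?subr_ge0 // ltW.
Qed.

Lemma eps_const u v : u <= a1 p -> v <= a1 p -> E u = E v.
Proof. by move=> h1 h2; rewrite /eps !max_l. Qed.

Lemma eps_le0 v : E v <= eps0.
Proof.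
rewrite /eps ler_piMr ?(ltW eps0_gt0) // expR_le1 oppr_le0 mulr_ge0 ?(ltW gam_gt0) //.
by rewrite le_max; have := a1_ge17; lra.
Qed.

End Admissible.

(* Off the diagonal every regularized kernel of the paper is [kap] times an
   elementary factor of [|v - w|]: multiplying [1 / (1 - e^{-x})] by the
   regularization amounts to replacing [x] by [max(x, eps)]. *)
HB.lock Definition kap (R : realType) (p : params R) (v w : R) : R :=
  4 * par_nbar p * om v * lnp w * expR (v - Num.max v w) * sig (Num.min v w) `|v - w|
  / (1 - expR (- Num.max `|v - w| (eps p (Num.max v w)))).

Section Kernel.
Variables (R : realType) (p : params R).
Hypothesis adm : admissible p.
Implicit Types u v w x y z : R.
Local Notation nbar := (par_nbar p).
Local Notation b0 := (par_b0 p).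
Local Notation m0 := (par_m0 p).
Local Notation E := (eps p).
Local Notation K := (kap p).

Definition width v w : R := Num.max `|v - w| (E (Num.max v w)).

Lemma width_gt0 v w : 0 < width v w.
Proof. by rewrite /width lt_max (eps_gt0 adm) orbT. Qed.

Lemma den_gt0 v w : 0 < 1 - expR (- width v w).
Proof. exact: subr1_expRN_gt0 (width_gt0 v w). Qed.

Lemma kap_gt0 v w : 0 < K v w.
Proof.
rewrite kap.unlock divr_gt0 ?den_gt0 // !mulr_gt0 ?om_gt0 ?lnp_gt0 ?expR_gt0 ?sig_gt0 //.
by rewrite (nbar_gt0 adm).
Qed.

Lemma kap_ge0 v w : 0 <= K v w.
Proof. exact/ltW/kap_gt0. Qed.

Lemma kap_below v w : w <= v ->
  K v w = 4 * nbar * om v * lnp w * sig w (v - w) / (1 - expR (- Num.max (v - w) (E v))).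
Proof.
by move=> wv; rewrite kap.unlock (max_l wv) (min_r wv) subrr expR0 mulr1 ger0_norm ?subr_ge0.
Qed.

Lemma kap_above v w : v <= w ->
  K v w = 4 * nbar * om v * lnp w * expR (- (w - v)) * sig v (w - v)
    / (1 - expR (- Num.max (w - v) (E w))).
Proof.
move=> vw; rewrite kap.unlock (max_r vw) (min_l vw) opprB distrC ger0_norm ?subr_ge0 //.
Qed.

Lemma reg_frac (x e : R) : 0 < x -> 0 < e ->
  (1 - expR (- Num.min e x)) / (1 - expR (- e)) =
  (1 - expR (- x)) / (1 - expR (- Num.max x e)).
Proof.
move=> x0 e0; have := subr1_expRN_gt0 x0; have := subr1_expRN_gt0 e0 => h1 h2.
have [ex|xe] := leP e x; last by [].
by rewrite !divff ?gt_eqF.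
Qed.

Lemma K32e_kap v w : w < v -> K32e p v w = K v w * (1 - expR (- (v - w))).
Proof.
move=> wv; have x0 : 0 < v - w by rewrite subr_gt0.
have wv' := ltW wv.
rewrite /K32e /reg (max_l wv') (gtr0_norm x0) (reg_frac x0 (eps_gt0 adm v)).
rewrite (kap_below wv') /K32 om.unlock sig.unlock.
by rewrite !mulrA mulrAC.
Qed.

Lemma K31e_kap v w : w < v -> K31e p v w = K v w * expR (- (v - w)).
Proof.
move=> wv; have x0 : 0 < v - w by rewrite subr_gt0.
have -> : K31e p v w = K32e p v w * (expR (- (v - w)) / (1 - expR (- (v - w)))).
  by rewrite /K31e /K32e /reg /K31 mulrAC.
rewrite (K32e_kap wv) -!mulrA; congr (_ * _); rewrite mulrCA divff ?mulr1 //.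
by rewrite gt_eqF // subr1_expRN_gt0.
Qed.

Lemma K3e_kap v w : w != v -> K3e p v w = K v w.
Proof.
rewrite neq_lt => /orP[wv|vw].
  have -> : K3e p v w = K31e p v w + K32e p v w.
    by rewrite /K3e /K31e /K32e /reg /K3 wv mulrDl.
  by rewrite (K31e_kap wv) (K32e_kap wv) -mulrDr addrC subrK mulr1.
have x0 : 0 < w - v by rewrite subr_gt0.
rewrite /K3e /reg /K3 ltNge (ltW vw) /= (max_r (ltW vw)) distrC (gtr0_norm x0).
rewrite (reg_frac x0 (eps_gt0 adm w)) (kap_above (ltW vw)) om.unlock sig.unlock.
have n0 : 1 - expR (- (w - v)) != 0 by rewrite gt_eqF // subr1_expRN_gt0.
rewrite -!mulrA; do 3 congr (_ * _).
rewrite (mulKf n0); congr (_ * _); rewrite [RHS]mulrCA; congr (_ * _).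
by rewrite mulrCA.
Qed.

Lemma K3bar2e_kap v w : v < w -> K3bar2e p v w = K v w * expR (- ((w - v) / 2)).
Proof.
move=> vw; have -> : K3bar2e p v w = K3e p v w * expR (- ((w - v) / 2)).
  by rewrite /K3bar2e /K3e /reg /K3bar2 mulrAC.
by rewrite K3e_kap // gt_eqF.
Qed.

Lemma inv_subr1_expRN_le z z' : 0 < z -> z <= z' ->
  (1 - expR (- z'))^-1 <= (1 - expR (- z))^-1.
Proof.
move=> z0 zz; have z0' := lt_le_trans z0 zz.
by rewrite lef_pV2 ?posrE ?subr1_expRN_gt0 // lerD2l lerN2 ler_expR lerN2.
Qed.

(** The regular factor is [om_expR2_le]; the singular one grows as the starting point approaches
    [w], and [eps] is taken at [w] for both kernels. *)
Lemma kap_mono_above u v w : u <= v -> v <= w -> K u w <= K v w.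
Proof.
move=> uv vw; have uw := le_trans uv vw.
have sE t : t <= w -> om t * expR (- (w - t)) * sig t (w - t) =
   (om t * expR (2 * t) / (1 + (1 + expR (- w)) * expR t)) * (expR (- w) * (1 + 2 * expR (- w))).
  move=> tw; rewrite sig.unlock.
  have -> : expR (- (w - t)) = expR t * expR (- w) by rewrite -expRD; congr expR; ring.
  rewrite expRM_natl; have := expR_gt0 t; have := expR_gt0 (- w).
  move: (expR t) (expR (- w)) => A B B0 A0; field.
  rewrite gt_eqF //; nra.
rewrite (kap_above vw) (kap_above uw).
have F t : 4 * nbar * om t * lnp w * expR (- (w - t)) * sig t (w - t) =
    4 * nbar * lnp w * (om t * expR (- (w - t)) * sig t (w - t)) by ring.
have E0 := eps_gt0 adm w.
rewrite !F; apply: ler_pM.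
- rewrite !mulr_ge0 ?(ltW (om_gt0 _)) ?(ltW (lnp_gt0 _)) ?expR_ge0 ?(ltW (sig_gt0 _ _)) //.
  exact/ltW/(nbar_gt0 adm).
- by rewrite invr_ge0 ltW // subr1_expRN_gt0 // lt_max E0 orbT.
- rewrite ler_wpM2l //.
    by rewrite !mulr_ge0 ?(ltW (lnp_gt0 _)) //; exact/ltW/(nbar_gt0 adm).
  rewrite !sE // ler_wpM2r ?om_expR2_le //.
- apply: inv_subr1_expRN_le; first by rewrite lt_max E0 orbT.
  by rewrite ge_max !le_max lexx orbT andbT; lra.
Qed.

Lemma continuous_lnp : continuous (@lnp R).
Proof.
apply: cont_ln => [x|]; first by have := expR_gt0 x; lra.
by apply: contD; [exact: cont_cst | apply: cont_expR; exact: cont_id].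
Qed.

Lemma continuous_kap v : continuous (K v).
Proof.
have cmax := cont_max (@cont_cst R v) (@cont_id R).
have cmin := cont_min (@cont_cst R v) (@cont_id R).
have cdist := cont_norm (contB (@cont_cst R v) (@cont_id R)).
have ceps : continuous (fun w => E (Num.max v w)).
  rewrite /eps; apply: contM; first exact: cont_cst.
  apply: cont_expR; apply: contN; apply: contM; first exact: cont_cst.
  by apply: cont_max => //; exact: cont_cst.
have -> : K v = fun w => 4 * par_nbar p * om v * lnp w * expR (v - Num.max v w) *
    sig (Num.min v w) `|v - w| / (1 - expR (- Num.max `|v - w| (E (Num.max v w)))).
  by rewrite kap.unlock.
apply: contM; last first.
  apply: contV => [w|]; first by rewrite gt_eqF // den_gt0.
  apply: contB; first exact: cont_cst.
  by apply: cont_expR; apply: contN; apply: cont_max.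
apply: contM.
  apply: contM; last first.
    by apply: cont_expR; apply: contB; first exact: cont_cst.
  by apply: contM; [exact: cont_cst | exact: continuous_lnp].
rewrite sig.unlock; have cem := cont_expR cmin; have ced := cont_expR (contN cdist).
apply: contM.
  by apply: contD => //; apply: contM => //; exact: cont_cst.
apply: contV => [w|].
  have := expR_gt0 (Num.min v w); have := expR_gt0 (- `|v - w|) => ? ?.
  by rewrite gt_eqF //; lra.
by apply: contD => //; apply: contD => //; exact: cont_cst.
Qed.

(* The regularization freezes the singular factor at distance [eps u], so the
   monotonicity below needs either [w] outside that zone or [eps] constant. *)
Lemma kap_mono_below u v w : w < u -> u <= v ->
  E u <= u - w \/ u <= - m0 -> K v w <= K u w.
Proof.
move=> wu uv hyp; have wu' := ltW wu; have wv := le_trans wu' uv.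
rewrite (kap_below wv) (kap_below wu').
have n0 := nbar_gt0 adm; have lw := lnp_gt0 w.
have F t : 4 * nbar * om t * lnp w * sig w (t - w) / (1 - expR (- Num.max (t - w) (E t)))
   = (4 * nbar * lnp w) * (om t * (sig w (t - w) / (1 - expR (- Num.max (t - w) (E t))))).
  by ring.
rewrite !F ler_wpM2l ?mulr_ge0 ?(ltW lw) ?(ltW n0) //.
have ou := om_gt0 u; have ov := om_gt0 v.
have su : sig w (v - w) <= sig w (u - w) by apply: sig_le => //; lra.
have sp := sig_gt0 w (v - w).
have zu : 0 < Num.max (u - w) (E u) by rewrite lt_max (eps_gt0 adm) orbT.
have zv : 0 < Num.max (v - w) (E v) by rewrite lt_max (eps_gt0 adm) orbT.
have zu' := subr1_expRN_gt0 zu; have zv' := subr1_expRN_gt0 zv.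
have [zz|zz] := leP (Num.max (u - w) (E u)) (Num.max (v - w) (E v)).
  apply: ler_pM; rewrite ?(ltW ov) ?om_le //.
    by rewrite mulr_ge0 ?invr_ge0 ?ltW.
  apply: ler_pM; rewrite ?invr_ge0 ?(ltW sp) ?(ltW zv') //.
  exact: inv_subr1_expRN_le.
(* The truncated distance can shrink from [u] to [v] only because [eps] drops, which forces
   [v > a1], whereas [u <= - m0]. So far apart, [om u] is at least twice [om v], and this pays for a
   singular factor of at most 2 at [v]. *)
have um : u <= - m0.
  case: hyp => // euw; exfalso; move: zz; rewrite (max_l euw) gt_max => /andP[].
  by move=> h _; lra.
have a17 := a1_ge17 adm; have [ma _] := m0_bounds adm.
have va : a1 p < v.
  rewrite ltNge; apply/negP => va; move: zz.
  rewrite (@eps_const _ p u v); [|lra|exact: va].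
  rewrite gt_max !lt_max ltxx !orbF => /andP[h1 h2].
  by case/orP: h1; lra.
have x1 : 1 <= Num.max (v - w) (E v) by rewrite le_max; apply/orP; left; lra.
have D2 : (1 - expR (- Num.max (v - w) (E v)))^-1 <= 2.
  rewrite invf_ple ?posrE //.
  have : expR (- Num.max (v - w) (E v)) <= expR (- 1) by rewrite ler_expR; lra.
  have : expR (- 1) <= 2^-1 :> R by rewrite expRN lef_pV2 ?posrE ?expR_gt0 // expR1_ge2.
  by lra.
have D1 : 1 <= (1 - expR (- Num.max (u - w) (E u)))^-1.
  by rewrite invf_ge1 //; have := expR_gt0 (- Num.max (u - w) (E u)); lra.
have O2 : om v * 2 <= om u.
  have : om (-2) <= om u by apply: om_le; lra.
  have l2 : 2 * lnp (-2) <= (1:R).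
    have := lnp_le_expR (-2 : R); have := expR2_ge3 R.
    rewrite expRN => h; have : (expR 2)^-1 <= 5^-1 :> R by rewrite lef_pV2 ?posrE ?expR_gt0.
    by lra.
  have l1 : 1 <= lnp v by have := lnp_ge_id v; lra.
  have /andP[lo1 _] := om_lnp_le1 l1.
  have o1' : om v <= 1 by nra.
  have := om_sqr (-2 : R); have := om_gt0 (-2 : R); have := lnp_gt0 (-2 : R).
  move: (om (-2)) (lnp (-2)) l2 => o l l2 l0 o0 e o2.
  have l3 : l ^+ 3 <= 8^-1.
    have : l ^+ 3 <= (2^-1) ^+ 3 by apply: lerXn2r; rewrite ?nnegrE; lra.
    by lra.
  suff : 2 <= o by lra.
  rewrite leNgt; apply/negP => o2'.
  have : o ^+ 2 < 4 by nra.
  have : 0 < l ^+ 3 by rewrite exprn_gt0.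
  by move: (l ^+ 3) (o ^+ 2) l3 e => A B; nra.
have S0 := sig_gt0 w (u - w).
move: O2 D1 D2 su sp; set A := (_)^-1; set B := (1 - expR (- Num.max (v - w) _))^-1.
move=> O2 D1 D2 su sp.
apply: (@le_trans _ _ (om v * (sig w (u - w) * 2))).
  rewrite ler_wpM2l ?(ltW ov) //; apply: ler_pM => //; first exact: ltW.
  by rewrite /B invr_ge0 ltW.
rewrite mulrCA (mulrCA (om u)) ler_wpM2l ?(ltW S0) //.
by apply: le_trans O2 _; rewrite ler_peMr // ltW.
Qed.

End Kernel.

(** * Kernel bounds *)

(* The product weight [gwt v * hwt (v - r)] controls [Ku - Ls] by [Vt] plus a
   constant, and dominates [Gammabar] with room to spare at infinity. *)
Definition hwt (R : realType) (u : R) : R := expR (Num.max (- u) 0 / 2).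
Definition gwt (R : realType) (p : params R) (v : R) : R :=
  expR (Num.max (v - a1 p) 0 / 2).

Section KernelBounds.
Variables (R : realType) (p : params R).
Hypothesis adm : admissible p.
Implicit Types u v w x y z rho : R.
Local Notation nbar := (par_nbar p).
Local Notation b0 := (par_b0 p).
Local Notation m0 := (par_m0 p).
Local Notation eps0 := (par_eps0 p).
Local Notation E := (eps p).
Local Notation K := (kap p).
Local Notation g := (gwt p).
Local Notation h := (@hwt R).

Lemma hwt_gt0 u : 0 < h u. Proof. exact: expR_gt0. Qed.
Lemma gwt_gt0 v : 0 < g v. Proof. exact: expR_gt0. Qed.
Lemma hwt_ge1 u : 1 <= h u.
Proof. by rewrite -expR0 ler_expR divr_ge0 // le_max lexx orbT. Qed.
Lemma gwt_ge1 v : 1 <= g v.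
Proof. by rewrite -expR0 ler_expR divr_ge0 // le_max lexx orbT. Qed.
Lemma hwt_le u v : u <= v -> h v <= h u.
Proof. by move=> uv; rewrite ler_expR ler_pM2r // le_max2 // lerN2. Qed.
Lemma gwt_le u v : u <= v -> g u <= g v.
Proof. by move=> uv; rewrite ler_expR ler_pM2r // le_max2 // lerB. Qed.
Lemma gwt_small v : v <= a1 p -> g v = 1.
Proof. by move=> va; rewrite /gwt max_r ?mul0r ?expR0 // subr_le0. Qed.
Lemma gwt_growth v w : v <= w -> g w <= expR ((w - v) / 2) * g v.
Proof.
move=> vw; rewrite /gwt -expRD ler_expR -mulrDl ler_pM2r ?invr_gt0 //.
by rewrite ge_max; apply/andP; split; rewrite /Num.max; case: ifP; lra.
Qed.
Lemma hwt_pos u : 0 <= u -> h u = 1.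
Proof. by move=> u0; rewrite /hwt max_r ?mul0r ?expR0 // oppr_le0. Qed.
Lemma hwt_neg u : u <= 0 -> h u = expR (- u / 2).
Proof. by move=> u0; rewrite /hwt max_l // oppr_ge0. Qed.
Lemma hwt_growth u w : w <= u -> h w <= expR ((u - w) / 2) * h u.
Proof.
move=> vw; rewrite /hwt -expRD ler_expR -mulrDl ler_pM2r ?invr_gt0 //.
by rewrite ge_max; apply/andP; split; rewrite /Num.max; case: ifP; lra.
Qed.

(** Template for upper bounds: [sig <= 2] turns the 4 into 8, and majorants of the other factors are
    supplied by each use. *)
Lemma kap_le_factors v w o l z : om v <= o -> lnp w * expR (v - Num.max v w) <= l ->
  0 < z -> z <= width p v w ->
  K v w <= 8 * nbar * o * l / (1 - expR (- z)).
Proof.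
move=> vo wl z0 zw; rewrite kap.unlock -/(width p v w).
have n0 := nbar_gt0 adm; have ov := om_gt0 v.
have l0 : 0 <= lnp w * expR (v - Num.max v w).
  by rewrite mulr_ge0 ?expR_ge0 // ltW // lnp_gt0.
have s0 := sig_gt0 (Num.min v w) `|v - w|.
have s2 := sig_le2 (Num.min v w) `|v - w|.
apply: ler_pM; last exact: inv_subr1_expRN_le.
- by rewrite !mulr_ge0 ?expR_ge0 // ltW // lnp_gt0.
- by rewrite invr_ge0 ltW // den_gt0.
have -> : 4 * nbar * om v * lnp w * expR (v - Num.max v w) * sig (Num.min v w) `|v - w| =
  (om v * (lnp w * expR (v - Num.max v w)) * sig (Num.min v w) `|v - w|) * (4 * nbar) by ring.
have -> : 8 * nbar * o * l = o * l * 2 * (4 * nbar) by ring.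
rewrite ler_wpM2r ?mulr_ge0 ?(ltW n0) //.
apply: ler_pM => //; first by rewrite mulr_ge0 // ltW.
  exact: ltW.
by apply: ler_pM => //; exact: ltW.
Qed.

Lemma width_ge v w t s : 0 <= s -> (v <= t /\ w <= t) \/ s <= `|v - w| ->
  Num.min s (E t) <= width p v w.
Proof.
move=> s0 [[vt wt]|sd]; rewrite /width ge_min !le_max.
  by apply/orP; right; rewrite (eps_le adm) ?orbT // ge_max vt wt.
by rewrite sd.
Qed.

Lemma width_floor_gt0 s t : 0 < s -> 0 < Num.min s (E t).
Proof. by move=> s0; rewrite lt_min s0 (eps_gt0 adm). Qed.

(** The true rate is 1 on both sides, up to the linear growth of [lnp] above; 3/4 absorbs this
    growth and still exceeds the rate 1/2 of the weights [gwt] and [hwt]. *)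
Lemma kap_decay rho : exists2 C : R, 0 < C &
  forall v w, `|v| <= rho -> K v w <= C * expR (- (3 / 4 * `|w|)).
Proof.
pose z := Num.min 1 (E (rho + 1)).
have z0 : 0 < z := width_floor_gt0 (rho + 1) ltr01.
have d0 := subr1_expRN_gt0 z0.
exists (8 * nbar * om (- rho) * (4 * expR rho) / (1 - expR (- z))).
  by rewrite divr_gt0 // !mulr_gt0 ?expR_gt0 ?om_gt0 ?(nbar_gt0 adm).
move=> v w; rewrite ler_norml => /andP[v1 v2].
have -> : 8 * nbar * om (- rho) * (4 * expR rho) / (1 - expR (- z)) * expR (- (3 / 4 * `|w|))
  = 8 * nbar * om (- rho) * (4 * expR rho * expR (- (3 / 4 * `|w|))) / (1 - expR (- z)).
  by rewrite mulrAC !mulrA.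
apply: kap_le_factors => //; first exact: om_le.
- have [w0|/ltW w0] := leP 0 w.
    rewrite (ger0_norm w0).
    apply: (@le_trans _ _ ((1 + w) * expR (rho - w))).
      apply: ler_pM; rewrite ?expR_ge0 ?(ltW (lnp_gt0 _)) ?lnp_le_1D //.
      rewrite ler_expR; have : w <= Num.max v w by rewrite le_max lexx orbT.
      lra.
    have -> : 4 * expR rho * expR (- (3 / 4 * w)) = 4 * expR (w / 4) * expR (rho - w).
      by rewrite -!mulrA -!expRD; congr (_ * expR _); field.
    by rewrite ler_wpM2r ?expR_ge0 //; have := expR_ge1Dx (w / 4); lra.
  rewrite (ler0_norm w0).
  apply: (@le_trans _ _ (expR w * 1)).
    apply: ler_pM; rewrite ?expR_ge0 ?(ltW (lnp_gt0 _)) ?lnp_le_expR //.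
    by rewrite expR_le1 subr_le0 le_max lexx.
  rewrite mulr1 (_ : - (3 / 4 * - w) = 3 / 4 * w); last by ring.
  apply: (@le_trans _ _ (expR rho * expR (3 / 4 * w))).
    by rewrite -expRD ler_expR; lra.
  have : 0 <= expR rho * expR (3 / 4 * w) by rewrite mulr_ge0 ?expR_ge0.
  lra.
- apply: width_ge => //; have [wr|rw] := leP w (rho + 1).
    by left; split; lra.
  by right; rewrite ler_normr; apply/orP; right; lra.
Qed.

Lemma om_lnp_bound w t : w <= t -> - m0 <= t -> om t * lnp w <= 1 + om (- m0).
Proof.
move=> wt mt; apply: (@le_trans _ _ (om t * lnp t)).
  by rewrite ler_wpM2l ?(ltW (om_gt0 _)) // lnp_le.
have o1 := om_gt0 (- m0); have ot := om_le mt; have o2 := om_gt0 t.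
have [l1|l1] := leP 1 (lnp t); first by have /andP[] := om_lnp_le1 l1; lra.
by have := lnp_gt0 t; nra.
Qed.

(** A bound [C / E u] on a zone of length [E u] is a bounded mass. If [v - w < E u], then
    [v - u < eps0], so that [E v] and [E u] differ by a factor of at most [k]; otherwise the
    distance [v - w] itself bounds the denominator. *)
Lemma kap_near : exists2 C : R, 0 < C & forall u v w,
  - m0 <= u -> u <= v -> u - E u <= w -> w < u -> K v w <= C / E u.
Proof.
pose k := expR (gam p * eps0).
have k1 : 1 <= k.
  by rewrite -expR0 ler_expR mulr_ge0 ?(ltW (gam_gt0 adm)) ?(ltW (eps0_gt0 adm)).
exists (8 * nbar * (1 + om (- m0)) * (k * expR eps0)).
  rewrite !mulr_gt0 ?expR_gt0 ?(nbar_gt0 adm) //.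
  by have := om_gt0 (- m0); lra.
move=> u v w mu uv wE wu; have wv : w <= v by lra.
have E0 := eps_gt0 adm u; have kE0 : 0 < E u / k by rewrite divr_gt0 // expR_gt0.
have zw : E u / k <= Num.max (v - w) (E v).
  have [Ex|xE] := leP (E u) (v - w).
    rewrite le_max; apply/orP; left; apply: le_trans Ex.
    by rewrite ler_pdivrMr ?expR_gt0 // ler_peMr // ltW.
  rewrite le_max; apply/orP; right; rewrite ler_pdivrMr ?expR_gt0 // mulrC.
  apply: le_trans (eps_growth adm uv) _.
  rewrite ler_pM2r ?(eps_gt0 adm) // ler_expR ler_pM2l ?(gam_gt0 adm) //.
  by have := eps_le0 adm u; lra.
have kEle : E u / k <= eps0.
  apply: le_trans (eps_le0 adm u); rewrite ler_pdivrMr ?expR_gt0 //.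
  by rewrite ler_peMr // ltW.
rewrite (kap_below p wv).
have sv0 := sig_gt0 w (v - w); have sv2 := sig_le2 w (v - w).
have D : (1 - expR (- Num.max (v - w) (E v)))^-1 <= k * expR eps0 / E u.
  apply: le_trans (inv_subr1_expRN_le kE0 zw) _.
  rewrite invf_ple ?posrE ?subr1_expRN_gt0 //; last first.
    by rewrite divr_gt0 // mulr_gt0 // expR_gt0.
  apply: le_trans (subr1_expRN_ge _).
  have -> : (k * expR eps0 / E u)^-1 = E u / k * expR (- eps0).
    by rewrite invf_div invfM expRN mulrA.
  by rewrite ler_pM2l // ler_expR lerN2.
have -> : 8 * nbar * (1 + om (- m0)) * (k * expR eps0) / E u =
  (4 * nbar * ((1 + om (- m0)) * 2)) * (k * expR eps0 / E u).
  by rewrite -mulrA; congr (_ * _); ring.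
apply: ler_pM => //.
- by rewrite !mulr_ge0 ?(ltW (om_gt0 _)) ?(ltW (lnp_gt0 _)) ?(ltW sv0) ?(ltW (nbar_gt0 adm)).
- by rewrite invr_ge0 ltW // subr1_expRN_gt0 // lt_max (eps_gt0 adm) orbT.
rewrite -!mulrA ler_pM2l // ler_pM2l ?(nbar_gt0 adm) // mulrA.
apply: ler_pM; rewrite ?(ltW sv0) //.
  by rewrite mulr_ge0 ?(ltW (om_gt0 _)) ?(ltW (lnp_gt0 _)).
by apply: om_lnp_bound => //; lra.
Qed.

(** For negative [w], [lnp w <= e^w] beats [h w = e^{-w/2}]; for [w >= 0] both weights are 1. *)
Lemma kap_hwt_loss : exists2 C : R, 0 < C & forall u w, - m0 <= u -> w < u ->
  K u w * (h w / h u - 1) <= C * expR (- (`|w| / 4)).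
Proof.
pose z := Num.min 1 (E 1).
have z0 : 0 < z := width_floor_gt0 1 ltr01.
have d0 := subr1_expRN_gt0 z0.
exists (8 * nbar * om (- m0) * 1 / (1 - expR (- z))).
  by rewrite divr_gt0 // !mulr_gt0 ?om_gt0 ?(nbar_gt0 adm).
move=> u w mu wu; have h1 := hwt_ge1 u.
have [w0|w0] := leP 0 w.
  have u0 : 0 <= u by lra.
  by rewrite !hwt_pos // divr1 subrr mulr0 mulr_ge0 ?expR_ge0 // divr_ge0 ?(ltW d0)
    // !mulr_ge0 ?(ltW (om_gt0 _)) ?(ltW (nbar_gt0 adm)).
have w0' := ltW w0.
apply: (@le_trans _ _ (K u w * h w)).
  rewrite ler_wpM2l ?kap_ge0 //.
  have : h w / h u <= h w by rewrite ler_pdivrMr ?hwt_gt0 // ler_peMr // ltW // hwt_gt0.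
  lra.
rewrite (hwt_neg w0') (ltr0_norm w0).
have kb : K u w <= 8 * nbar * om (- m0) * expR w / (1 - expR (- z)).
  apply: kap_le_factors => //; first exact: om_le.
    by rewrite max_l ?(ltW wu) // subrr expR0 mulr1 lnp_le_expR.
  apply: width_ge => //; have [wr|rw] := leP u 1.
    by left; split; lra.
  by right; rewrite ler_normr; apply/orP; left; lra.
apply: le_trans (ler_wpM2r (expR_ge0 _) kb) _.
have -> : 8 * nbar * om (- m0) * expR w / (1 - expR (- z)) * expR (- w / 2) =
   (8 * nbar * om (- m0) * 1 / (1 - expR (- z))) * (expR w * expR (- w / 2)).
  by rewrite mulr1; ring.
rewrite ler_pM2l; last by rewrite divr_gt0 // !mulr_gt0 ?om_gt0 ?(nbar_gt0 adm).
by rewrite -expRD ler_expR; lra.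
Qed.

(** As [u] tends to minus infinity the kernel grows like [e^{-u/2}], so the weight gained by a
    downward jump of length [y] cannot be treated as an error; it is paid by the weight saved on an
    upward jump of the same length. As [eps] is constant here, the denominators agree, and the ratio
    of the kernels is at least [e^{-y} e^{3y/2} = e^{y/2}], exactly the ratio of [e^{y/2} - 1] to
    [1 - e^{-y/2}]. *)
Lemma kap_reflect u y : u <= - m0 -> 0 < y -> u + y <= - b0 ->
  K u (u - y) * (expR (y / 2) - 1) <= K u (u + y) * (1 - expR (- (y / 2))).
Proof.
move=> um y0 uyb; have [m1 m2] := m0_bounds adm; have a17 := a1_ge17 adm.
have b10 := b0_ge10 adm.
have l1 : u - y <= u by lra.
have l2 : u <= u + y by lra.
rewrite (kap_below p l1) (kap_above p l2).
have -> : u - (u - y) = y by ring.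
have -> : u + y - u = y by ring.
have -> : E (u + y) = E u by apply: eps_const; lra.
have Lg : expR (3 / 4 * (2 * y)) * lnp (u - y) <= lnp (u + y).
  have := @lnp_growth_lower R (u - y) (u + y) ltac:(lra) ltac:(lra).
  by rewrite (_ : u + y - (u - y) = 2 * y) //; ring.
have S : sig (u - y) y <= sig u y by apply: sig_le; lra.
have -> : expR (y / 2) - 1 = expR (y / 2) * (1 - expR (- (y / 2))).
  by rewrite mulrBr mulr1 expRxMexpNx_1.
rewrite mulrA ler_wpM2r //.
  by rewrite subr_ge0 expR_le1; lra.
rewrite mulrAC ler_wpM2r //.
  by rewrite invr_ge0 ltW // subr1_expRN_gt0 // lt_max y0.
have n0 := nbar_gt0 adm; have ou := om_gt0 u.
have -> : 4 * nbar * om u * lnp (u - y) * sig (u - y) y * expR (y / 2) =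
  (4 * nbar * om u) * ((expR (y / 2) * lnp (u - y)) * sig (u - y) y) by ring.
have -> : 4 * nbar * om u * lnp (u + y) * expR (- y) * sig u y =
  (4 * nbar * om u) * ((expR (- y) * lnp (u + y)) * sig u y) by ring.
rewrite ler_wpM2l ?mulr_ge0 ?(ltW n0) ?(ltW ou) //.
apply: ler_pM => //; [|exact/ltW/sig_gt0|].
  by rewrite mulr_ge0 ?expR_ge0 // ltW // lnp_gt0.
have := ler_wpM2l (expR_ge0 (- y)) Lg; rewrite mulrA -expRD.
by rewrite (_ : - y + 3 / 4 * (2 * y) = y / 2) //; field.
Qed.

(** These are the downward jumps whose reflection [2u - w] lies at or above [-b0], out of reach of
    [kap_reflect]. The exponents of [om u], [lnp w], [sig] and the weights add up to [3w/2 - 2u], at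
    most [w/2 + b0] in this range. *)
Lemma kap_far_below : exists2 C : R, 0 < C & forall u w, u <= - m0 -> w <= 2 * u + b0 ->
  K u w * (h w / h u) <= C * expR (- (`|w| / 4)).
Proof.
exists (4 * nbar * (om 0 * 6 * expR b0)).
  by rewrite !mulr_gt0 ?om_gt0 ?expR_gt0 ?(nbar_gt0 adm).
move=> u w um wb; have [m1 m2] := m0_bounds adm; have a17 := a1_ge17 adm.
have b10 := b0_ge10 adm; have wu : w <= u by lra.
have w0 : w <= 0 by lra.
have u0 : u <= 0 by lra.
rewrite (hwt_neg w0) (hwt_neg u0) -expRB (kap_below p wu) (ler0_norm w0).
have n0 := nbar_gt0 adm; have ou := om_gt0 u; have s0 := sig_gt0 w (u - w).
rewrite -!mulrA ler_pM2l // ler_pM2l //.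
have o1 : om u <= expR (- (3 / 2 * u)) * om 0.
  by have := om_growth u0; rewrite sub0r mulrN.
have l1 := lnp_le_expR w.
have s1 : sig w (u - w) <= 3 * expR (w - u).
  have := sig_le_sum w (u - w); rewrite opprB.
  have : expR w <= expR (w - u) by rewrite ler_expR; lra.
  lra.
have d1 : (1 - expR (- Num.max (u - w) (E u)))^-1 <= 2.
  have x1 : 1 <= Num.max (u - w) (E u) by rewrite le_max; apply/orP; left; lra.
  rewrite invf_ple ?posrE ?subr1_expRN_gt0 //; last lra.
  have : expR (- Num.max (u - w) (E u)) <= expR (- 1) by rewrite ler_expR; lra.
  have : expR (- 1) <= 2^-1 :> R by rewrite expRN lef_pV2 ?posrE ?expR_gt0 // expR1_ge2.
  by lra.
have d0 : 0 <= (1 - expR (- Num.max (u - w) (E u)))^-1.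
  by rewrite invr_ge0 ltW // subr1_expRN_gt0 // lt_max (eps_gt0 adm) orbT.
have l0 := lnp_gt0 w.
apply: (@le_trans _ _ ((expR (- (3 / 2 * u)) * om 0) * (expR w * (3 * expR (w - u) *
   (2 * expR (- w / 2 - - u / 2)))))).
  apply: ler_pM => //; first exact: ltW.
    by rewrite !mulr_ge0 ?expR_ge0 // ltW.
  apply: ler_pM => //; first exact: ltW.
    by rewrite !mulr_ge0 ?expR_ge0 // ltW.
  apply: ler_pM => //; first exact: ltW.
    by rewrite !mulr_ge0 ?expR_ge0.
  by rewrite ler_wpM2r ?expR_ge0.
have -> : expR (- (3 / 2 * u)) * om 0 * (expR w * (3 * expR (w - u) *
   (2 * expR (- w / 2 - - u / 2)))) =
   om 0 * 6 * (expR (- (3 / 2 * u)) * expR w * expR (w - u) * expR (- w / 2 - - u / 2)) by ring.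
rewrite [leRHS]mulrA ler_pM2l; last first.
  by rewrite mulr_gt0 // om_gt0.
by rewrite -!expRD ler_expR; lra.
Qed.

End KernelBounds.

(** * Integrals over the line *)

Section Integration.
Variable R : realType.
Local Notation leb := (@lebesgue_measure R).
Implicit Types (F G : R -> R) (u v w x y c : R).

Definition Int F : R := rint setT F.
Definition ig F : Prop := leb.-integrable setT (EFin \o F).
Definition mf F : Prop := measurable_fun [set: R] F.
Definition chi (b : bool) : R := b%:R.

Lemma mfD F G : mf F -> mf G -> mf (fun w => F w + G w).
Proof. exact: measurable_funD. Qed.
Lemma mfB F G : mf F -> mf G -> mf (fun w => F w - G w).
Proof. exact: measurable_funB. Qed.
Lemma mfM F G : mf F -> mf G -> mf (fun w => F w * G w).
Proof. exact: measurable_funM. Qed.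
Lemma mf_cst c : mf (fun=> c).
Proof. exact: measurable_cst. Qed.
Lemma mf_id : mf (fun w => w).
Proof. exact: measurable_id. Qed.
Lemma mf_norm F : mf F -> mf (fun w => `|F w|).
Proof. by move=> mF; exact: measurableT_comp. Qed.
Lemma mf_cont F : continuous F -> mf F.
Proof. exact: continuous_measurable_fun. Qed.
Lemma mf_if (P : R -> bool) F G : measurable_fun [set: R] P -> mf F -> mf G ->
  mf (fun w => if P w then F w else G w).
Proof. by move=> mP mF mG; exact: measurable_fun_ifT. Qed.

Lemma meas_lt F G : mf F -> mf G -> measurable_fun [set: R] (fun w => F w < G w).
Proof. exact: measurable_fun_ltr. Qed.
Lemma meas_le F G : mf F -> mf G -> measurable_fun [set: R] (fun w => F w <= G w).
Proof. exact: measurable_fun_ler. Qed.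
Lemma meas_eq F G : mf F -> mf G -> measurable_fun [set: R] (fun w => F w == G w).
Proof. exact: measurable_fun_eqr. Qed.
Lemma meas_and (P Q : R -> bool) : measurable_fun [set: R] P -> measurable_fun [set: R] Q ->
  measurable_fun [set: R] (fun w => P w && Q w).
Proof. exact: measurable_and. Qed.

Lemma mf_chi (P : R -> bool) : measurable_fun [set: R] P -> mf (fun w => chi (P w)).
Proof.
move=> mP; have -> : (fun w => chi (P w)) = fun w => if P w then 1 else 0.
  by apply/funext => w; rewrite /chi; case: (P w).
by apply: mf_if => //; exact: mf_cst.
Qed.

Lemma ig_mf F : ig F -> mf F.
Proof. by move=> /integrableP[/measurable_EFinP]. Qed.

Lemma igD F G : ig F -> ig G -> ig (fun w => F w + G w).
Proof. by move=> iF iG; have := integrableD measurableT iF iG. Qed.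
Lemma igB F G : ig F -> ig G -> ig (fun w => F w - G w).
Proof. by move=> iF iG; have := integrableB measurableT iF iG. Qed.
Lemma igZ c F : ig F -> ig (fun w => c * F w).
Proof. by move=> iF; have := integrableZl measurableT c iF. Qed.
Lemma igN F : ig F -> ig (fun w => - F w).
Proof. by move=> iF; have := integrableN iF. Qed.
Lemma ig0 : ig (fun=> 0).
Proof. exact: integrable0. Qed.
Lemma ig_norm F : ig F -> ig (fun w => `|F w|).
Proof. by move=> iF; have := integrable_abse iF. Qed.

Lemma ig_dom F G : mf F -> ig G -> (forall w, `|F w| <= G w) -> ig F.
Proof.
move=> mF iG h; apply: (le_integrable measurableT _ _ iG).
  exact/measurable_EFinP.
by move=> w _ /=; rewrite lee_fin (le_trans (h w)) // ler_norm.
Qed.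

Lemma IntD F G : ig F -> ig G -> Int (fun w => F w + G w) = Int F + Int G.
Proof. by move=> iF iG; exact: RintegralD. Qed.
Lemma IntB F G : ig F -> ig G -> Int (fun w => F w - G w) = Int F - Int G.
Proof. by move=> iF iG; exact: RintegralB. Qed.
Lemma IntZ c F : ig F -> Int (fun w => c * F w) = c * Int F.
Proof. by move=> iF; exact: RintegralZl. Qed.
Lemma IntN F : ig F -> Int (fun w => - F w) = - Int F.
Proof.
move=> iF; have -> : (fun w => - F w) = fun w => (-1) * F w.
  by apply/funext => w; rewrite mulN1r.
by rewrite IntZ // mulN1r.
Qed.
Lemma Int_le F G : ig F -> ig G -> (forall w, F w <= G w) -> Int F <= Int G.
Proof. by move=> iF iG h; apply: le_Rintegral. Qed.
Lemma Int_ge0 F : (forall w, 0 <= F w) -> 0 <= Int F.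
Proof. by move=> h; apply: Rintegral_ge0. Qed.
Lemma eq_Int F G : F =1 G -> Int F = Int G.
Proof. by move=> /funext ->. Qed.
Lemma Int_norm F : ig F -> `|Int F| <= Int (fun w => `|F w|).
Proof. by move=> iF; apply: le_normr_Rintegral. Qed.

Lemma Int_norm_le F G : mf F -> ig G -> (forall w, `|F w| <= G w) -> `|Int F| <= Int G.
Proof.
move=> mF iG h; have iF := ig_dom mF iG h.
by apply: le_trans (Int_norm iF) _; apply: Int_le => //; exact: ig_norm.
Qed.

Lemma ig_chiM (P : R -> bool) F : measurable_fun [set: R] P -> ig F ->
  ig (fun w => chi (P w) * F w).
Proof.
move=> mP iF; apply: (ig_dom _ (ig_norm iF)).
  by apply: mfM; [exact: mf_chi | exact: ig_mf].
by move=> w; rewrite normrM /chi; case: (P w); rewrite ?normr1 ?mul1r // normr0 mul0r.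
Qed.

Lemma rint_chi (i : interval R) F :
  rint [set` i] F = Int (fun w => chi (w \in i) * F w).
Proof.
rewrite /rint Rintegral_mkcond; apply: eq_Int => w.
rewrite patchE /chi mem_setE.
by case: (w \in i); rewrite ?mul1r ?mul0r.
Qed.

Lemma ig_mkcond (i : interval R) F : leb.-integrable [set` i] (EFin \o F) ->
  ig (fun w => chi (w \in i) * F w).
Proof.
move=> h; have mi : measurable ([set` i] : set (measurableTypeR R)) by exact: measurable_itv.
have {}h := iffLR (integrable_mkcond _ mi) h; rewrite /ig.
suff -> : EFin \o (fun w => chi (w \in i) * F w) = ((EFin \o F) \_ [set` i]) by [].
apply/funext => w; rewrite patchE /= mem_setE /chi.
by case: (w \in i); rewrite ?mul1r ?mul0r.
Qed.

(** The kernels agree with [kap] only off the diagonal, and a pair [(v, r)] has two diagonal points,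
    [v - r] and [v]; hence the two exceptional points in the lemmas below. *)
Lemma offE F G u v : (forall w, w != u -> w != v -> F w = G w) ->
  F = fun w => if w == u then F u else if w == v then F v else G w.
Proof.
move=> h; apply/funext => w.
by have [->//|wu] := eqVneq w u; have [->//|wv] := eqVneq w v; exact: h.
Qed.

Lemma mf_off F G u v : (forall w, w != u -> w != v -> F w = G w) -> mf G -> mf F.
Proof.
move=> /offE -> mG.
apply: mf_if; first by apply: meas_eq; [exact: mf_id | exact: mf_cst].
  exact: mf_cst.
apply: mf_if => //; last exact: mf_cst.
by apply: meas_eq; [exact: mf_id | exact: mf_cst].
Qed.

Lemma eq_off_integral (F G : measurableTypeR R -> \bar R) u v :
  measurable_fun setT F -> measurable_fun setT G ->
  (forall w, w != u -> w != v -> F w = G w) ->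
  (\int[leb]_(w in setT) F w = \int[leb]_(w in setT) G w)%E.
Proof.
move=> mF mG h; apply: ae_eq_integral => //.
exists [set u; v]; split => //=.
- exact: measurableU.
- apply/eqP; rewrite eq_le measure_ge0 andbT.
  have : (leb ([set u] `|` [set v]) <= leb [set u] + leb [set v])%E by apply: measureU2.
  by rewrite !lebesgue_measure_set1 adde0.
- move=> w /= hw; apply: contrapT => nw; apply: hw => _; apply: h.
    by apply/eqP => e; apply: nw; left.
  by apply/eqP => e; apply: nw; right.
Qed.

Lemma Int_off F G u v : mf G -> (forall w, w != u -> w != v -> F w = G w) ->
  Int F = Int G.
Proof.
move=> mG h; rewrite /Int /rint /Rintegral; congr fine.
apply: (@eq_off_integral _ _ u v) => //.
- by apply/measurable_EFinP; exact: mf_off h mG.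
- exact/measurable_EFinP.
- by move=> w wu wv; rewrite h.
Qed.

Lemma ig_off F G u v : ig G -> (forall w, w != u -> w != v -> F w = G w) -> ig F.
Proof.
move=> iG h; have mG := ig_mf iG; have mF := mf_off h mG.
apply/integrableP; split; first exact/measurable_EFinP.
move/integrableP : iG => [_].
have -> // : (\int[leb]_w `|(EFin \o F) w| = \int[leb]_w `|(EFin \o G) w|)%E.
apply: (@eq_off_integral _ _ u v).
- by apply: measurableT_comp => //; exact/measurable_EFinP.
- by apply: measurableT_comp => //; exact/measurable_EFinP.
- by move=> w wu wv /=; rewrite h.
Qed.

(** Reflections are the only change of variables: they serve to compare jumps below and above [u],
    and a translation is the product of two of them. *)
Definition refl c (w : measurableTypeR R) : measurableTypeR R := c - w.

Lemma meas_refl c : measurable_fun [set: measurableTypeR R] (refl c).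
Proof.
by apply: (@mf_cont (fun w => c - w)); apply: contB; [exact: cont_cst | exact: cont_id].
Qed.

HB.instance Definition _ c := isMeasurableFun.Build _ _ _ _ (refl c) (meas_refl c).

Lemma refl_measure c (A : set (measurableTypeR R)) : measurable A ->
  leb A = pushforward leb (refl c) A.
Proof.
move=> mA; apply: lebesgue_measure_unique => //= _ [[a b]] _ <-.
rewrite /pushforward /=.
have -> : refl c @^-1` [set` `]a, b]] = [set` `[(c - b), (c - a)[].
  apply/seteqP; split => w /=; rewrite !in_itv /= /refl => /andP[h1 h2]; apply/andP; split; lra.
rewrite !lebesgue_measure_itv /= !lte_fin ltrD2l ltrN2.
by case: ifP => // _; rewrite -!EFinB; congr EFin; lra.
Qed.

Lemma integral_refl_measure c (f : measurableTypeR R -> \bar R) :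
  (\int[leb]_w f w = \int[pushforward leb (refl c)]_w f w)%E.
Proof. by apply: eq_measure_integral => A mA _; exact: refl_measure. Qed.

Lemma ig_refl c F : ig F -> ig (fun w => F (c - w)).
Proof.
move=> iF; have mF := ig_mf iF.
have mrF : measurable_fun [set: measurableTypeR R] (EFin \o F \o refl c).
  by apply: measurableT_comp; [exact/measurable_EFinP | exact: meas_refl].
apply/integrableP; split => //.
move/integrableP : iF => [_].
rewrite (integral_refl_measure c) ge0_integral_pushforward //.
by apply: measurableT_comp => //; exact/measurable_EFinP.
Qed.

Lemma Int_refl c F : ig F -> Int (fun w => F (c - w)) = Int F.
Proof.
move=> iF; have irF := ig_refl c iF; have mF := ig_mf iF.
rewrite /Int /rint /Rintegral; congr fine.
rewrite [RHS](integral_refl_measure c) integral_pushforward //.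
exact/measurable_EFinP.
Qed.

Lemma ig_shift c F : ig F -> ig (fun w => F (w + c)).
Proof.
move=> iF; have := ig_refl 0 (ig_refl c iF).
by congr ig; apply/funext => w; congr F; ring.
Qed.

Lemma Int_shift c F : ig F -> Int (fun w => F (w + c)) = Int F.
Proof.
move=> iF; rewrite -(Int_refl c iF) -(Int_refl 0 (ig_refl c iF)).
by apply: eq_Int => w; congr F; ring.
Qed.

Lemma ig_seg x y : ig (fun w => chi (x <= w <= y)).
Proof.
have h : leb.-integrable `[x, y] (EFin \o (fun=> 1 : R)).
  by apply: continuous_compact_integrable; [exact: segment_compact | apply: continuous_subspaceT; exact: cont_cst].
have := ig_mkcond h; congr ig; apply/funext => w.
by rewrite mulr1 in_itv.
Qed.

Lemma Int_seg x y : x <= y -> Int (fun w => chi (x <= w <= y)) = y - x.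
Proof.
move=> xy.
have -> : Int (fun w => chi (x <= w <= y)) = rint `[x, y] (fun=> 1).
  by rewrite rint_chi; apply: eq_Int => w; rewrite mulr1 in_itv.
have -> : rint `[x, y] (fun=> 1) = 1 * fine (leb `[x, y]) by exact: Rintegral_cst.
rewrite mul1r lebesgue_measure_itv /= lte_fin.
by case: ltgtP xy => // -> _; rewrite subrr.
Qed.

Lemma cvg_expR_decay c : 0 < c -> expR (- c * x) @[x --> +oo] --> (0 : R).
Proof.
move=> c0; have h1 : c * x @[x --> +oo] --> +oo.
  by apply: gt0_cvgMry => //; exact: cvg_id.
have := cvg_comp _ _ h1 (@cvgr_expR R).
have -> // : (fun x => expR (- x)) \o *%R c = (fun x => expR (- c * x)) :> (R -> R).
by apply/funext => x /=; rewrite mulNr.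
Qed.

Lemma ig_decay c : 0 < c -> ig (fun w => expR (- (c * `|w|))).
Proof.
move=> c0; have nc0 : - c != 0 by lra.
have cE : continuous (fun w : R => expR (- c * w)).
  by apply: cont_expR; apply: contM; [exact: cont_cst | exact: cont_id].
pose F w := (- c)^-1 * expR (- c * w).
have dF x : is_derive x 1 F (expR (- c * x)).
  have := is_deriveM (is_derive_cst ((- c)^-1 : R) x 1) (is_derive_expRZ (- c) x).
  rewrite /GRing.scale /= => d; apply: (is_derive_eq d).
  by rewrite mulr0 addr0 mulrA mulVf // mul1r.
have h : leb.-integrable `[0, +oo[ (EFin \o (fun w => expR (- c * w))).
  apply/integrableP; split.
    by apply/measurable_EFinP; apply: measurable_funTS; exact: mf_cont.
  have e : (\int[leb]_(w in `[0%R, +oo[) (expR (- c * w))%:E = (0 : R)%:E - (F 0)%:E)%E.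
    apply: (@ge0_continuous_FTC2y R _ F).
    - by move=> x _; exact: expR_ge0.
    - by apply: continuous_subspaceT.
    - by rewrite -(mulr0 (- c)^-1); apply: cvgMr; exact: cvg_expR_decay.
    - by move=> x _; have [] := dF x.
    - apply: cvg_at_right_filter; apply: cvgMr; exact: cE.
    - by move=> x _; rewrite derive1E; have [_ ->] := dF x.
  under eq_integral do rewrite /= ger0_norm ?expR_ge0 //.
  by rewrite e ltry.
have {}h : ig (fun w => chi (0 <= w) * expR (- c * w)).
  have := ig_mkcond h; congr ig; apply/funext => w.
  by rewrite in_itv /= andbT.
apply: (ig_dom _ (igD h (ig_refl 0 h))).
  by apply: mf_cont; apply: cont_expR; apply: contN; apply: contM;
    [exact: cont_cst | apply: cont_norm; exact: cont_id].
move=> w; rewrite ger0_norm ?expR_ge0 // sub0r /chi.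
have [w0|w0] := leP 0 w.
  rewrite mul1r mulNr ger0_norm // lerDl mulr_ge0 ?expR_ge0 //.
rewrite mul0r add0r oppr_ge0 (ltW w0) mul1r (ltr0_norm w0) mulNr.
exact: lexx.
Qed.

End Integration.

(** * Integral representation of the operators *)

Section Representation.
Variables (R : realType) (p : params R).
Hypothesis adm : admissible p.
Local Notation b0 := (par_b0 p).
Local Notation m0 := (par_m0 p).
Local Notation E := (eps p).
Local Notation K := (kap p).
Implicit Types (F G : R -> R) (u v w x y c : R).

(** All kernels are real, so the two components of a complex function decouple; indexing them by a
    boolean treats both at once. *)
Definition pr (b : bool) (z : R[i]) : R := if b then complex.Re z else complex.Im z.

Lemma prD b (y z : R[i]) : pr b (y + z) = pr b y + pr b z.
Proof. by case: y z b => [? ?] [? ?] []. Qed.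
Lemma prN b z : pr b (- z) = - pr b z.
Proof. by case: z b => ? ? []. Qed.
Lemma prB b (y z : R[i]) : pr b (y - z) = pr b y - pr b z.
Proof. by rewrite prD prN. Qed.
Lemma pr_scale b x z : pr b (x%:C%C * z) = x * pr b z.
Proof. by case: z b => ? ? [] /=; rewrite mul0r ?subr0 ?addr0. Qed.
Lemma ind_chi (t : bool) : ind R t = (chi R t)%:C%C.
Proof. by rewrite /ind /chi; case: t. Qed.
Lemma pr_ind b (t : bool) z : pr b (ind R t * z) = chi R t * pr b z.
Proof. by rewrite ind_chi pr_scale. Qed.
Lemma pr_cint b (S : set R) (F : R -> R[i]) : pr b (cint S F) = rint S (fun w => pr b (F w)).
Proof. by case: b. Qed.

(** The signed indicator that turns [ocint x y] into an integral over the line. *)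
Definition ochi x y w : R :=
  if x <= y then chi R (x <= w <= y) else - chi R (y <= w <= x).

Lemma meas_itv (i : interval R) : measurable_fun [set: R] (fun w => w \in i).
Proof.
case: i => [[[] x|[]] [[] y|[]]]; rewrite /in_mem /= ?andbF ?andbT;
  do ?[exact: measurable_cst]; do ?apply: meas_and; do ?[apply: meas_lt | apply: meas_le];
  do ?[exact: mf_id | exact: mf_cst].
all: by under eq_fun do rewrite ?andbF //=; exact: measurable_cst.
Qed.

Lemma mf_ochi x y : mf (ochi x y).
Proof.
have h s t : mf (fun w => chi R (s <= w <= t)).
  by apply: mf_chi; apply: meas_and; apply: meas_le; [exact: mf_cst | exact: mf_id | exact: mf_id | exact: mf_cst].
rewrite /ochi; case: (x <= y) => //.
have -> : (fun w => - chi R (y <= w <= x)) = fun w => 0 - chi R (y <= w <= x).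
  by apply/funext => w; rewrite sub0r.
by apply: mfB => //; exact: mf_cst.
Qed.

Lemma chi_le1 (t : bool) : `|chi R t| <= 1.
Proof. by rewrite /chi; case: t; rewrite ?normr1 ?normr0. Qed.

Lemma ochi_le1 x y w : `|ochi x y w| <= 1.
Proof. by rewrite /ochi; case: ifP => _; rewrite ?normrN chi_le1. Qed.

Section Pair.
Variables (v r : R).
Hypothesis r_gt0 : 0 < r.
Local Notation u := (v - r).

(** The class of all kernels that occur in [Ku] and [Ls]; the domination makes them integrable
    against the functions in [subexp]. *)
Definition goodk (k : R -> R) : Prop :=
  mf k /\ exists2 C : R, 0 <= C & forall w, `|k w| <= C * (K u w + K v w).

Lemma goodk_kap c : c = u \/ c = v -> goodk (K c).
Proof.
move=> cuv; split; first by apply: mf_cont; exact: continuous_kap.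
exists 1 => // w; have ku := kap_ge0 adm u w; have kv := kap_ge0 adm v w.
by rewrite mul1r ger0_norm ?kap_ge0 //; case: cuv => ->; rewrite ?lerDl ?lerDr.
Qed.

Lemma goodkD k k' : goodk k -> goodk k' -> goodk (fun w => k w + k' w).
Proof.
move=> [mk [C C0 h]] [mk' [C' C0' h']]; split; first exact: mfD.
exists (C + C'); first lra.
by move=> w; rewrite mulrDl; apply: le_trans (ler_normD _ _) (lerD (h w) (h' w)).
Qed.

Lemma goodkN k : goodk k -> goodk (fun w => - k w).
Proof.
move=> [mk [C C0 h]]; split; last by exists C => // w; rewrite normrN.
by have := mfB (mf_cst 0) mk; under eq_fun do rewrite sub0r.
Qed.

Lemma goodkB k k' : goodk k -> goodk k' -> goodk (fun w => k w - k' w).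
Proof. by move=> gk gk'; apply: goodkD => //; exact: goodkN. Qed.

Lemma goodkM k f : goodk k -> mf f -> (forall w, `|f w| <= 1) -> goodk (fun w => k w * f w).
Proof.
move=> [mk [C C0 h]] mfg f1; split; first exact: mfM.
exists C => // w; rewrite normrM; apply: le_trans (h w).
by rewrite ler_piMr.
Qed.

Lemma goodkMl k f : mf f -> (forall w, `|f w| <= 1) -> goodk k -> goodk (fun w => f w * k w).
Proof. by move=> mfg f1 gk; have := goodkM gk mfg f1; under eq_fun do rewrite mulrC. Qed.

Lemma goodk_chi (t : bool) k : goodk k -> goodk (fun w => chi R t * k w).
Proof. by apply: goodkMl => [|w]; [exact: mf_cst | exact: chi_le1]. Qed.

Lemma ig_kap_exp c : ig (fun w => K c w * expR (`|w| / 2)).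
Proof.
have [C C0 h] := kap_decay adm `|c|.
apply: (ig_dom _ (igZ C (@ig_decay R (1 / 4) ltac:(lra)))).
  apply: mfM; first by apply: mf_cont; exact: continuous_kap.
  apply: mf_cont; apply: cont_expR; apply: contM; last exact: cont_cst.
  by apply: cont_norm; exact: cont_id.
move=> w; rewrite ger0_norm ?mulr_ge0 ?kap_ge0 ?expR_ge0 //.
apply: le_trans (ler_wpM2r (expR_ge0 _) (h c w (lexx _))) _.
by rewrite -[leLHS]mulrA -expRD ler_pM2l // ler_expR; lra.
Qed.

(** The rate 1/2 is that of the weights [gwt] and [hwt], and it stays below the decay rate 3/4 of
    the kernel. *)
Definition subexp (e : R -> R) : Prop :=
  mf e /\ exists2 B : R, 0 <= B & forall w, `|e w| <= B * expR (`|w| / 2).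

Lemma goodk_dom k e : goodk k -> subexp e ->
  exists2 C : R, 0 <= C & forall w, `|k w * e w| <=
    C * (K u w * expR (`|w| / 2) + K v w * expR (`|w| / 2)).
Proof.
move=> [mk [C C0 h]] [me [B B0 h']]; exists (C * B); first exact: mulr_ge0.
move=> w; rewrite normrM -mulrDl.
have -> : C * B * ((K u w + K v w) * expR (`|w| / 2)) =
  (C * (K u w + K v w)) * (B * expR (`|w| / 2)) by ring.
by apply: ler_pM.
Qed.

Lemma ig_goodk k e : goodk k -> subexp e -> ig (fun w => k w * e w).
Proof.
move=> gk se; have [C C0 h] := goodk_dom gk se.
apply: (ig_dom _ (igZ C (igD (ig_kap_exp u) (ig_kap_exp v))) h).
by apply: mfM; [case: gk | case: se].
Qed.

Section Component.
Variables (b : bool) (D : R -> R -> R[i]).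

(** When [D] is the increment of [psi], [eb w] is a component of [psi v - psi w] and [et w] one of
    [psi w - psi (v - r)]: the first moves the bottom of the pair to [w], the second its top. Both
    are cut off where the second argument of [D] would not be positive. *)
Definition eb w : R := if w < v then pr b (D v (v - w)) else 0.
Definition et w : R := if u < w then pr b (D w (w - u)) else 0.

Hypotheses (sb : subexp eb) (st : subexp et).

Definition rep (z : R[i]) (f : R -> R) : Prop := ig f /\ pr b z = Int f.

Lemma repD z z' f f' : rep z f -> rep z' f' -> rep (z + z') (fun w => f w + f' w).
Proof. by move=> [i e] [i' e']; split; [exact: igD | rewrite prD e e' IntD]. Qed.
Lemma repN z f : rep z f -> rep (- z) (fun w => - f w).
Proof. by move=> [i e]; split; [exact: igN | rewrite prN e IntN]. Qed.
Lemma repB z z' f f' : rep z f -> rep z' f' -> rep (z - z') (fun w => f w - f' w).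
Proof. by move=> h h'; apply: repD => //; exact: repN. Qed.
Lemma rep_ind (t : bool) z f : (t -> rep z f) -> rep (ind R t * z) (fun w => chi R t * f w).
Proof.
case: t => h.
  have [i e] := h isT; split; first exact: igZ.
  by rewrite pr_ind IntZ // e.
split; first by under eq_fun do rewrite mul0r; exact: ig0.
rewrite pr_ind /chi mul0r; under eq_Int do rewrite mul0r.
by rewrite /Int /rint Rintegral_cst // mul0r.
Qed.
Lemma rep_eq z f f' : rep z f -> f =1 f' -> rep z f'.
Proof. by move=> h /funext <-. Qed.

Lemma rep_leaf (i : interval R) (Fc : R -> R[i]) k e : goodk k -> subexp e ->
  (forall w, w != u -> w != v -> w \in i -> pr b (Fc w) = k w * e w) ->
  rep (cint [set` i] Fc) (fun w => chi R (w \in i) * k w * e w).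
Proof.
move=> gk se h.
have ih : ig (fun w => chi R (w \in i) * k w * e w).
  apply: ig_goodk => //; apply: goodkMl => // [|w]; last exact: chi_le1.
  by apply: mf_chi; exact: meas_itv.
split => //; rewrite pr_cint rint_chi.
apply: (@Int_off _ _ _ u v); first exact: ig_mf.
move=> w wu wv; rewrite /chi; case: (boolP (w \in i)) => [wi|_]; last by rewrite !mul0r.
by rewrite !mul1r h.
Qed.

Lemma rep_oleaf x y (Fc : R -> R[i]) k e : goodk k -> subexp e ->
  (forall w, w != u -> w != v -> (x <= w <= y) || (y <= w <= x) -> pr b (Fc w) = k w * e w) ->
  rep (ocint x y Fc) (fun w => ochi x y w * k w * e w).
Proof.
move=> gk se h; rewrite /ocint /ochi; case: ifP => _.
  apply: rep_eq (rep_leaf (i := `[x, y]) gk se _) _ => [w wu wv|w]; rewrite in_itv //=.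
  by move=> wi; apply: h => //; rewrite wi.
have := rep_leaf (i := `[y, x]) gk se; move=> /(_ Fc) h'.
apply: rep_eq (repN (h' _)) _ => [w wu wv|w]; rewrite in_itv //=.
  by move=> wi; apply: h => //; rewrite wi orbT.
by rewrite !mulNr.
Qed.


Definition k31 c w : R := K c w * expR (- `|c - w|).
Definition k32 c w : R := K c w * (1 - expR (- `|c - w|)).
Definition kbar c w : R := K c w * expR (- (`|c - w| / 2)).
Definition d31 w : R := k31 u w - k31 v w.
Definition d32 w : R := k32 u w - k32 v w.

(** [kbU] and [ktU] collect, in the order of [Ku], the kernels that multiply [eb] and [et]; [kbL]
    does so for [Ls], which acts on [eb] alone. *)
Definition kbU w : R :=
  chi R (v < a1 p) * (chi R (w <= u) * d31 w)
  + chi R (a1 p <= v) * (chi R (w <= u) * (d31 w * chi R (E u < v - w)))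
  + chi R (u < - b0) * (ochi u (Num.min v 0) w * K u w)
  + chi R (- b0 <= u) * (ochi u v w * kbar u w)
  + chi R (u <= - m0) * (ochi (u - Num.max (rt p v r) (E u)) (u - E u) w * d32 w)
  + chi R (m0 <= u) * (chi R (v <= 3%:R * r) * (ochi 0 (u - E u) w * d32 w)
      + chi R (3%:R * r < v) * (chi R (w <= c0 R * v) * d32 w)).

Definition ktU w : R :=
  chi R (v < - b0) * (ochi v (a1 p) w * (K v w - K u w) + chi R (a1 p <= w) * (kbar v w - kbar u w))
  + chi R (- b0 <= v) * (chi R (v <= w) * (kbar v w - kbar u w))
  + chi R (v < - m0) * (ochi u v w * (k31 v w * chi R (v - w < Num.min r (- v - b0))))
  + chi R (- m0 <= v) * (ochi u v w * (k31 v w * expR (- `|v - w|)))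
  + chi R (v <= - m0) * (chi R (v + r < - b0) * (ochi u v w * k32 v w)
      + chi R (- b0 <= v + r) * (ochi (2%:R * v + b0) v w * k32 v w))
  + chi R (m0 <= v) * (chi R (0 < u < c0 R * v) * (ochi u (u / c0 R) w * k32 v w)
      + chi R (c0 R * v <= u) * (ochi u v w * k32 v w)).

Definition kbL w : R :=
  - (chi R (a1 p <= v) * (chi R (w <= u) * (d31 w * chi R (v - w <= E u))))
  - ochi (u - E u) u w * d32 w.

Lemma mf_expN c s : 0 <= s -> mf (fun w => expR (- (`|c - w| * s))).
Proof.
move=> s0; apply: mf_cont; apply: cont_expR; apply: contN; apply: contM; last exact: cont_cst.
by apply: cont_norm; apply: contB; [exact: cont_cst | exact: cont_id].
Qed.

Lemma expN_bounds c s w : 0 <= s -> 0 < expR (- (`|c - w| * s)) <= 1.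
Proof. by move=> s0; rewrite expR_gt0 expR_le1 oppr_le0 mulr_ge0. Qed.

Lemma expN_le1 c s w : 0 <= s -> `|expR (- (`|c - w| * s))| <= 1.
Proof. by move=> /(expN_bounds c w) /andP[h1 h2]; rewrite gtr0_norm. Qed.

Lemma goodk31 c : c = u \/ c = v -> goodk (k31 c).
Proof.
move=> cuv; rewrite /k31; under eq_fun do rewrite -[`|_ - _|]mulr1.
apply: goodkM; first exact: goodk_kap; first exact: mf_expN.
by move=> w; exact: expN_le1.
Qed.

Lemma goodkbar c : c = u \/ c = v -> goodk (kbar c).
Proof.
move=> cuv; rewrite /kbar.
apply: goodkM; first exact: goodk_kap; first by apply: mf_expN; rewrite invr_ge0.
by move=> w; apply: expN_le1; rewrite invr_ge0.
Qed.

Lemma goodk32 c : c = u \/ c = v -> goodk (k32 c).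
Proof.
move=> cuv; rewrite /k32; under eq_fun do rewrite mulrBr mulr1.
by apply: goodkB; [exact: goodk_kap | exact: goodk31].
Qed.

Lemma goodk_d31 : goodk d31.
Proof. by apply: goodkB; apply: goodk31; [left | right]. Qed.
Lemma goodk_d32 : goodk d32.
Proof. by apply: goodkB; apply: goodk32; [left | right]. Qed.

Lemma goodk_chiw (P : R -> bool) k : measurable_fun [set: R] P -> goodk k ->
  goodk (fun w => k w * chi R (P w)).
Proof. by move=> mP gk; apply: goodkM => //; [exact: mf_chi | move=> w; exact: chi_le1]. Qed.

Lemma goodk_chiwl (P : R -> bool) k : measurable_fun [set: R] P -> goodk k ->
  goodk (fun w => chi R (P w) * k w).
Proof. by move=> mP gk; apply: goodkMl => //; [exact: mf_chi | move=> w; exact: chi_le1]. Qed.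

Lemma goodk_ochi x y k : goodk k -> goodk (fun w => ochi x y w * k w).
Proof. by move=> gk; apply: goodkMl => //; [exact: mf_ochi | move=> w; exact: ochi_le1]. Qed.

Lemma uv_lt : u < v. Proof. by rewrite ltrBlDr ltrDl. Qed.

Lemma pr_A1 w : w < u -> pr b (A1 p D v r w) = d31 w * eb w.
Proof.
move=> wu; have wv := lt_trans wu uv_lt.
rewrite /A1 pr_scale /eb wv /d31 /k31 !K31e_kap // !gtr0_norm ?subr_gt0 //.
Qed.

Lemma pr_A2 w : w < u -> pr b (A2 p D v r w) = d32 w * eb w.
Proof.
move=> wu; have wv := lt_trans wu uv_lt.
rewrite /A2 pr_scale /eb wv /d32 /k32 !K32e_kap // !gtr0_norm ?subr_gt0 //.
Qed.

Lemma pr_Dw w : u < w -> pr b (Dw D v r w) = et w.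
Proof. by move=> uw; rewrite /Dw /et uw; congr (pr b (D w _)); ring. Qed.

Lemma neq_lt_le x w : w != x -> w <= x -> w < x.
Proof. by move=> h1 h2; rewrite lt_neqAle h1. Qed.

Lemma neq_gt_ge x w : w != x -> x <= w -> x < w.
Proof. by move=> h1 h2; rewrite lt_neqAle eq_sym h1. Qed.

Lemma rep_Ls : rep (Ls p D v r) (fun w => kbL w * eb w).
Proof.
have gA := @goodk_chiw _ _ (meas_le (mfB (mf_cst v) (@mf_id R)) (mf_cst (E u))) goodk_d31.
apply: rep_eq (repB (repN (rep_ind (t := a1 p <= v) (fun _ => rep_leaf (i := `]-oo, u]) (k := fun w => d31 w * chi R (v - w <= E u)) gA sb _)))
  (rep_oleaf (x := u - E u) (y := u) goodk_d32 sb _)) _.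
- move=> _ w wu wv; rewrite in_itv /= => /(neq_lt_le wu) h.
  by rewrite mulrC pr_ind pr_A1 //; ring.
- move=> w wu wv h; apply: pr_A2; apply: neq_lt_le => //.
  by case/orP: h => /andP[h1 h2] //; have := eps_gt0 adm u; lra.
- move=> w; rewrite /kbL in_itv /=; ring.
Qed.


Lemma c0_bounds : c0 R = 13 / 25. Proof. by rewrite /c0; field. Qed.

Lemma rep_Ku : rep (Ku p D v r) (fun w => kbU w * eb w + ktU w * et w).
Proof.
have [m1 m2] := m0_bounds adm; have a17 := a1_ge17 adm; have b10 := b0_ge10 adm.
have E0 := eps_gt0 adm u; have uv' := uv_lt; have cE := c0_bounds.
have rg : 0 < r by exact: r_gt0.
have mlt : forall c, measurable_fun [set: R] (fun w => c < v - w).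
  by move=> c; apply: meas_lt; [exact: mf_cst | apply: mfB; [exact: mf_cst | exact: mf_id]].
have mgt : forall c, measurable_fun [set: R] (fun w => v - w < c).
  by move=> c; apply: meas_lt; [apply: mfB; [exact: mf_cst | exact: mf_id] | exact: mf_cst].
have gv := goodk_kap (or_intror (erefl v)); have gu := goodk_kap (or_introl (erefl u)).
have gbv := goodkbar (or_intror (erefl v)); have gbu := goodkbar (or_introl (erefl u)).
have g31 := goodk31 (or_intror (erefl v)); have g32 := goodk32 (or_intror (erefl v)).
eapply rep_eq; [rewrite /Ku; repeat lazymatch goal with
  | |- rep (_ + _) _ => eapply repD | |- rep (ind _ _ * _) _ => eapply rep_ind; intro end | ].
- apply: (rep_leaf (k := d31) goodk_d31 sb) => w wu wv; rewrite in_itv /= => wi.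
  by apply: pr_A1; exact: neq_lt_le.
- apply: (rep_leaf (k := fun w => d31 w * chi R (E u < v - w)) (goodk_chiw (mlt _) goodk_d31) sb).
  move=> w wu wv; rewrite in_itv /= => wi.
  have wl := neq_lt_le wu wi.
  by rewrite mulrC pr_ind pr_A1 //; ring.
- apply: (rep_oleaf (k := fun w => K v w - K u w) (goodkB gv gu) st) => w wu wv wi.
  have vw : v < w.
    by apply: neq_gt_ge => //; case/orP: wi => /andP[? ?]; lra.
  by rewrite pr_scale !K3e_kap // pr_Dw //; lra.
- apply: (rep_leaf (k := fun w => kbar v w - kbar u w) (goodkB gbv gbu) st) => w wu wv.
  rewrite in_itv /= andbT => wi; have vw : v < w by lra.
  have uw : u < w by lra.
  rewrite pr_scale pr_Dw // !K3bar2e_kap //.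
  by rewrite /kbar -!(distrC w) !gtr0_norm //; lra.
- apply: (rep_leaf (k := fun w => kbar v w - kbar u w) (goodkB gbv gbu) st) => w wu wv.
  rewrite in_itv /= andbT => wi; have vw : v < w by exact: neq_gt_ge.
  have uw : u < w by lra.
  rewrite pr_scale pr_Dw // !K3bar2e_kap //.
  by rewrite /kbar -!(distrC w) !gtr0_norm //; lra.
- apply: (rep_oleaf (k := K u) gu sb) => w wu wv wi.
  have wv' : w < v.
    apply: neq_lt_le => //; move: wi; rewrite !ge_min !le_min.
    by case/orP => /andP[h1 h2]; [case/andP: h2 | case/orP: h1; lra].
  by rewrite pr_scale K3e_kap // /eb wv'.
- apply: (rep_oleaf (k := kbar u) gbu sb) => w wu wv wi.
  have wuv : u < w < v.
    by rewrite (neq_gt_ge wu) ?(neq_lt_le wv) //; case/orP: wi => /andP[? ?]; lra.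
  case/andP: wuv => uw wv'.
  by rewrite pr_scale K3bar2e_kap // /eb wv' /kbar -(distrC w) gtr0_norm // subr_gt0.
- apply: (rep_oleaf (k := fun w => k31 v w * chi R (v - w < Num.min r (- v - b0)))
    (goodk_chiw (mgt _) g31) st) => w wu wv wi.
  have wuv : u < w < v.
    by rewrite (neq_gt_ge wu) ?(neq_lt_le wv) //; case/orP: wi => /andP[? ?]; lra.
  case/andP: wuv => uw wv'.
  rewrite pr_ind pr_scale K31e_kap // pr_Dw // /k31 gtr0_norm ?subr_gt0 //; ring.
- apply: (rep_oleaf (k := fun w => k31 v w * expR (- `|v - w|)) _ st).
    apply: goodkM => // w.
      by under eq_fun do rewrite -[`|_ - _|]mulr1; exact: mf_expN.
    by rewrite -[`|_ - _|]mulr1; exact: expN_le1.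
  move=> w wu wv wi.
  have wuv : u < w < v.
    by rewrite (neq_gt_ge wu) ?(neq_lt_le wv) //; case/orP: wi => /andP[? ?]; lra.
  case/andP: wuv => uw wv'.
  by rewrite pr_scale K31e_kap // pr_Dw // /k31 gtr0_norm ?subr_gt0.
- apply: (rep_oleaf (k := d32) goodk_d32 sb) => w wu wv wi.
  apply: pr_A2; case/orP: wi => /andP[h1 h2]; first lra.
  have : E u <= Num.max (rt p v r) (E u) by rewrite le_max lexx orbT.
  lra.
- apply: (rep_oleaf (k := d32) goodk_d32 sb) => w wu wv wi.
  by apply: pr_A2; case/orP: wi => /andP[h1 h2]; lra.
- apply: (rep_leaf (k := d32) goodk_d32 sb) => w wu wv; rewrite in_itv /= cE => wi.
  by apply: pr_A2; lra.
- apply: (rep_oleaf (k := k32 v) g32 st) => w wu wv wi.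
  have wuv : u < w < v.
    by rewrite (neq_gt_ge wu) ?(neq_lt_le wv) //; case/orP: wi => /andP[? ?]; lra.
  case/andP: wuv => uw wv'.
  by rewrite pr_scale K32e_kap // pr_Dw // /k32 gtr0_norm ?subr_gt0.
- apply: (rep_oleaf (k := k32 v) g32 st) => w wu wv wi.
  have wuv : u < w < v.
    by rewrite (neq_gt_ge wu) ?(neq_lt_le wv) //; case/orP: wi => /andP[? ?]; lra.
  case/andP: wuv => uw wv'.
  by rewrite pr_scale K32e_kap // pr_Dw // /k32 gtr0_norm ?subr_gt0.
- apply: (rep_oleaf (k := k32 v) g32 st) => w wu wv wi.
  case/andP: (H0); rewrite cE => u0 uc0.
  have uc1 : u <= u / c0 R by rewrite cE; lra.
  have uc2 : u / c0 R < v by rewrite cE; lra.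
  have wuv : u < w < v.
    by rewrite (neq_gt_ge wu) ?(neq_lt_le wv) //; case/orP: wi => /andP[? ?]; lra.
  case/andP: wuv => uw wv'.
  by rewrite pr_scale K32e_kap // pr_Dw // /k32 gtr0_norm ?subr_gt0.
- apply: (rep_oleaf (k := k32 v) g32 st) => w wu wv wi.
  have wuv : u < w < v.
    by rewrite (neq_gt_ge wu) ?(neq_lt_le wv) //; case/orP: wi => /andP[? ?]; lra.
  case/andP: wuv => uw wv'.
  by rewrite pr_scale K32e_kap // pr_Dw // /k32 gtr0_norm ?subr_gt0.
move=> w; rewrite /kbU /ktU !in_itv /= !andbT.
ring.
Qed.

End Component.
End Pair.
End Representation.

(** * The weighted mass of Ku - Ls *)

Section Domination.
Variables (R : realType) (p : params R).
Hypothesis adm : admissible p.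
Local Notation b0 := (par_b0 p).
Local Notation m0 := (par_m0 p).
Local Notation eps0 := (par_eps0 p).
Local Notation E := (eps p).
Local Notation K := (kap p).
Local Notation g := (gwt p).
Local Notation h := (@hwt R).
Implicit Types (F G : R -> R) (u v w x y c : R).

Lemma Int_le_off (s : seq R) F G : ig F -> ig G ->
  (forall w, w \notin s -> F w <= G w) -> Int F <= Int G.
Proof.
elim: s F => [|z s IHs] F iF iG hFG; first by apply: Int_le => // w; exact: hFG.
pose F1 w := if w == z then G w else F w.
have F1E w : w != z -> F1 w = F w by move=> wz; rewrite /F1 (negbTE wz).
have iF1 : ig F1 by apply: (@ig_off R _ F z z) => // w wz _; exact: F1E.
have <- : Int F1 = Int F by apply: (@Int_off R _ _ z z) => [|w wz _]; [exact: ig_mf | exact: F1E].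
apply: IHs => // w ws; rewrite /F1; have [//|wz] := eqVneq w z.
by apply: hFG; rewrite inE negb_or wz.
Qed.

Lemma chi01 (t : bool) : chi R t = 0 \/ chi R t = 1.
Proof. by case: t; [right | left]. Qed.
Lemma chiT (t : bool) : t -> chi R t = 1. Proof. by move=> ->. Qed.
Lemma chiF (t : bool) : t = false -> chi R t = 0. Proof. by move=> ->. Qed.
Lemma chi_ge0 (t : bool) : 0 <= chi R t. Proof. by case: t. Qed.

Lemma ochi_below x y w : w < x -> w < y -> ochi x y w = 0.
Proof.
move=> wx wy; rewrite /ochi; case: ifP => _; last first.
  by rewrite chiF ?oppr0 //; rewrite leNgt wy.
by rewrite chiF //; rewrite leNgt wx.
Qed.
Lemma ochi_above x y w : x < w -> y < w -> ochi x y w = 0.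
Proof.
move=> wx wy; rewrite /ochi; case: ifP => _.
  by rewrite chiF //; rewrite (leNgt w y) wy andbF.
by rewrite chiF ?oppr0 //; rewrite (leNgt w x) wx andbF.
Qed.
Lemma ochi_in x y w : x <= w <= y -> ochi x y w = 1.
Proof.
by move=> xwy; rewrite /ochi chiT //; case/andP: xwy => a b; rewrite (le_trans a b).
Qed.
Lemma ochi_le x y w : x <= y -> ochi x y w = chi R (x <= w <= y).
Proof. by move=> xy; rewrite /ochi xy. Qed.

Section Pair.
Variables (v r : R).
Hypothesis r_gt0 : 0 < r.
Local Notation u := (v - r).
Local Notation k1 := (d31 p v r).
Local Notation k2 := (d32 p v r).

(** The kernels of [Ku - Ls] against [eb] and [et]; [Ls] contributes nothing to the second. *)
Definition kb w : R := kbU p v r w - kbL p v r w.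
Definition kt w : R := ktU p v r w.

Lemma goodk_kbU : goodk p v r (kbU p v r).
Proof.
have m1 : measurable_fun [set: R] (fun w => w <= u) by apply: meas_le; [exact: mf_id | exact: mf_cst].
have m2 : measurable_fun [set: R] (fun w => w <= c0 R * v) by apply: meas_le; [exact: mf_id | exact: mf_cst].
have m3 : measurable_fun [set: R] (fun w => E u < v - w).
  by apply: meas_lt; [exact: mf_cst | apply: mfB; [exact: mf_cst | exact: mf_id]].
rewrite /kbU.
repeat first [exact: goodk_d31 | exact: goodk_d32 | apply: goodkD | apply: goodk_chi | apply: goodk_ochi | apply: (goodk_chiwl m1)
 | apply: (goodk_chiwl m2) | apply: (goodk_chiw m3) | exact: goodk_d31 | exact: goodk_d32
 | by apply: goodk_kap => //; left | by apply: goodkbar => //; left].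
Qed.

Lemma goodk_kbL : goodk p v r (kbL p v r).
Proof.
have m1 : measurable_fun [set: R] (fun w => w <= u) by apply: meas_le; [exact: mf_id | exact: mf_cst].
have m3 : measurable_fun [set: R] (fun w => v - w <= E u).
  by apply: meas_le; [apply: mfB; [exact: mf_cst | exact: mf_id] | exact: mf_cst].
rewrite /kbL; apply: goodkB; first apply: goodkN;
repeat first [apply: goodk_chi | apply: goodk_ochi | apply: (goodk_chiwl m1)
 | apply: (goodk_chiw m3) | exact: goodk_d31 | exact: goodk_d32].
Qed.

Lemma goodk_ktU : goodk p v r (ktU p v r).
Proof.
have m1 : measurable_fun [set: R] (fun w => a1 p <= w) by apply: meas_le; [exact: mf_cst | exact: mf_id].
have m2 : measurable_fun [set: R] (fun w => v <= w) by apply: meas_le; [exact: mf_cst | exact: mf_id].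
have m3 : measurable_fun [set: R] (fun w => v - w < Num.min r (- v - b0)).
  by apply: meas_lt; [apply: mfB; [exact: mf_cst | exact: mf_id] | exact: mf_cst].
have g4 : goodk p v r (fun w => k31 p v w * expR (- `|v - w|)).
  apply: goodkM; first by apply: goodk31 => //; right.
    by under eq_fun do rewrite -[`|_ - _|]mulr1; exact: mf_expN.
  by move=> w; rewrite -[`|_ - _|]mulr1; exact: expN_le1.
rewrite /ktU.
repeat first [exact: g4 | apply: goodkD | apply: goodk_chi | apply: goodk_ochi | apply: (goodk_chiwl m1)
 | apply: (goodk_chiwl m2) | apply: (goodk_chiw m3)
 | by apply: goodk31 => //; right | by apply: goodk32 => //; right
 | by apply: goodk_kap => //; left | by apply: goodk_kap => //; right
 | by apply: goodkbar => //; left | by apply: goodkbar => //; right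
 | apply: goodkN].
Qed.


Lemma k31_bounds c w : 0 <= k31 p c w <= K c w.
Proof.
by rewrite /k31 mulr_ge0 ?kap_ge0 ?expR_ge0 //= ler_piMr ?kap_ge0 // expR_le1 oppr_le0.
Qed.

Lemma k32_bounds c w : 0 <= k32 p c w <= K c w.
Proof.
have e0 := expR_gt0 (- `|c - w|).
have e1 : expR (- `|c - w|) <= 1 by rewrite expR_le1 oppr_le0.
by rewrite /k32 mulr_ge0 ?kap_ge0 ?subr_ge0 //= ler_piMr ?kap_ge0 //; lra.
Qed.

Lemma k31D32 c w : k31 p c w + k32 p c w = K c w.
Proof. by rewrite /k31 /k32; ring. Qed.

(** Below [u], the three pieces with [A1] in [Ku] and [Ls] recombine into all of [k1], while those
    with [A2] cover only part of the line; [X] counts how often. Reversed limits and overlaps can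
    make it differ from 0 and 1, but only close to [u]. The point [u - E u] is an end of two
    adjacent closed intervals and would be counted twice. *)
Lemma kb_low w : w < u -> exists X, [/\ kb w = k1 w + X * k2 w, `|X| <= 2 &
  E u < u - w \/ (u <= - m0 /\ w != u - E u) -> X = 0 \/ X = 1].
Proof.
move=> wu; have uv' := uv_lt v r_gt0; have wv : w < v by lra.
have [m1 m2] := m0_bounds adm; have a17 := a1_ge17 adm; have b10 := b0_ge10 adm.
have E0 := eps_gt0 adm u.
pose o1 := ochi (u - Num.max (rt p v r) (E u)) (u - E u) w.
pose o2 := chi R (v <= 3%:R * r) * ochi 0 (u - E u) w + chi R (3%:R * r < v) * chi R (w <= c0 R * v).
pose o3 := ochi (u - E u) u w.
pose X := chi R (u <= - m0) * o1 + chi R (m0 <= u) * o2 + o3.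
have o5 : chi R (u < - b0) * ochi u (Num.min v 0) w = 0.
  have [ub|ub] := ltP u (- b0); last by rewrite /chi mul0r.
  by rewrite ochi_below ?mulr0 // lt_min wv /=; lra.
have o6 : ochi u v w = 0 by rewrite ochi_below.
have n1 : `|o1| <= 1 by exact: ochi_le1.
have n3 : `|o3| <= 1 by exact: ochi_le1.
have n4 : `|ochi 0 (u - E u) w| <= 1 by exact: ochi_le1.
exists X; split.
- rewrite /kb /kbU /kbL o6 (chiT (ltW wu)) /X /o1 /o2 /o3.
  have e1 : chi R (v < a1 p) + chi R (a1 p <= v) = 1.
    by rewrite /chi ltNge; case: (a1 p <= v); rewrite /= ?addr0 ?add0r.
  have e2 : chi R (E u < v - w) + chi R (v - w <= E u) = 1.
    by rewrite /chi ltNge; case: (v - w <= E u); rewrite /= ?addr0 ?add0r.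
  rewrite (mulrA (chi R (u < - b0))) o5.
  move: e1 e2; move: (chi R (v < a1 p)) (chi R (a1 p <= v)) (chi R (E u < v - w))
    (chi R (v - w <= E u)) => A B C D AB CD.
  have -> : A = 1 - B by lra.
  have -> : C = 1 - D by lra.
  ring.
- have n2 : `|o2| <= 1.
    rewrite /o2 ltNge; case: (v <= 3%:R * r); rewrite /= /chi ?mul1r ?mul0r ?addr0 ?add0r //.
    exact: chi_le1.
  rewrite /X; have [um|um] := leP u (- m0); have [mu|mu] := leP m0 u.
  + by exfalso; lra.
  + rewrite /chi mul1r mul0r addr0; apply: le_trans (ler_normD _ _) _; lra.
  + rewrite /chi mul1r mul0r add0r; apply: le_trans (ler_normD _ _) _; lra.
  + rewrite /chi !mul0r !add0r; lra.
- case=> [Eu|[um wE]].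
    have z3 : o3 = 0 by rewrite /o3 ochi_below //; lra.
    have z1 : o1 = 0 \/ o1 = 1.
      rewrite /o1 ochi_le; first exact: chi01.
      by rewrite lerD2l lerN2 le_max lexx orbT.
    have z2 : o2 = 0 \/ o2 = 1.
      rewrite /o2 ltNge; case: (v <= 3%:R * r); rewrite /= /chi ?mul1r ?mul0r ?addr0 ?add0r.
        rewrite /ochi; case: ifP => _; first exact: chi01.
        by left; rewrite chiF ?oppr0 //; rewrite leNgt; have -> : w < u - E u by lra.
      exact: chi01.
    rewrite /X z3 addr0; have [um|um] := leP u (- m0); have [mu|mu] := leP m0 u.
    + by exfalso; lra.
    + by rewrite /chi mul1r mul0r addr0.
    + by rewrite /chi mul1r mul0r add0r.
    + by left; rewrite /chi !mul0r addr0.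
  rewrite /X (chiT um) mul1r (chiF (t := m0 <= u)); last by apply/negbTE; rewrite -ltNge; lra.
  rewrite mul0r addr0; case: (ltgtP w (u - E u)) wE => // wE _.
    rewrite /o3 ochi_below // addr0 /o1 ochi_le; first exact: chi01.
    by rewrite lerD2l lerN2 le_max lexx orbT.
  rewrite /o1 ochi_above //; last first.
    have : E u <= Num.max (rt p v r) (E u) by rewrite le_max lexx orbT.
    lra.
  rewrite add0r /o3 ochi_le; first exact: chi01.
  by lra.
Qed.

(** With [X] equal to 0 or 1, [kb] is the difference between [u] and [v] of either [k31] or the
    whole kernel, and both are larger at [u]. *)
Lemma kb_low_far w : w < u -> E u < u - w \/ (u <= - m0 /\ w != u - E u) -> K v w <= K u w -> `|kb w| <= K u w.
Proof.
move=> wu Eu kvu; have [X [-> _ /(_ Eu) X01]] := kb_low wu.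
have uv' := uv_lt v r_gt0.
have /andP[a1' a2'] := k31_bounds u w; have /andP[a3 a4] := k31_bounds v w.
have v0 := kap_ge0 adm v w.
have e := k31D32 u w; have e' := k31D32 v w.
have le1 : k31 p v w <= k31 p u w.
  apply: ler_pM; rewrite ?expR_ge0 // ler_expR lerN2 !gtr0_norm; lra.
rewrite ler_norml /d31 /d32.
by case: X01 => ->; rewrite ?mul0r ?mul1r; apply/andP; split; lra.
Qed.

(** Crude, but used only within [E u] of [u], where [kap_near] bounds the mass. *)
Lemma kb_low_near w : w < u -> `|kb w| <= 3 * (K u w + K v w).
Proof.
move=> wu; have [X [-> X2 _]] := kb_low wu.
have /andP[a1' a2'] := k31_bounds u w; have /andP[a3 a4] := k31_bounds v w.
have /andP[b1' b2'] := k32_bounds u w; have /andP[b3 b4] := k32_bounds v w.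
have n1 : `|k1 w| <= K u w + K v w by rewrite ler_norml /d31; apply/andP; split; lra.
have n2 : `|k2 w| <= K u w + K v w by rewrite ler_norml /d32; apply/andP; split; lra.
apply: le_trans (ler_normD _ _) _; rewrite normrM.
have : `|X| * `|k2 w| <= 2 * (K u w + K v w) by apply: ler_pM.
lra.
Qed.

Lemma kb_mid w : u < w -> w < v -> `|kb w| <= K u w.
Proof.
move=> uw wv; have [m1 m2] := m0_bounds adm; have b10 := b0_ge10 adm; have E0 := eps_gt0 adm u.
have a17 := a1_ge17 adm; have cE := c0_bounds R; have rg : 0 < r by exact: r_gt0.
have k0 := kap_ge0 adm u w.
have -> : kb w = chi R (u < - b0) * (ochi u (Num.min v 0) w * K u w)
  + chi R (- b0 <= u) * (ochi u v w * kbar p u w).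
  rewrite /kb /kbU /kbL.
  have -> : ochi (u - Num.max (rt p v r) (E u)) (u - E u) w = 0.
    apply: ochi_above; last lra.
    have : E u <= Num.max (rt p v r) (E u) by rewrite le_max lexx orbT.
    lra.
  have -> : ochi (u - E u) u w = 0 by apply: ochi_above; lra.
  have -> : chi R (w <= u) = 0 by rewrite chiF // leNgt uw.
  have -> : chi R (m0 <= u) * (chi R (v <= 3%:R * r) * (ochi 0 (u - E u) w * k2 w)
      + chi R (3%:R * r < v) * (chi R (w <= c0 R * v) * k2 w)) = 0.
    have [mu|mu] := leP m0 u; last by rewrite /chi mul0r.
    rewrite (ochi_above (x := 0)); [|lra|lra].
    have [v3|v3] := leP v (3%:R * r); first by rewrite /chi !mul0r !mulr0 addr0 mulr0.
    rewrite (_ : chi R (w <= c0 R * v) = 0) ?mul0r ?mulr0 ?addr0 ?mulr0 //.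
    by rewrite chiF // leNgt cE; have -> : 13 / 25 * v < w by lra.
  by rewrite !(mul0r, mulr0, addr0, add0r, subr0, oppr0).
have [ub|ub] := ltP u (- b0).
  rewrite /chi mul1r mul0r addr0 normrM (ger0_norm k0).
  by rewrite ler_piMl // ochi_le1.
rewrite /chi mul0r add0r mul1r normrM /kbar normrM (ger0_norm k0).
have e1 : `|expR (- (`|u - w| / 2))| <= 1.
  by apply: expN_le1; rewrite invr_ge0.
have o1 := ochi_le1 u v w.
apply: (@le_trans _ _ (1 * (K u w * 1))); last by rewrite mul1r mulr1.
by apply: ler_pM => //; [exact: mulr_ge0 | exact: ler_wpM2l].
Qed.

(** The pieces with [k31] exclude one another, and so do those with [k32]; the two kernels sum to
    [K v]. *)
Lemma kt_mid w : u < w -> w < v -> `|kt w| <= K v w.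
Proof.
move=> uw wv; have [m1 m2] := m0_bounds adm; have b10 := b0_ge10 adm.
have a17 := a1_ge17 adm; have cE := c0_bounds R; have rg : 0 < r by exact: r_gt0.
have k0 := kap_ge0 adm v w.
have /andP[p1 p2] := k31_bounds v w; have /andP[q1 q2] := k32_bounds v w.
have e := k31D32 v w.
have -> : kt w = chi R (v < - m0) * (ochi u v w * (k31 p v w * chi R (v - w < Num.min r (- v - b0))))
  + chi R (- m0 <= v) * (ochi u v w * (k31 p v w * expR (- `|v - w|)))
  + chi R (v <= - m0) * (chi R (v + r < - b0) * (ochi u v w * k32 p v w)
      + chi R (- b0 <= v + r) * (ochi (2%:R * v + b0) v w * k32 p v w))
  + chi R (m0 <= v) * (chi R (0 < u < c0 R * v) * (ochi u (u / c0 R) w * k32 p v w)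
      + chi R (c0 R * v <= u) * (ochi u v w * k32 p v w)).
  rewrite /kt /ktU.
  have -> : chi R (v <= w) = 0 by rewrite chiF // leNgt wv.
  have -> : chi R (v < - b0) * (ochi v (a1 p) w * (K v w - K u w) + chi R (a1 p <= w) * (kbar p v w - kbar p u w)) = 0.
    have [vb|vb] := ltP v (- b0); last by rewrite /chi mul0r.
    rewrite ochi_below //; last lra.
    by rewrite (_ : chi R (a1 p <= w) = 0) ?mul0r ?addr0 ?mulr0 // chiF // leNgt; have -> : w < a1 p by lra.
  by rewrite !(mul0r, mulr0, addr0, add0r).
have o1 := ochi_le1 u v w; have o2 := ochi_le1 (2%:R * v + b0) v w; have o3 := ochi_le1 u (u / c0 R) w.
have T1 : `|chi R (v < - m0) * (ochi u v w * (k31 p v w * chi R (v - w < Num.min r (- v - b0))))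
  + chi R (- m0 <= v) * (ochi u v w * (k31 p v w * expR (- `|v - w|)))| <= k31 p v w.
  have A x y : `|x| <= 1 -> `|y| <= 1 -> `|x * (k31 p v w * y)| <= k31 p v w.
    move=> x1 y1; rewrite (normrM x) (normrM (k31 p v w)) (ger0_norm p1).
    apply: (@le_trans _ _ (1 * (k31 p v w * 1))); last by rewrite mul1r mulr1.
    by apply: ler_pM => //; [rewrite mulr_ge0 | apply: ler_wpM2l].
  have [vm|vm] := ltP v (- m0).
    by rewrite /chi /= mul1r mul0r addr0; apply: A => //; exact: chi_le1.
  rewrite /chi mul0r add0r mul1r; apply: A => //.
  by rewrite -[`|v - w|]mulr1; exact: expN_le1.
have T2 : `|chi R (v <= - m0) * (chi R (v + r < - b0) * (ochi u v w * k32 p v w)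
      + chi R (- b0 <= v + r) * (ochi (2%:R * v + b0) v w * k32 p v w))
  + chi R (m0 <= v) * (chi R (0 < u < c0 R * v) * (ochi u (u / c0 R) w * k32 p v w)
      + chi R (c0 R * v <= u) * (ochi u v w * k32 p v w))| <= k32 p v w.
  have A x : `|x| <= 1 -> `|x * k32 p v w| <= k32 p v w.
    by move=> x1; rewrite normrM (ger0_norm q1) ler_piMl.
  have Z : `|0 : R| <= k32 p v w by rewrite normr0.
  have [vm|vm] := leP v (- m0).
    rewrite (chiF (t := m0 <= v)); last by apply/negbTE; rewrite -ltNge; lra.
    rewrite mul0r addr0 {1}/chi mul1r (ltNge (v + r)).
    by case: (- b0 <= v + r); rewrite /chi /= ?mul1r ?mul0r ?addr0 ?add0r; exact: A.
  rewrite {1}/chi mul0r add0r; case: (m0 <= v); rewrite /chi ?mul0r ?mul1r //.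
  have [uc|uc] := leP (c0 R * v) u; rewrite ?andbF ?andbT /= ?mul0r ?mul1r ?add0r ?addr0; first exact: A.
  by case: (0 < u); rewrite ?mul1r ?mul0r //; exact: A.
rewrite -addrA; apply: le_trans (ler_normD _ _) _; lra.
Qed.

(** The point [a1] is left out because the closed ranges of two integrals meet there. *)
Lemma kt_high w : v < w -> w != a1 p ->
  kt w = if (v < - b0) && (w < a1 p) then K v w - K u w else kbar p v w - kbar p u w.
Proof.
move=> vw wa; have [m1 m2] := m0_bounds adm; have b10 := b0_ge10 adm; have uv' := uv_lt v r_gt0.
have a17 := a1_ge17 adm; have cE := c0_bounds R.
rewrite /kt /ktU (chiT (ltW vw)) (ochi_above (x := u) (y := v)) //; last by lra.
have -> : chi R (v <= - m0) * (chi R (v + r < - b0) * (0 * k32 p v w) +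
    chi R (- b0 <= v + r) * (ochi (2%:R * v + b0) v w * k32 p v w)) = 0.
  have [vm|vm] := leP v (- m0); last by rewrite /chi mul0r.
  by rewrite ochi_above ?(mul0r, mulr0, addr0) //; lra.
have -> : chi R (m0 <= v) * (chi R (0 < u < c0 R * v) * (ochi u (u / c0 R) w * k32 p v w) +
    chi R (c0 R * v <= u) * (0 * k32 p v w)) = 0.
  case: (boolP (0 < u < c0 R * v)) => [/andP[u0 uc]|_]; last by rewrite /chi !(mul0r, mulr0, addr0).
  rewrite ochi_above ?(mul0r, mulr0, addr0) //; first lra.
  by move: uc; rewrite cE; lra.
rewrite !(mul0r, mulr0, addr0).
have [vb|vb] := ltP v (- b0); last by rewrite /chi mul0r add0r !mul1r.
rewrite (chiT (t := true)) // (chiF (t := false)) // mul1r mul0r addr0 /=.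
have [wa1|wa1] := ltP w (a1 p).
  by rewrite /chi mul0r addr0 ochi_in ?mul1r // (ltW vw) ltW.
by rewrite /chi mul1r ochi_above ?mul0r ?add0r // lt_neqAle eq_sym wa.
Qed.

(** If [|D|] is at most [g v * h (v - r)], then [eb w] is at most [g v * h w] and [et w] at most
    [g w * h u]. Division by [g v * h u] gives this density of the weighted mass of [Ku - Ls]. *)
Definition weighted w : R :=
  chi R (w < v) * (`|kb w| * (h w / h u)) + chi R (u < w) * (`|kt w| * (g w / g v)).
Definition dens w : R := chi R (w < v) * K u w + chi R (u < w) * K v w.
(** The window of [lossw] is the reflection in [u] of the window of [gainw]; both integrands are
    nonnegative there when [u <= - m0]. *)
Definition lossw w : R := chi R (2 * u + b0 < w < u) * (K u w * (h w / h u - 1)).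
Definition gainw w : R := chi R (u < w < - b0) * (K u w * (1 - h w / h u)).
(** The errors of the weighted estimate: a unit mass on the regularization zone below [u] and an
    integrable tail. The total does not depend on [(v, r)]. *)
Definition errw w : R := chi R (u - E u <= w <= u) / E u + expR (- (`|w| / 4)).

Lemma errw_ge w : expR (- (`|w| / 4)) <= errw w.
Proof. by rewrite /errw lerDr mulr_ge0 ?chi_ge0 // invr_ge0 ltW // eps_gt0. Qed.
Lemma errw_ge0 w : 0 <= errw w.
Proof. exact: le_trans (expR_ge0 _) (errw_ge w). Qed.

(** Where the kernel is undamped, [g] is constant and [K v w - K u w] leaves [K u w] unspent, which
    covers the gain. Elsewhere the damping of [kbar] absorbs the growth of [g], and there is no gain
    since [w >= - b0]. *)
Lemma weighted_high w : v < w -> w != a1 p ->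
  weighted w + chi R (u <= - m0) * gainw w <= dens w.
Proof.
move=> vw wa; have uv' := uv_lt v r_gt0; have uw : u < w by lra.
have [m1 m2] := m0_bounds adm; have b10 := b0_ge10 adm; have a17 := a1_ge17 adm.
rewrite /weighted /dens /gainw (chiF (t := w < v)); last by apply/negbTE; rewrite -leNgt ltW.
rewrite uw (chiT (t := true)) // !mul0r !add0r !mul1r /=.
have kvw := kap_ge0 adm v w; have kuw := kap_ge0 adm u w.
have mono : K u w <= K v w by apply: kap_mono_above => //; exact: ltW.
have gv0 := gwt_gt0 p v; have gw0 := gwt_gt0 p w.
have hr1 : h w / h u <= 1 by rewrite ler_pdivrMr ?hwt_gt0 // mul1r hwt_le // ltW.
have hr0 : 0 <= h w / h u by rewrite divr_ge0 // ltW // hwt_gt0.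
rewrite kt_high //; case: (boolP ((v < - b0) && (w < a1 p))) => [/andP[vb wa1]|nb].
  rewrite !(gwt_small (p := p)); [|lra|lra].
  rewrite divr1 mulr1 ger0_norm; last lra.
  have c1 := chi_le1 R (u <= - m0); have c2 := chi_le1 R (w < - b0).
  have : chi R (u <= - m0) * (chi R (w < - b0) * (K u w * (1 - h w / h u))) <= K u w.
    have x0 : 0 <= K u w * (1 - h w / h u) by rewrite mulr_ge0 // subr_ge0.
    have x1 : K u w * (1 - h w / h u) <= K u w by rewrite ler_piMr //; lra.
    by case: (chi01 (u <= - m0)) => ->; case: (chi01 (w < - b0)) => ->; rewrite ?mul0r ?mul1r.
  lra.
have -> : chi R (w < - b0) = 0.
  apply: chiF; apply/negbTE; rewrite -leNgt leNgt; apply: contra nb => wb.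
  by apply/andP; split; lra.
rewrite mul0r mulr0 addr0.
have B c : c <= w -> kbar p c w = K c w * expR (- ((w - c) / 2)).
  by move=> cw; rewrite /kbar distrC ger0_norm // subr_ge0.
rewrite !B; [|exact: ltW|exact: ltW].
have ev0 := expR_gt0 (- ((w - v) / 2)); have eu0 := expR_gt0 (- ((w - u) / 2)).
have mono2 : K u w * expR (- ((w - u) / 2)) <= K v w * expR (- ((w - v) / 2)).
  by apply: ler_pM => //; rewrite ler_expR; lra.
have n : `|K v w * expR (- ((w - v) / 2)) - K u w * expR (- ((w - u) / 2))| <=
    K v w * expR (- ((w - v) / 2)).
  have : 0 <= K u w * expR (- ((w - u) / 2)) by rewrite mulr_ge0 // ltW.
  by move=> n0; rewrite ger0_norm; lra.
have gr : g w / g v <= expR ((w - v) / 2).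
  by rewrite ler_pdivrMr //; apply: gwt_growth; exact: ltW.
apply: (@le_trans _ _ (K v w * expR (- ((w - v) / 2)) * expR ((w - v) / 2))).
  by apply: ler_pM => //; rewrite divr_ge0 // ltW.
by rewrite -mulrA mulrC -expRD addNr expR0 mul1r.
Qed.

(** The gain is what the decrease of [h] from [u] to [w] saves on the bound [K u w] for [kb]. *)
Lemma weighted_mid w : u < w -> w < v ->
  weighted w + chi R (u <= - m0) * gainw w <= dens w.
Proof.
move=> uw wv; rewrite /weighted /dens /gainw uw wv (chiT (t := true)) // !mul1r /=.
have kvw := kap_ge0 adm v w; have kuw := kap_ge0 adm u w.
have hr1 : h w / h u <= 1 by rewrite ler_pdivrMr ?hwt_gt0 // mul1r hwt_le // ltW.
have hr0 : 0 <= h w / h u by rewrite divr_ge0 // ltW // hwt_gt0.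
have gr0 : 0 <= g w / g v by rewrite divr_ge0 // ltW // gwt_gt0.
have gr1 : g w / g v <= 1 by rewrite ler_pdivrMr ?gwt_gt0 // mul1r gwt_le // ltW.
have t1 : `|kt w| * (g w / g v) <= K v w * 1 by apply: ler_pM => //; exact: kt_mid.
have t2 : `|kb w| * (h w / h u) <= K u w * (h w / h u).
  by apply: ler_wpM2r => //; exact: kb_mid.
have : chi R (u <= - m0) * (chi R (w < - b0) * (K u w * (1 - h w / h u))) <= K u w * (1 - h w / h u).
  have x0 : 0 <= K u w * (1 - h w / h u) by rewrite mulr_ge0 // subr_ge0.
  by case: (chi01 (u <= - m0)) => ->; case: (chi01 (w < - b0)) => ->; rewrite ?mul0r ?mul1r.
by rewrite mulrBr mulr1; lra.
Qed.

End Pair.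

(** For [u <= - m0], the weight gained goes into [lossw] as long as the reflected point stays below
    [-b0], and is integrable beyond. For [u > - m0] it is integrable by [kap_hwt_loss]; only within
    [E u] of [u], where the kernels need not be ordered, does one fall back on [kb_low_near]. *)
Lemma weighted_low : exists2 C : R, 0 < C & forall v (r w : R), 0 < r -> w < v - r ->
  w != v - r - E (v - r) ->
  weighted v r w <= dens v r w + C * errw v r w + chi R (v - r <= - m0) * lossw v r w.
Proof.
have [C1 C10 H1] := kap_near adm; have [C2 C20 H2] := kap_hwt_loss adm.
have [C3 C30 H3] := kap_far_below adm.
(* The 6 is the factor 3 of [kb_low_near] for each of two kernels, and [e^{eps0/2}] bounds the ratio
   of [h] over a distance [E u <= eps0]. *)
exists (C2 + C3 + 6 * C1 * expR (eps0 / 2)).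
  by rewrite !addr_gt0 // mulr_gt0 ?expR_gt0 // mulr_gt0.
set C := C2 + C3 + _ => v r w r0 wu wE; have uv' := uv_lt v r0; have wv : w < v by lra.
have [m1 m2] := m0_bounds adm; have b10 := b0_ge10 adm; have a17 := a1_ge17 adm.
have E0 := eps_gt0 adm (v - r).
have e0' := errw_ge0 v r w; have ee := errw_ge v r w.
have hr0 : 0 < h w / h (v - r) by rewrite divr_gt0 // hwt_gt0.
have kuw := kap_ge0 adm (v - r) w.
have C4 : 0 < 6 * C1 * expR (eps0 / 2) by rewrite !mulr_gt0 // expR_gt0.
have CC2 : C2 * expR (- (`|w| / 4)) <= C * errw v r w.
  by apply: ler_pM => //; rewrite ?expR_ge0 ?ltW // /C; lra.
have CC3 : C3 * expR (- (`|w| / 4)) <= C * errw v r w.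
  by apply: ler_pM => //; rewrite ?expR_ge0 ?ltW // /C; lra.
have -> : weighted v r w = `|kb v r w| * (h w / h (v - r)).
  rewrite /weighted (chiT wv) (chiF (t := v - r < w)) ?mul0r ?addr0 ?mul1r //.
  by apply/negbTE; rewrite -leNgt ltW.
have -> : dens v r w = K (v - r) w.
  rewrite /dens (chiT wv) (chiF (t := v - r < w)) ?mul0r ?addr0 ?mul1r //.
  by apply/negbTE; rewrite -leNgt ltW.
have cb := chi_ge0 (v - r <= - m0).
have [um|um] := leP (v - r) (- m0).
  have far : `|kb v r w| <= K (v - r) w.
    apply: kb_low_far => //; first by right.
    by apply: kap_mono_below => //; [lra | right].
  rewrite {1}/chi mul1r /lossw wu andbT.
  have [w2|w2] := ltP (2 * (v - r) + b0) w.
    rewrite {1}/chi mul1r.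
    have : `|kb v r w| * (h w / h (v - r)) <= K (v - r) w * (h w / h (v - r)).
      by apply: ler_wpM2r => //; exact: ltW.
    have : 0 <= C * errw v r w by rewrite mulr_ge0 // /C; lra.
    by rewrite mulrBr mulr1; lra.
  rewrite {1}/chi mul0r addr0.
  have : `|kb v r w| * (h w / h (v - r)) <= K (v - r) w * (h w / h (v - r)).
    by apply: ler_wpM2r => //; exact: ltW.
  have := H3 _ _ um w2; lra.
rewrite {1}/chi mul0r addr0.
have um' := ltW um.
have [Ew|wEu] := ltP (E (v - r)) (v - r - w).
  have far : `|kb v r w| <= K (v - r) w.
    apply: kb_low_far => //; first by left.
    by apply: kap_mono_below => //; [lra | left; exact: ltW].
  have : `|kb v r w| * (h w / h (v - r)) <= K (v - r) w * (h w / h (v - r)).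
    by apply: ler_wpM2r => //; exact: ltW.
  have := H2 _ _ um' wu; rewrite mulrBr mulr1; lra.
have wl : v - r - E (v - r) <= w by lra.
have n1 := H1 _ _ _ um' (lexx (v - r)) wl wu.
have n2 := H1 _ _ _ um' (ltW uv') wl wu.
have nk := kb_low_near r0 wu.
have hr : h w / h (v - r) <= expR (eps0 / 2).
  rewrite ler_pdivrMr ?hwt_gt0 //; apply: le_trans (hwt_growth (ltW wu)) _.
  rewrite ler_pM2r ?hwt_gt0 // ler_expR ler_pM2r //.
  by have := eps_le0 adm (v - r); lra.
have : `|kb v r w| * (h w / h (v - r)) <= (6 * (C1 / E (v - r))) * expR (eps0 / 2).
  by apply: ler_pM => //; [exact: ltW | lra].
have er : (E (v - r))^-1 <= errw v r w.
  by rewrite /errw wl (ltW wu) (chiT (t := true)) // mul1r lerDl expR_ge0.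
have : 6 * C1 * expR (eps0 / 2) * (E (v - r))^-1 <= C * errw v r w.
  apply: ler_pM => //; first exact: ltW.
    by rewrite invr_ge0 ltW.
  by rewrite /C; lra.
have -> : 6 * (C1 / E (v - r)) * expR (eps0 / 2) = 6 * C1 * expR (eps0 / 2) * (E (v - r))^-1 by ring.
lra.
Qed.

Lemma subexp_hwt c d : 0 <= d -> subexp (fun w => d * (h w / h c)).
Proof.
move=> d0; split.
  apply: mf_cont; apply: contM; first exact: cont_cst.
  apply: contM; last exact: cont_cst.
  apply: cont_expR; apply: contM; last exact: cont_cst.
  by apply: cont_max; [apply: contN; exact: cont_id | exact: cont_cst].
exists d => // w; rewrite normrM (ger0_norm d0) ger0_norm; last first.
  by rewrite divr_ge0 // ltW // hwt_gt0.
apply: ler_wpM2l => //; apply: (@le_trans _ _ (h w)).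
  by rewrite ler_pdivrMr ?hwt_gt0 // ler_peMr ?hwt_ge1 // ltW // hwt_gt0.
rewrite ler_expR ler_pM2r // ge_max normr_ge0 andbT -normrN; exact: ler_norm.
Qed.

Lemma subexp_gwt c : subexp (fun w => g w / g c).
Proof.
split.
  apply: mf_cont; apply: contM; last exact: cont_cst.
  apply: cont_expR; apply: contM; last exact: cont_cst.
  by apply: cont_max; [apply: contB; [exact: cont_id | exact: cont_cst] | exact: cont_cst].
exists 1 => // w; rewrite mul1r ger0_norm; last by rewrite divr_ge0 // ltW // gwt_gt0.
apply: (@le_trans _ _ (g w)).
  by rewrite ler_pdivrMr ?gwt_gt0 // ler_peMr ?gwt_ge1 // ltW // gwt_gt0.
rewrite ler_expR ler_pM2r // ge_max normr_ge0 andbT.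
by have := ler_norm w; have := a1_ge17 adm; lra.
Qed.

Lemma subexp1 : subexp (fun _ : R => 1 : R).
Proof.
split; first exact: mf_cst.
by exists 1 => // w; rewrite mul1r normr1 -expR0 ler_expR divr_ge0.
Qed.

Section Integrals.
Variables (v r : R).
Hypothesis r_gt0 : 0 < r.
Local Notation u := (v - r).

Lemma meas_ltc c : measurable_fun [set: R] (fun w => c < w).
Proof. by apply: meas_lt; [exact: mf_cst | exact: mf_id]. Qed.
Lemma meas_gtc c : measurable_fun [set: R] (fun w => w < c).
Proof. by apply: meas_lt; [exact: mf_id | exact: mf_cst]. Qed.

Lemma goodk_norm k : goodk p v r k -> goodk p v r (fun w => `|k w|).
Proof.
move=> [mk [C C0 hk]]; split; first exact: mf_norm.
by exists C => // w; rewrite normr_id.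
Qed.

Lemma goodk_kbw : goodk p v r (kb v r).
Proof. by apply: goodkB; [exact: goodk_kbU | exact: goodk_kbL]. Qed.

Lemma ig_weighted : ig (weighted v r).
Proof.
apply: igD.
  apply: ig_chiM; first exact: meas_gtc.
  have := ig_goodk adm (goodk_norm goodk_kbw) (subexp_hwt u ler01).
  by congr ig; apply/funext => w; rewrite mul1r.
apply: ig_chiM; first exact: meas_ltc.
by apply: (ig_goodk adm (goodk_norm _) (subexp_gwt v)); exact: goodk_ktU.
Qed.

Lemma ig_kap c : ig (K c).
Proof.
have gk : goodk p c 1 (K c) by apply: goodk_kap => //; right.
have := ig_goodk adm gk subexp1.
by congr ig; apply/funext => w; rewrite mulr1.
Qed.

Lemma ig_dens : ig (dens v r).
Proof.
by apply: igD; apply: ig_chiM; [exact: meas_gtc | exact: ig_kap | exact: meas_ltc | exact: ig_kap].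
Qed.

Lemma ig_kaph c : ig (fun w => K c w * (h w / h c)).
Proof.
have gk : goodk p c 1 (K c) by apply: goodk_kap => //; right.
have := ig_goodk adm gk (subexp_hwt c ler01).
by congr ig; apply/funext => w; rewrite mul1r.
Qed.

Lemma ig_lossw : ig (lossw v r).
Proof.
apply: ig_chiM; first by apply: meas_and; [exact: meas_ltc | exact: meas_gtc].
by under eq_fun do rewrite mulrBr mulr1; apply: igB; [exact: ig_kaph | exact: ig_kap].
Qed.

Lemma ig_gainw : ig (gainw v r).
Proof.
apply: ig_chiM; first by apply: meas_and; [exact: meas_ltc | exact: meas_gtc].
by under eq_fun do rewrite mulrBr mulr1; apply: igB; [exact: ig_kap | exact: ig_kaph].
Qed.

Lemma ig_errw : ig (errw v r).
Proof.
apply: igD.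
  have := igZ (E u)^-1 (@ig_seg R (u - E u) u).
  by congr ig; apply/funext => w; rewrite mulrC.
have := @ig_decay R (1 / 4) ltac:(lra).
by congr ig; apply/funext => w; congr expR; lra.
Qed.

Lemma Int_errw : Int (errw v r) = 1 + Int (fun w => expR (- (`|w| / 4))).
Proof.
have E0 := eps_gt0 adm u.
rewrite IntD; last 2 first.
- have := igZ (E u)^-1 (@ig_seg R (u - E u) u).
  by congr ig; apply/funext => w; rewrite mulrC.
- have := @ig_decay R (1 / 4) ltac:(lra).
  by congr ig; apply/funext => w; congr expR; lra.
congr (_ + _).
have -> : Int (fun w => chi R (u - E u <= w <= u) / E u) = (E u)^-1 * Int (fun w => chi R (u - E u <= w <= u)).
  by rewrite -IntZ; [apply: eq_Int => w; rewrite mulrC | exact: ig_seg].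
rewrite Int_seg; last by lra.
by rewrite opprB addrCA subrr addr0 mulVf // gt_eqF.
Qed.

(* Reflection in [u] turns the loss of weight on jumps below [u] into jumps
   above [u], whose kernel is larger. *)
Lemma Int_loss_gain : u <= - m0 -> Int (lossw v r) <= Int (gainw v r).
Proof.
move=> um; have [m1 m2] := m0_bounds adm; have b10 := b0_ge10 adm; have a17 := a1_ge17 adm.
rewrite -(Int_refl (2 * u) ig_lossw); apply: Int_le; [exact: (ig_refl (2 * u) ig_lossw) | exact: ig_gainw |] => w.
rewrite /lossw /gainw.
have -> : (2 * u + b0 < 2 * u - w < u) = (u < w < - b0).
  by apply/andP/andP => -[h1 h2]; split; lra.
case: (boolP (u < w < - b0)) => [/andP[uw wb]|_]; last by rewrite /chi !mul0r.
rewrite (chiT (t := true)) // !mul1r.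
rewrite !hwt_neg; [|lra|lra|lra].
have := kap_reflect adm um (_ : 0 < w - u) ltac:(lra).
move=> /(_ ltac:(lra)).
have -> : u - (w - u) = 2 * u - w by ring.
have -> : u + (w - u) = w by ring.
rewrite -!expRB.
have -> : - (2 * u - w) / 2 - - u / 2 = (w - u) / 2 by field.
have -> // : - w / 2 - - u / 2 = - ((w - u) / 2) by field.
Qed.

Lemma VtE : Vt p v r = Int (dens v r).
Proof.
have uv' := uv_lt v r_gt0.
have A (i : interval R) c : c = u \/ c = v ->
  rint [set` i] (K3e p c) = Int (fun w => chi R (w \in i) * K c w).
  move=> cuv; rewrite rint_chi; apply: (@Int_off _ _ _ u v).
    apply: mfM; first by apply: mf_chi; exact: meas_itv.
    by apply: mf_cont; exact: continuous_kap.
  by move=> w wu wv; rewrite K3e_kap //; case: cuv => ->.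
have I (i : interval R) c : ig (fun w => chi R (w \in i) * K c w).
  by apply: ig_chiM; [exact: meas_itv | exact: ig_kap].
rewrite /Vt (A `]-oo, u] u (or_introl erefl)) (A `[u, v] v (or_intror erefl)).
rewrite (A `[u, v] u (or_introl erefl)) (A `[v, +oo[ v (or_intror erefl)).
have I2 := igD (I `]-oo, u] u) (I `[u, v] v); have I3 := igD I2 (I `[u, v] u).
rewrite -(IntD (I _ _) (I _ _)) -(IntD I2 (I _ _)) -(IntD I3 (I _ _)).
have md : mf (dens v r) := ig_mf ig_dens.
apply: (Int_off (u := u) (v := v) md).
move=> w wu wv; rewrite /dens !in_itv /= !andbT /chi.
by case: (ltgtP w u) wu => // wu _; case: (ltgtP w v) wv => // wv _;
  rewrite /= ?mul0r ?mul1r ?addr0 ?add0r // ?(addrC (K v w)) //; exfalso; lra.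
Qed.

End Integrals.

(** The pointwise bounds add up to [dens + C * errw], plus [lossw - gainw] when [u <= - m0]; the
    last difference has nonpositive integral by [Int_loss_gain]. *)
Lemma weighted_bound : exists2 C : R, 0 < C & forall v (r : R), 0 < r ->
  Int (weighted v r) <= Vt p v r + C.
Proof.
have [C C0 H] := weighted_low.
exists (C * (1 + Int (fun w => expR (- (`|w| / 4))))).
  rewrite mulr_gt0 // ltr_pwDl // Int_ge0 // => w; exact: expR_ge0.
move=> v r r0; rewrite -(@Int_errw v r) VtE //.
have cI F c : ig F -> ig (fun w => c * F w) by exact: igZ.
have iL := ig_lossw v r; have iG := ig_gainw v r.
have iD := ig_dens v r; have iE := ig_errw v r.
set c := chi R (v - r <= - m0).
apply: (@le_trans _ _ (Int (fun w => dens v r w + C * errw v r w +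
    c * (lossw v r w - gainw v r w)))); last first.
  rewrite IntD; [|exact: igD (cI _ _ iE)|exact/cI/igB].
  rewrite IntD //; last exact: cI.
  rewrite !IntZ //; last exact: igB.
  rewrite IntB // gerDl /c /chi; have [um|um] := leP (v - r) (- m0).
    by rewrite mul1r subr_le0; exact: Int_loss_gain.
  by rewrite mul0r.
(* The two diagonal points, and the two points where closed ranges of integration meet. *)
apply: (@Int_le_off [:: v - r; v; v - r - E (v - r); a1 p]).
- exact: ig_weighted.
- by apply: igD; [exact: igD (cI _ _ iE) | exact/cI/igB].
move=> w; rewrite !inE !negb_or => /and4P[wu wv wE wa].
have uv' := uv_lt v r0; have e0 := errw_ge0 v r w.
have Ce : 0 <= C * errw v r w by rewrite mulr_ge0 // ltW.
have [wltu|ultw|wequ] := ltgtP w (v - r).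
- have := H _ _ _ r0 wltu wE.
  have -> : gainw v r w = 0.
    by rewrite /gainw (chiF (t := _ && _)) ?mul0r //; apply/negbTE; rewrite negb_and -leNgt ltW.
  by rewrite subr0.
- have L0 : lossw v r w = 0.
    rewrite /lossw (chiF (t := _ && _)) ?mul0r //; apply/negbTE.
    by rewrite negb_and -!leNgt (ltW ultw) orbT.
  rewrite L0 sub0r mulrN.
  have [wltv|vltw|weqv] := ltgtP w v.
  + have := weighted_mid r0 ultw wltv; rewrite -/c; lra.
  + have := weighted_high r0 vltw wa; rewrite -/c; lra.
  + by rewrite weqv eqxx in wv.
- by rewrite wequ eqxx in wu.
Qed.

Lemma Vt_ge0 v (r : R) : 0 < r -> 0 <= Vt p v r.
Proof.
move=> r0; rewrite VtE //; apply: Int_ge0 => w.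
by rewrite /dens addr_ge0 // mulr_ge0 ?chi_ge0 ?kap_ge0.
Qed.

Lemma Vt_bounded rho : exists C : R, forall v (r : R), 0 < r -> v <= rho -> - rho <= v - r ->
  Vt p v r <= C.
Proof.
have [C C0 H] := kap_decay adm rho.
exists (Int (fun w => 2 * C * expR (- (3 / 4 * `|w|)))) => v r r0 vr ur.
rewrite VtE //; apply: Int_le; first exact: ig_dens.
  by apply: igZ; apply: ig_decay; lra.
move=> w; rewrite /dens.
have h1 : K (v - r) w <= C * expR (- (3 / 4 * `|w|)) by apply: H; rewrite ler_norml; apply/andP; split; lra.
have h2 : K v w <= C * expR (- (3 / 4 * `|w|)) by apply: H; rewrite ler_norml; apply/andP; split; lra.
have k1' := kap_ge0 adm (v - r) w; have k2' := kap_ge0 adm v w.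
rewrite -mulrA mulr_natl mulr2n; apply: lerD.
  by apply: le_trans h1; case: (chi01 (w < v)) => ->; rewrite ?mul0r ?mul1r.
by apply: le_trans h2; case: (chi01 (v - r < w)) => ->; rewrite ?mul0r ?mul1r.
Qed.

End Domination.

(** * Complex values and weights *)

Section ComplexTopology.
Variable R : realType.
Implicit Types (b : bool) (z : R[i]).

Lemma normc_cabs z : `|z| = (cabs z)%:C%C.
Proof. by rewrite /cabs normc_def. Qed.

Lemma cabs_def z : cabs z = Num.sqrt (complex.Re z ^+ 2 + complex.Im z ^+ 2).
Proof. by rewrite /cabs normc_def. Qed.

Lemma pr_le_cabs b z : `|pr b z| <= cabs z.
Proof.
rewrite cabs_def -sqrtr_sqr ler_wsqrtr //.
by case: b; rewrite /= ?lerDl ?lerDr sqr_ge0.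
Qed.

Lemma cabs_le_pr z B : (forall b, `|pr b z| <= B) -> cabs z <= 2 * B.
Proof.
move=> hB; have h1 := hB true; have h2 := hB false.
have B0 : 0 <= B by apply: le_trans h1; exact: normr_ge0.
rewrite cabs_def -(@ger0_norm _ (2 * B)) ?mulr_ge0 // -sqrtr_sqr ler_wsqrtr //.
move: h1 h2; rewrite !ler_norml /= => /andP[x1 x2] /andP[y1 y2].
by nra.
Qed.

Lemma complex_eq_pr z z' : (forall b, pr b z = pr b z') -> z = z'.
Proof.
by case: z z' => [x y] [x' y'] h; have /= -> := h true; have /= -> := h false.
Qed.

Lemma pr_cvg b (T : Type) (F : set_system T) (f : T -> R[i]^o) z : Filter F ->
  f @ F --> (z : R[i]^o) -> (fun t => pr b (f t)) @ F --> pr b z.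
Proof.
move=> FF /cvgrPdist_lt fz; apply/cvgrPdist_lt => e e0.
have e0' : 0 < e%:C%C by rewrite ltcR.
apply: filterS (fz _ e0') => t; rewrite normc_cabs ltcR => h.
by rewrite -prB; apply: le_lt_trans h; exact: pr_le_cabs.
Qed.

Lemma pr_cvgE (T : Type) (F : set_system T) (f : T -> R[i]^o) z : Filter F ->
  (forall b, (fun t => pr b (f t)) @ F --> pr b z) -> f @ F --> (z : R[i]^o).
Proof.
move=> FF h; apply/cvgrPdist_lt => e; rewrite ltcE /= => /andP[/eqP ei er].
have -> : e = (complex.Re e)%:C%C by case: e ei {er} => x y /= ->.
have e2 : 0 < complex.Re e / 4 by lra.
have /cvgrPdist_lt/(_ _ e2) h1 := h true; have /cvgrPdist_lt/(_ _ e2) h2 := h false.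
near=> t; rewrite normc_cabs ltcR.
apply: (@le_lt_trans _ _ (2 * (complex.Re e / 4))); last lra.
apply: cabs_le_pr => b; rewrite prB; case: b; apply: ltW; near: t; [exact: h1 | exact: h2].
Unshelve. all: by end_near. Qed.

Lemma within_comp (T U V : topologicalType) (A : set U) (S : set T) (f : U -> V) (phi : T -> U) :
  {within A, continuous f} -> {within S, continuous phi} -> (forall x, S x -> A (phi x)) ->
  {within S, continuous (fun x => f (phi x))}.
Proof.
move=> /subspace_continuousP cf /subspace_continuousP cphi SA.
apply/subspace_continuousP => x Sx P Pn.
have := cf _ (SA _ Sx) _ Pn; rewrite /nbhs /= => h.
have := cphi _ Sx _ h.
rewrite /nbhs /= /within /=; apply: filterS => y hy Sy.
by apply: hy => //; exact: SA.
Qed.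

Lemma pr_within b (T : topologicalType) (A : set T) (f : T -> R[i]^o) :
  {within A, continuous f} -> {within A, continuous (fun x => pr b (f x))}.
Proof.
move=> /subspace_continuousP cf; apply/subspace_continuousP => x Ax.
by apply: pr_cvg; exact: cf.
Qed.

Lemma within_setT (T U : topologicalType) (f : T -> U) :
  {within setT, continuous f} -> continuous f.
Proof. move=> /subspace_continuousP h x P Px; have := h x I P Px.
by rewrite /nbhs /= /within /=; apply: filterS => y; apply. Qed.

Lemma ereal_sup_lt_bound (S : set \bar R) : (ereal_sup S < +oo)%E ->
  exists2 B : R, 0 <= B & forall x, S x -> (x <= B%:E)%E.
Proof.
case e : (ereal_sup S) => [B| |] // _.
  exists (Num.max B 0); first by rewrite le_max lexx orbT.
  move=> x Sx; apply: le_trans (ereal_sup_ubound Sx) _.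
  by rewrite e lee_fin le_max lexx.
exists 0 => // x Sx; apply: le_trans (ereal_sup_ubound Sx) _.
by rewrite e leNye.
Qed.

Lemma bound_ereal_sup (S : set \bar R) (B : R) : (forall x, S x -> (x <= B%:E)%E) ->
  (ereal_sup S < +oo)%E.
Proof.
by move=> h; apply: (@le_lt_trans _ _ B%:E); [exact: ge_ereal_sup | exact: ltry].
Qed.

End ComplexTopology.

(** * Comparison of the weights *)

HB.lock Definition f0 (R : realType) (p : params R) : R := ln 2%:R `^ (- par_alpha p).

Section Weights.
Variables (R : realType) (p : params R).
Hypothesis adm : admissible p.
Local Notation mu := (par_mu p).
Local Notation a := (par_a p).
Local Notation alpha := (par_alpha p).
Local Notation E := (eps p).
Local Notation g := (gwt p).
Local Notation h := (@hwt R).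
Implicit Types (u v w x y c r : R).

Local Notation f0 := (f0 p).

Lemma ln2E : ln 2%:R = lnp (0 : R).
Proof. by rewrite /lnp expR0; congr ln; rewrite -natr1. Qed.

Lemma f0_gt0 : 0 < f0.
Proof. by rewrite f0.unlock ln2E powR_gt0 // lnp_gt0. Qed.

Lemma fweight_ge v : f0 <= fweight p v.
Proof. by rewrite f0.unlock /fweight le_max lexx orbT. Qed.

(** For negative [v], [lnp v >= e^v ln 2]; the rate is then [alpha < 1/6]. *)
Lemma fweight_le v : fweight p v <= f0 * expR (Num.max (- v) 0 / 6).
Proof.
have /andP[al0 al6] := alpha_bounds adm.
have f00 := f0_gt0; have m0' : 0 <= Num.max (- v) 0 by rewrite le_max lexx orbT.
have e1 : 1 <= expR (Num.max (- v) 0 / 6) by rewrite -expR0 ler_expR divr_ge0.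
have fl : f0 <= f0 * expR (Num.max (- v) 0 / 6) by rewrite ler_peMr // ltW.
have ef : ln 2%:R `^ (- alpha) = f0 by rewrite f0.unlock.
rewrite /fweight ef ge_max fl andbT.
have pw x y : 0 < x -> x <= y -> y `^ (- alpha) <= x `^ (- alpha).
  move=> x0 xy; have y0 := lt_le_trans x0 xy.
  rewrite !powRN lef_pV2 ?posrE ?powR_gt0 //.
  by apply: ge0_ler_powR; rewrite ?nnegrE; lra.
have l0 := lnp_gt0 v; have l00 := lnp_gt0 (0 : R).
have [v0|v0] := leP 0 v.
  by apply: le_trans fl; rewrite f0.unlock ln2E; apply: pw => //; exact: lnp_le.
rewrite max_l; last lra.
have h1 : expR v * lnp 0 <= lnp v.
  have := @lnp_growth R v 0 (ltW v0); rewrite sub0r => h1.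
  have := ler_wpM2l (expR_ge0 v) h1.
  by rewrite mulrA expRxMexpNx_1 mul1r.
apply: (le_trans (pw _ _ (mulr_gt0 (expR_gt0 v) l00) h1)).
rewrite powRM ?expR_ge0 ?(ltW l00) // mulrC f0.unlock ln2E ler_pM2l ?powR_gt0 //.
by rewrite -expRM ler_expR; nra.
Qed.

Lemma Gammat_gt0 v : 0 < Gammat p v.
Proof.
by rewrite /Gammat mulr_gt0 ?expR_gt0 //; apply: lt_le_trans f0_gt0 (fweight_ge v).
Qed.

(** The rate is [mu * c0 <= 91/400 < 1/4] upwards and at most 1/6 downwards. *)
Lemma Gammat_le : exists2 C : R, 0 < C & forall v, Gammat p v <= C * expR (`|v| / 4).
Proof.
have /andP[mu1 mu2] := mu_bounds adm; have a9 := a_ge9 adm.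
exists (f0 * expR (mu * a)); first by rewrite mulr_gt0 ?expR_gt0 ?f0_gt0.
move=> v; rewrite /Gammat -mulrA; apply: (@le_trans _ _ (f0 * expR (Num.max (- v) 0 / 6) *
    expR (mu * Num.max a (c0 R * v)))).
  by rewrite ler_pM2r ?expR_gt0 // fweight_le.
rewrite -mulrA ler_pM2l ?f0_gt0 // -!expRD ler_expR c0_bounds.
have [v0|v0] := leP 0 v.
  rewrite (ger0_norm v0) max_r; last lra.
  have : Num.max a (13 / 25 * v) <= a + 13 / 25 * v by rewrite ge_max; apply/andP; split; lra.
  move=> h1; have : mu * Num.max a (13 / 25 * v) <= mu * (a + 13 / 25 * v) by rewrite ler_pM2l //; lra.
  by nra.
rewrite (ltr0_norm v0) max_l; last lra.
rewrite max_l; last lra.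
lra.
Qed.

Lemma exp_quarter_GG : exists2 C : R, 0 < C & forall v u, u <= v ->
  expR (`|v| / 4) <= C * (g v * h u) /\ expR (`|u| / 4) <= C * (g v * h u).
Proof.
have a17 := a1_ge17 adm.
exists (expR (a1 p / 2)); first exact: expR_gt0.
move=> v u uv; rewrite /gwt /hwt -!expRD !ler_expR.
have m1 : v - a1 p <= Num.max (v - a1 p) 0 by rewrite le_max lexx.
have m2 : 0 <= Num.max (v - a1 p) 0 by rewrite le_max lexx orbT.
have m3 : - u <= Num.max (- u) 0 by rewrite le_max lexx.
have m4 : 0 <= Num.max (- u) 0 by rewrite le_max lexx orbT.
by split; [case: (leP 0 v) => v0; rewrite ?(ger0_norm v0) ?(ltr0_norm v0) |
           case: (leP 0 u) => u0; rewrite ?(ger0_norm u0) ?(ltr0_norm u0)]; lra.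
Qed.

(** The Hoelder modulus in [Gammabar]: it behaves like [y ^ (gamma0 / 2)] near 0 and saturates at
    1. *)
Definition hol y : R := (1 - expR (- (par_kappa p * y))) `^ (par_gamma0 p / 2%:R).

Lemma hol_base y : 0 <= y -> 0 <= 1 - expR (- (par_kappa p * y)) <= 1.
Proof.
move=> y0; have k7 := kappa_ge7 adm; rewrite subr_ge0 expR_le1 oppr_le0 mulr_ge0 //; last lra.
by rewrite gerBl expR_ge0.
Qed.

Lemma hol_le1 y : 0 <= y -> 0 <= hol y <= 1.
Proof.
move=> /hol_base /andP[h1 h2]; have /andP[g1 g2] := gamma0_bounds adm.
rewrite /hol powR_ge0 /=.
rewrite [leRHS](_ : 1 = 1 `^ (par_gamma0 p / 2%:R)); last by rewrite powR1.
by apply: ge0_ler_powR; rewrite ?nnegrE //; lra.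
Qed.

Lemma hol_gt0 y : 0 < y -> 0 < hol y.
Proof.
move=> y0; have k7 := kappa_ge7 adm; apply: powR_gt0; apply: subr1_expRN_gt0.
by rewrite mulr_gt0 //; lra.
Qed.

Lemma le_double x y c : x <= c -> y <= c -> x + y <= 2 * c.
Proof. lra. Qed.

Lemma GammabarE v r : Gammabar p v r = (fweight p v + fweight p (v - r)) *
  expR (mu * Num.max a (Num.max (c0 R * v) (v - r))) * hol (r + E v).
Proof. by []. Qed.

Lemma Gammabar_gt0 v r : 0 < r -> 0 < Gammabar p v r.
Proof.
move=> r0; have e0 := eps_gt0 adm v; have f00 := f0_gt0.
rewrite GammabarE !mulr_gt0 ?expR_gt0 ?hol_gt0 //; last lra.
by apply: addr_gt0; apply: lt_le_trans (fweight_ge _).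
Qed.

(** The margin 1/16 is [1/2 - 7/16], the room between the exponent of [g] and the largest [mu];
    downwards the room [1/2 - 1/6] is larger. Uniqueness uses the decay of the quotient in [v] and
    in [-(v - r)]. *)
Lemma Gammabar_le : exists2 C : R, 0 < C & forall v r, 0 < r ->
  Gammabar p v r <= C * expR (- ((Num.max v 0 + Num.max (- (v - r)) 0) / 16)) * (g v * h (v - r)).
Proof.
have /andP[mu1 mu2] := mu_bounds adm; have a9 := a_ge9 adm; have f00 := f0_gt0.
exists (2 * f0 * expR (mu * a + a1 p / 2)); first by rewrite !mulr_gt0 ?expR_gt0.
move=> v r r0; rewrite GammabarE; set u := v - r.
have uv' : u <= v by rewrite /u; lra.
have e0 := eps_gt0 adm v; have /andP[q0 q1] := @hol_le1 (r + E v) ltac:(lra).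
have m1 : v - a1 p <= Num.max (v - a1 p) 0 by rewrite le_max lexx.
have m2 : 0 <= Num.max (v - a1 p) 0 by rewrite le_max lexx orbT.
have a17 := a1_ge17 adm.
have fuu := fweight_le u.
have fvu : fweight p v <= f0 * expR (Num.max (- u) 0 / 6).
  apply: le_trans (fweight_le v) _; rewrite ler_pM2l // ler_expR ler_pM2r // le_max2 //; lra.
have Ff : fweight p v + fweight p u <= 2 * f0 * expR (Num.max (- u) 0 / 6).
  by rewrite -[leRHS]mulrA; exact: le_double.
have F0 : 0 < fweight p v + fweight p u.
  by apply: addr_gt0; apply: lt_le_trans (fweight_ge _).
apply: (@le_trans _ _ ((2 * f0 * expR (Num.max (- u) 0 / 6)) *
   expR (mu * Num.max a (Num.max (c0 R * v) u)))).
  rewrite -[leRHS]mulr1; apply: ler_pM => //.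
    by rewrite mulr_ge0 ?expR_ge0 // ltW.
  by rewrite ler_pM2r ?expR_gt0.
clear fuu fvu Ff F0 q0 q1 e0.
set Mx := Num.max a _; set V := Num.max v 0; set U := Num.max (- u) 0.
have V0 : 0 <= V by rewrite /V le_max lexx orbT.
have Vv : v <= V by rewrite /V le_max lexx.
have U0 : 0 <= U by rewrite /U le_max lexx orbT.
have hm : Mx <= a + V by rewrite /Mx c0_bounds !ge_max; apply/and3P; split; lra.
have hM : mu * Mx <= mu * a + 7 / 16 * V.
  have : mu * Mx <= mu * (a + V) by rewrite ler_pM2l //; lra.
  have : mu * V <= 7 / 16 * V by rewrite ler_wpM2r.
  by rewrite mulrDr; lra.
have V1 : V <= Num.max (v - a1 p) 0 + a1 p by rewrite /V ge_max; apply/andP; split; lra.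
have -> : 2 * f0 * expR (mu * a + a1 p / 2) * expR (- ((V + U) / 16)) * (g v * h u) =
  2 * f0 * expR (mu * a + a1 p / 2 + - ((V + U) / 16) + (Num.max (v - a1 p) 0 / 2 + U / 2)).
  rewrite -[g v * h u]expRD -(mulrA (2 * f0 * expR _)) -(mulrA (2 * f0)) -!expRD.
  by rewrite !addrA.
rewrite -[leLHS]mulrA -expRD ler_pM2l ?mulr_gt0 // ler_expR.
lra.
Qed.

Lemma normX_bound (k : R -> R[i]) (B : R) : (normX p k <= B%:E)%E ->
  forall v, cabs (k v) <= B * Gammat p v.
Proof.
move=> hB v; rewrite -ler_pdivrMr ?Gammat_gt0 // -lee_fin.
by apply: le_trans hB; apply: ereal_sup_ubound; exists v.
Qed.

Lemma normYbar_bound (D : R -> R -> R[i]) (B : R) : (normYbar p D <= B%:E)%E ->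
  forall v r, 0 < r -> cabs (D v r) <= B * Gammabar p v r.
Proof.
move=> hB v r r0; rewrite -ler_pdivrMr ?Gammabar_gt0 // -lee_fin.
by apply: le_trans hB; apply: ereal_sup_ubound; exists (v, r).
Qed.

Lemma bound_normYbar (D : R -> R -> R[i]) (B : R) :
  (forall v r, 0 < r -> cabs (D v r) <= B * Gammabar p v r) -> (normYbar p D <= B%:E)%E.
Proof.
move=> hB; apply: ge_ereal_sup => _ [[v r] /= r0 <-].
by rewrite lee_fin ler_pdivrMr ?Gammabar_gt0 // hB.
Qed.

End Weights.

(** * Tame functions *)

Section Tame.
Variables (R : realType) (p : params R).
Hypothesis adm : admissible p.
Local Notation E := (eps p).
Local Notation K := (kap p).
Local Notation g := (gwt p).
Local Notation h := (@hwt R).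
Implicit Types (b : bool) (F G : R -> R) (u v w x y c r s t : R).

(** Enough for [Ku] and [Ls] to be convergent integrals, continuous in time. Both the increments of
    [psi] and every solution [D] with initial data in the weighted space belong to this class. *)
Definition tame (D : R -> R -> R -> R[i]) : Prop :=
  (exists2 B : R, 0 <= B & forall t v r b, 0 <= t -> 0 < r ->
     `|pr b (D t v r)| <= B * (g v * h (v - r))) /\
  {within [set x : R * R * R | 0 <= x.1.1 /\ 0 < x.2],
    continuous ((fun x : R * R * R => D x.1.1 x.1.2 x.2) : R * R * R -> R[i]^o)}.

Lemma cont_triple (f1 f2 f3 : R -> R) : continuous f1 -> continuous f2 -> continuous f3 ->
  continuous (fun x => (f1 x, f2 x, f3 x)).
Proof. by move=> c1 c2 c3 x; exact: (cvg_pair (cvg_pair (c1 x) (c2 x)) (c3 x)). Qed.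

Lemma tame_within D b (S : set R) (f1 f2 f3 : R -> R) : tame D ->
  continuous f1 -> continuous f2 -> continuous f3 ->
  (forall x, S x -> 0 <= f1 x /\ 0 < f3 x) ->
  {within S, continuous (fun x => pr b (D (f1 x) (f2 x) (f3 x)))}.
Proof.
move=> [_ cD] c1 c2 c3 hS; apply: pr_within.
apply: (@within_comp _ _ _ _ S _ (fun x => (f1 x, f2 x, f3 x)) cD) => //.
by apply: continuous_subspaceT; exact: cont_triple.
Qed.

(** Clamping time by [Num.max s 0] extends functions of time by constants to negative times, so that
    continuity can be stated on the whole line. *)
Lemma tame_time D b v r : tame D -> 0 < r ->
  continuous (fun s => pr b (D (Num.max s 0) v r)).
Proof.
move=> tD r0; apply: within_setT.
apply: (tame_within (f1 := fun s => Num.max s 0) (f2 := fun=> v) (f3 := fun=> r)) => //.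
- by apply: cont_max; [exact: cont_id | exact: cont_cst].
- exact: cont_cst.
- exact: cont_cst.
- by move=> x _; split => //; rewrite le_max lexx orbT.
Qed.

Lemma mf_if_within (i : interval R) (P : R -> bool) F : {within [set` i], continuous F} ->
  (forall w, P w = (w \in i)) -> mf (fun w => if P w then F w else 0).
Proof.
move=> cF Pi; have mi : measurable ([set` i] : set (measurableTypeR R)) by exact: measurable_itv.
have mF : measurable_fun ([set` i] : set (measurableTypeR R)) F.
  exact: subspace_continuous_measurable_fun.
have -> : (fun w => if P w then F w else 0) = F \_ [set` i].
  by apply/funext => w; rewrite patchE mem_setE Pi.
exact/(measurable_restrictT F mi).
Qed.

Lemma hwt_exp w : h w <= expR (`|w| / 2).
Proof. rewrite ler_expR ler_pM2r // ge_max normr_ge0 andbT -normrN; exact: ler_norm. Qed.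

Lemma gwt_exp w : g w <= expR (`|w| / 2).
Proof.
rewrite ler_expR ler_pM2r // ge_max normr_ge0 andbT.
by have := ler_norm w; have := a1_ge17 adm; lra.
Qed.

Lemma tame_eb D B t v b : tame D -> 0 <= B -> 0 <= t ->
  (forall t v r b, 0 <= t -> 0 < r -> `|pr b (D t v r)| <= B * (g v * h (v - r))) ->
  mf (eb v b (D t)) /\ forall w, `|eb v b (D t) w| <= B * g v * expR (`|w| / 2).
Proof.
move=> tD B0 t0 hB; split.
  apply: (@mf_if_within `]-oo, v[) => [|w]; last by rewrite in_itv.
  apply: (tame_within (f1 := fun=> t) (f2 := fun=> v) (f3 := fun w => v - w)) => //.
  - exact: cont_cst.
  - exact: cont_cst.
  - by apply: contB; [exact: cont_cst | exact: cont_id].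
  - by move=> x /=; rewrite in_itv /= subr_gt0.
move=> w; rewrite /eb; have gv := gwt_gt0 p v; case: ifP => wv.
  have := hB t v (v - w) b t0; rewrite subr_gt0 subKr => /(_ wv) h1.
  by apply: le_trans h1 _; rewrite mulrA ler_wpM2l ?hwt_exp // mulr_ge0 // ltW.
by rewrite normr0 !mulr_ge0 ?expR_ge0 // ltW.
Qed.

Lemma tame_et D B t v r b : tame D -> 0 <= B -> 0 <= t ->
  (forall t v r b, 0 <= t -> 0 < r -> `|pr b (D t v r)| <= B * (g v * h (v - r))) ->
  mf (et v r b (D t)) /\ forall w, `|et v r b (D t) w| <= B * h (v - r) * expR (`|w| / 2).
Proof.
move=> tD B0 t0 hB; split.
  apply: (@mf_if_within `]v - r, +oo[) => [|w]; last by rewrite in_itv /= andbT.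
  apply: (tame_within (f1 := fun=> t) (f2 := fun w => w) (f3 := fun w => w - (v - r))) => //.
  - exact: cont_cst.
  - exact: cont_id.
  - by apply: contB; [exact: cont_id | exact: cont_cst].
  - by move=> x /=; rewrite in_itv /= andbT (subr_gt0 (v - r)).
move=> w; rewrite /et; have hu := hwt_gt0 (v - r); case: ifP => uw.
  have := hB t w (w - (v - r)) b t0; rewrite subr_gt0 subKr => /(_ uw) h1.
  apply: le_trans h1 _; rewrite -!mulrA ler_wpM2l // mulrC ler_wpM2l ?gwt_exp //.
  exact: ltW.
by rewrite normr0 !mulr_ge0 ?expR_ge0 // ltW.
Qed.

Lemma tame_subexp D t v r b : tame D -> 0 <= t ->
  subexp (eb v b (D t)) /\ subexp (et v r b (D t)).
Proof.
move=> tD t0; have [[B B0 hB] _] := tD.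
have [m1 h1] := tame_eb v b tD B0 t0 hB; have [m2 h2] := tame_et v r b tD B0 t0 hB.
split; split => //.
  by exists (B * g v) => //; rewrite mulr_ge0 // ltW // gwt_gt0.
by exists (B * h (v - r)) => //; rewrite mulr_ge0 // ltW // hwt_gt0.
Qed.

Lemma Int_cont (f : R -> R -> R) G : (forall s, mf (f s)) -> (forall w, continuous (f^~ w)) ->
  ig G -> (forall s w, `|f s w| <= G w) -> continuous (fun s => Int (f s)).
Proof.
move=> mfs cf iG hG s.
have s1 : s \in `](s - 1), (s + 1)[ by rewrite in_itv /=; apply/andP; split; lra.
have := @continuity_under_integral R _ _ (@lebesgue_measure R) f setT measurableT (s - 1) (s + 1).
move=> /(_ _ _ G iG _ s); apply.
- by move=> x _; exact: ig_dom (mfs x) iG (hG x).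
- by apply: aeW => y _ x _; exact: cf.
- by move=> x _; apply: aeW => y _; exact: hG.
- by rewrite inE.
Qed.

Section Pair.
Variables (v r : R) (b : bool) (D : R -> R -> R -> R[i]).
Hypotheses (r_gt0 : 0 < r) (tD : tame D).
Local Notation u := (v - r).

Lemma cont_good (k k' : R -> R) : goodk p v r k -> goodk p v r k' ->
  continuous (fun s => Int (fun w => k w * eb v b (D (Num.max s 0)) w + k' w * et v r b (D (Num.max s 0)) w)).
Proof.
move=> [mk [C C0 hk]] [mk' [C' C0' hk']]; have [[B B0 hB] _] := tD.
have s0 s : 0 <= Num.max s 0 by rewrite le_max lexx orbT.
pose G w := K u w * expR (`|w| / 2) + K v w * expR (`|w| / 2).
pose M := C * (B * g v) + C' * (B * h u).
apply: (@Int_cont _ (fun w => M * G w)).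
- move=> s; have [[m1 _] [m2 _]] := tame_subexp v r b tD (s0 s).
  by apply: mfD; apply: mfM.
- move=> w; apply: contD; apply: contM; (try exact: cont_cst).
    by rewrite /eb; case wv : (w < v); [apply: tame_time; rewrite ?subr_gt0 | exact: cont_cst].
  by rewrite /et; case uw : (u < w); [apply: tame_time; rewrite ?(subr_gt0 u) | exact: cont_cst].
- by apply: igZ; apply: igD; exact: ig_kap_exp.
- move=> s w; have [_ h1] := tame_eb v b tD B0 (s0 s) hB.
  have [_ h2] := tame_et v r b tD B0 (s0 s) hB.
  apply: le_trans (ler_normD _ _) _; rewrite !normrM.
  have -> : M * G w = (C * (K u w + K v w)) * (B * g v * expR (`|w| / 2)) +
     (C' * (K u w + K v w)) * (B * h u * expR (`|w| / 2)) by rewrite /M /G; ring.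
  by apply: lerD; apply: ler_pM.
Qed.

Lemma pr_Ku t : 0 <= t -> pr b (Ku p (D t) v r) =
  Int (fun w => kbU p v r w * eb v b (D t) w + ktU p v r w * et v r b (D t) w).
Proof.
move=> t0; have [s1 s2] := tame_subexp v r b tD t0.
by have [_ ->] := rep_Ku adm r_gt0 s1 s2.
Qed.

Lemma pr_Ls t : 0 <= t -> pr b (Ls p (D t) v r) = Int (fun w => kbL p v r w * eb v b (D t) w).
Proof.
move=> t0; have [s1 s2] := tame_subexp v r b tD t0.
by have [_ ->] := rep_Ls adm r_gt0 s1.
Qed.

Lemma Ku_continuous : continuous (fun s => pr b (Ku p (D (Num.max s 0)) v r)).
Proof.
have s0 s : 0 <= Num.max s 0 by rewrite le_max lexx orbT.
under [X in continuous X]eq_fun do rewrite pr_Ku //.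
by apply: cont_good; [exact: goodk_kbU | exact: goodk_ktU].
Qed.

Lemma Ls_continuous : continuous (fun s => pr b (Ls p (D (Num.max s 0)) v r)).
Proof.
have s0 s : 0 <= Num.max s 0 by rewrite le_max lexx orbT.
have g0 : goodk p v r (fun=> 0).
  by split; [exact: mf_cst | exists 0 => // w; rewrite normr0 mul0r].
have := cont_good (goodk_kbL adm v r) g0.
have -> // : (fun s => pr b (Ls p (D (Num.max s 0)) v r)) = fun s => Int (fun w =>
    kbL p v r w * eb v b (D (Num.max s 0)) w + 0 * et v r b (D (Num.max s 0)) w).
apply/funext => s; rewrite pr_Ls //.
by apply: eq_Int => w; rewrite mul0r addr0.
Qed.

End Pair.

(** By linearity the integrand is [kb] and [kt] applied to the difference of the two arguments; the
    bound on this difference makes it at most [N * g v * h (v - r)] times [weighted]. *)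
Lemma KuLs_diff v r b D D' t N C : 0 < r -> tame D -> tame D' -> 0 <= t -> 0 <= N ->
  Int (weighted p v r) <= Vt p v r + C ->
  (forall v r, 0 < r -> `|pr b (D t v r) - pr b (D' t v r)| <= N * (g v * h (v - r))) ->
  `|(pr b (Ku p (D t) v r) - pr b (Ls p (D t) v r)) -
    (pr b (Ku p (D' t) v r) - pr b (Ls p (D' t) v r))| <= (Vt p v r + C) * (N * (g v * h (v - r))).
Proof.
move=> r0 tD tD' t0 N0 hW hN.
have gv := gwt_gt0 p v; have hu := hwt_gt0 (v - r).
have [s1 s2] := tame_subexp v r b tD t0; have [s1' s2'] := tame_subexp v r b tD' t0.
have gU := goodk_kbU adm v r; have gL := goodk_kbL adm v r; have gT := goodk_ktU adm v r.
have igs k e : goodk p v r k -> subexp e -> ig (fun w => k w * e w) by exact: ig_goodk.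
rewrite !pr_Ku // !pr_Ls // -!IntB; last first.
- exact: igs.
- by apply: igD; exact: igs.
- exact: igs.
- by apply: igD; exact: igs.
- by apply: igB; [apply: igD|]; exact: igs.
- by apply: igB; [apply: igD|]; exact: igs.
apply: (@le_trans _ _ (Int (fun w => (N * (g v * h (v - r))) * weighted p v r w))); last first.
  rewrite IntZ; last exact: ig_weighted.
  by rewrite mulrC ler_wpM2r // !mulr_ge0 // ltW.
apply: Int_norm_le; last 1 first.
- move=> w; set eb1 := eb v b (D t) w; set eb2 := eb v b (D' t) w.
  set et1 := et v r b (D t) w; set et2 := et v r b (D' t) w.
  have -> : kbU p v r w * eb1 + ktU p v r w * et1 - kbL p v r w * eb1 -
    (kbU p v r w * eb2 + ktU p v r w * et2 - kbL p v r w * eb2) =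
    kb p v r w * (eb1 - eb2) + kt p v r w * (et1 - et2) by rewrite /kb /kt; ring.
  apply: le_trans (ler_normD _ _) _; rewrite !normrM /weighted mulrDr.
  apply: lerD.
    rewrite /eb1 /eb2 /eb; have [wv|wv] := ltP w v; last first.
      by rewrite subrr normr0 mulr0 /chi mul0r mulr0.
    have := hN v (v - w); rewrite subr_gt0 subKr => /(_ wv) h1.
    have -> : N * (g v * h (v - r)) * (chi R true * (`|kb p v r w| * (h w / h (v - r)))) =
      `|kb p v r w| * (N * (g v * h w)) * (h (v - r) / h (v - r)) * chi R true by ring.
    rewrite divff ?gt_eqF // !mulr1 ler_wpM2l //.
  rewrite /et1 /et2 /et; have [uw|uw] := ltP (v - r) w; last first.
    by rewrite subrr normr0 mulr0 /chi mul0r mulr0.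
  have := hN w (w - (v - r)); rewrite subr_gt0 subKr => /(_ uw) h1.
  have -> : N * (g v * h (v - r)) * (chi R true * (`|kt p v r w| * (g w / g v))) =
    `|kt p v r w| * (N * (g w * h (v - r))) * (g v / g v) * chi R true by ring.
  by rewrite divff ?gt_eqF // !mulr1 ler_wpM2l.
- have m k e : goodk p v r k -> subexp e -> mf (fun w => k w * e w) by move=> [? _] [? _]; exact: mfM.
  by apply: mfB; apply: mfB; [apply: mfD|idtac|apply: mfD|idtac]; exact: m.
- by apply: igZ; exact: ig_weighted.
Qed.

End Tame.

(** * Time integrals *)

Section TimeIntegral.
Variable R : realType.
Local Notation leb := (@lebesgue_measure R).
Implicit Types (F G : R -> R) (s t V lam : R).

Lemma seg_integrable F t : continuous F -> leb.-integrable `[0, t] (EFin \o F).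
Proof.
move=> cF; apply: continuous_compact_integrable; first exact: segment_compact.
exact: continuous_subspaceT.
Qed.

Lemma eq_rint_seg F G t : (forall s, 0 <= s -> F s = G s) -> rint `[0, t] F = rint `[0, t] G.
Proof. by move=> h; apply: eq_Rintegral => s; rewrite inE /= in_itv /= => /andP[/h]. Qed.

Lemma rint_segB F G t : continuous F -> continuous G ->
  rint `[0, t] (fun s => F s - G s) = rint `[0, t] F - rint `[0, t] G.
Proof. by move=> cF cG; apply: RintegralB => //; exact: seg_integrable. Qed.

Lemma rint_seg_le F G t : continuous F -> continuous G ->
  (forall s, 0 <= s <= t -> F s <= G s) -> rint `[0, t] F <= rint `[0, t] G.
Proof.
move=> cF cG h; apply: le_Rintegral => //; try exact: seg_integrable.
Qed.

Lemma rint_seg_norm F G t : continuous F -> continuous G ->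
  (forall s, 0 <= s <= t -> `|F s| <= G s) -> `|rint `[0, t] F| <= rint `[0, t] G.
Proof.
move=> cF cG h; apply: le_trans (le_normr_Rintegral _ (seg_integrable t cF)) _ => //.
by apply: rint_seg_le => //; exact: cont_norm.
Qed.

Lemma rint_seg0 F : rint `[0, 0] F = 0.
Proof. by rewrite /rint set_itv1 Rintegral_set1. Qed.

Lemma rint_seg_FTC (F f : R -> R) t : 0 <= t -> continuous f ->
  (forall s, 0 <= s <= t -> is_derive s 1 F (f s)) -> rint `[0, t] f = F t - F 0.
Proof.
rewrite le_eqVlt => /predU1P[<-|t0] cf dF; first by rewrite rint_seg0 subrr.
have cF s : 0 <= s <= t -> {for s, continuous F}.
  by move=> /dF df; apply/differentiable_continuous/derivable1_diffP; case: df.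
rewrite /rint /Rintegral (@continuous_FTC2 R f F) //.
- exact: continuous_subspaceT.
- split.
  + move=> s; rewrite in_itv /= => /andP[s1 s2]; have [] // := dF s; apply/andP; split; exact: ltW.
  + by apply: cvg_at_right_filter; apply: cF; rewrite lexx ltW.
  + by apply: cvg_at_left_filter; apply: cF; rewrite lexx ltW.
- move=> s; rewrite in_itv /= => /andP[s1 s2]; rewrite derive1E.
  by have [|_ ->] // := dF s; apply/andP; split; exact: ltW.
Qed.

Definition kern V t s : R := expR (- ((t - s) * V)).

Lemma cont_kern V t : continuous (kern V t).
Proof.
apply: cont_expR; apply: contN; apply: contM; last exact: cont_cst.
by apply: contB; [exact: cont_cst | exact: cont_id].
Qed.

Lemma rint_kern V lam t : 0 <= t -> 0 < V + lam ->
  rint `[0, t] (fun s => kern V t s * expR (lam * s)) =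
  (expR (lam * t) - expR (- (t * V))) / (V + lam).
Proof.
move=> t0 Vl; have Vl0 : V + lam != 0 by rewrite gt_eqF.
pose F s := expR (- (t * V)) * (expR ((V + lam) * s) / (V + lam)).
have e s : kern V t s * expR (lam * s) = expR (- (t * V)) * expR ((V + lam) * s).
  by rewrite /kern -!expRD; congr expR; ring.
have cf : continuous (fun s => kern V t s * expR (lam * s)).
  by apply: contM; [exact: cont_kern | apply: cont_expR; apply: contM; [exact: cont_cst | exact: cont_id]].
have dF s : is_derive s 1 F (kern V t s * expR (lam * s)).
  rewrite e.
  have d1 := is_deriveM (is_derive_expRZ (V + lam) s) (is_derive_cst ((V + lam)^-1 : R) s 1).
  have d2 := is_deriveM (is_derive_cst (expR (- (t * V)) : R) s 1) d1.
  apply: (is_derive_eq d2); rewrite /GRing.scale /= /cst.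
  by move: (expR _) (expR _) => A B; field.
rewrite (rint_seg_FTC t0 cf (fun s _ => dF s)) /F mulr0 expR0 mulrA -expRD.
have -> : - (t * V) + (V + lam) * t = lam * t by ring.
by rewrite mulrA mulr1 mulrBl.
Qed.

Lemma rint_kern_le V lam t N F : 0 <= t -> 0 < V + lam -> 0 <= N -> continuous F ->
  (forall s, 0 <= s <= t -> `|F s| <= N * expR (lam * s)) ->
  `|rint `[0, t] (fun s => kern V t s * F s)| <=
  N / (V + lam) * (expR (lam * t) - expR (- (t * V))).
Proof.
move=> t0 Vl N0 cF hF.
have cE : continuous (fun s => expR (lam * s)).
  by apply: cont_expR; apply: contM; [exact: cont_cst | exact: cont_id].
have ck := @cont_kern V t.
have -> : N / (V + lam) * (expR (lam * t) - expR (- (t * V))) =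
  rint `[0, t] (fun s => N * (kern V t s * expR (lam * s))).
  rewrite /rint RintegralZl //; last by apply: seg_integrable; exact: contM.
  by rewrite -/(rint _ _) rint_kern // mulrAC mulrA.
apply: rint_seg_norm; first exact: contM.
  by apply: contM; [exact: cont_cst | exact: contM].
move=> s st; rewrite normrM gtr0_norm ?expR_gt0 // mulrCA ler_wpM2l ?expR_ge0 //.
exact: hF.
Qed.

End TimeIntegral.

(** * Uniqueness in the product weight *)

Section Uniqueness.
Variables (R : realType) (p : params R).
Hypothesis adm : admissible p.
Local Notation g := (gwt p).
Local Notation h := (@hwt R).
Implicit Types (v r t s : R) (b : bool).

(** The norm condition on [D] covers only [t > 0]; at [t = 0] the equation itself gives
    [D 0 = increment psi0]. *)
Lemma difference_tame psi0 psi D B0 : 0 <= B0 ->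
  (forall v r b, 0 < r -> `|pr b (increment psi0 v r)| <= B0 * Gammabar p v r) ->
  difference_solution p psi0 psi D ->
  exists2 B : R, 0 <= B & forall t v r b, 0 <= t -> 0 < r -> `|pr b (D t v r)| <= B * Gammabar p v r.
Proof.
move=> B00 hB0 [cD sD eD]; have [B1 B10 hB1] := ereal_sup_lt_bound sD.
exists (B0 + B1); first exact: addr_ge0.
move=> t v r b; rewrite le_eqVlt => /predU1P[<-|t0] r0; have G0 := Gammabar_gt0 adm v r0.
  have z F : cint `[(0 : R), 0] F = 0.
    by apply: complex_eq_pr => b'; rewrite pr_cint rint_seg0; case: b'.
  have /= -> := eD 0 v r (lexx 0) r0.
  rewrite !z !subr0 mul0r oppr0 expR0 addr0 pr_scale mul1r.
  apply: le_trans (hB0 _ _ _ r0) _; rewrite ler_wpM2r ?(ltW G0) //; lra.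
have := hB1 _ (imageP _ (t0 : [set t | 0 < t] t)).
move=> /(normYbar_bound adm) /(_ v r r0) h1.
apply: le_trans (pr_le_cabs _ _) _; apply: le_trans h1 _.
by rewrite ler_wpM2r ?(ltW G0) //; lra.
Qed.

Lemma Gammabar_tame D : (exists2 B : R, 0 <= B &
    forall t v r b, 0 <= t -> 0 < r -> `|pr b (D t v r)| <= B * Gammabar p v r) ->
  {within [set x : R * R * R | 0 <= x.1.1 /\ 0 < x.2],
    continuous ((fun x : R * R * R => D x.1.1 x.1.2 x.2) : R * R * R -> R[i]^o)} -> tame p D.
Proof.
move=> [B B0 hB] cD; split => //; have [C C0 hC] := Gammabar_le adm.
exists (B * C); first by rewrite mulr_ge0 // ltW.
move=> t v r b t0 r0; apply: le_trans (hB _ _ _ _ t0 r0) _.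
rewrite -mulrA ler_wpM2l //; apply: le_trans (hC _ _ r0) _.
have gh : 0 <= g v * h (v - r) := ltW (mulr_gt0 (gwt_gt0 p v) (hwt_gt0 (v - r))).
rewrite ler_wpM2r // ler_piMr ?(ltW C0) // expR_le1 oppr_le0 divr_ge0 // addr_ge0 //.
  by rewrite le_max lexx orbT.
by rewrite le_max lexx orbT.
Qed.

Lemma pr_difference psi0 psi D b t v r : 0 <= t -> 0 < r -> tame p D ->
  difference_solution p psi0 psi D ->
  pr b (D t v r) = expR (- (t * Vt p v r)) * pr b (increment psi0 v r) +
   rint `[0, t] (fun s => kern (Vt p v r) t s *
     (pr b (Ku p (D (Num.max s 0)) v r) - pr b (Ls p (D (Num.max s 0)) v r))) -
   rint `[0, t] (fun s => kern (Vt p v r) t s * pr b (Kb p (psi s) v r)).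
Proof.
move=> t0 r0 tD [_ _ eD]; have /= -> := eD t v r t0 r0.
rewrite (prB b (_ - _)) (prB b (_ + _)) (prD b (_ * _)) !pr_cint pr_scale subr0.
have cK := @Ku_continuous _ _ adm v r b D r0 tD; have cL := @Ls_continuous _ _ adm v r b D r0 tD.
have ck := @cont_kern R (Vt p v r) t.
congr (_ - _); last by apply: eq_rint_seg => s _; rewrite pr_scale.
rewrite -addrA; congr (_ + _).
have -> : rint `[0, t] (fun s => kern (Vt p v r) t s *
     (pr b (Ku p (D (Num.max s 0)) v r) - pr b (Ls p (D (Num.max s 0)) v r))) =
   rint `[0, t] (fun s => kern (Vt p v r) t s * pr b (Ku p (D (Num.max s 0)) v r) -
     kern (Vt p v r) t s * pr b (Ls p (D (Num.max s 0)) v r)).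
  by apply: eq_rint_seg => s _; rewrite mulrBr.
rewrite rint_segB; [|exact: contM|exact: contM].
by congr (_ - _); apply: eq_rint_seg => s s0; rewrite pr_scale max_l.
Qed.

(** The source [Kb] depends on [psi] alone and cancels. The factor is below 1 but approaches 1 as
    [Vt] grows, so this is not a uniform contraction. *)
Lemma difference_contract psi0 psi D D' C N lam : tame p D -> tame p D' ->
  difference_solution p psi0 psi D -> difference_solution p psi0 psi D' ->
  (forall v r, 0 < r -> Int (weighted p v r) <= Vt p v r + C) ->
  0 <= C -> C < lam -> 0 <= N ->
  (forall t v r b, 0 <= t -> 0 < r ->
     `|pr b (D t v r) - pr b (D' t v r)| <= N * expR (lam * t) * (g v * h (v - r))) ->
  forall t v r b, 0 <= t -> 0 < r ->
    `|pr b (D t v r) - pr b (D' t v r)| <=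
    (Vt p v r + C) / (Vt p v r + lam) * (N * expR (lam * t) * (g v * h (v - r))).
Proof.
move=> tD tD' sD sD' hC C0 Cl N0 hN t v r b t0 r0.
have V0 := Vt_ge0 adm v r0; set V := Vt p v r in V0 *.
have G0 : 0 < g v * h (v - r) := mulr_gt0 (gwt_gt0 p v) (hwt_gt0 (v - r)).
have Vl : 0 < V + lam by lra.
have VC : 0 <= V + C by lra.
pose X D s := pr b (Ku p (D (Num.max s 0)) v r) - pr b (Ls p (D (Num.max s 0)) v r).
have cX D1 : tame p D1 -> continuous (X D1).
  by move=> tD1; apply: contB; [exact: Ku_continuous | exact: Ls_continuous].
have ck := @cont_kern R V t.
rewrite (@pr_difference psi0 psi D b t v r t0 r0 tD sD) (@pr_difference psi0 psi D' b t v r t0 r0 tD' sD') -/V.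
have -> (x y z w : R) : x + y - w - (x + z - w) = y - z by ring.
rewrite -rint_segB; [|by apply: contM; [|exact: (cX D)]|by apply: contM; [|exact: (cX D')]].
have -> : rint `[0, t] (fun s => kern V t s * X D s - kern V t s * X D' s) =
  rint `[0, t] (fun s => kern V t s * (X D s - X D' s)).
  by apply: eq_rint_seg => s _; rewrite [RHS]mulrBr.
apply: le_trans (rint_kern_le (N := (V + C) * (N * (g v * h (v - r)))) t0 Vl _ _ _) _.
- exact: mulr_ge0 VC (mulr_ge0 N0 (ltW G0)).
- by apply: contB; exact: cX.
- move=> s /andP[s0 st]; rewrite /X max_l //.
  have -> : (V + C) * (N * (g v * h (v - r))) * expR (lam * s) =
    (V + C) * ((N * expR (lam * s)) * (g v * h (v - r))) by ring.
  apply: (@KuLs_diff _ _ adm v r b D D' s (N * expR (lam * s)) C r0 tD tD' s0).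
  + by rewrite mulr_ge0 ?expR_ge0.
  + exact: hC.
  + by move=> v' r' r0'; exact: hN.
have -> : (V + C) / (V + lam) * (N * expR (lam * t) * (g v * h (v - r))) =
  (V + C) * (N * (g v * h (v - r))) / (V + lam) * expR (lam * t) by ring.
rewrite ler_wpM2l //; last by rewrite gerBl expR_ge0.
exact: divr_ge0 (mulr_ge0 VC (mulr_ge0 N0 (ltW G0))) (ltW Vl).
Qed.

Lemma difference_unique psi0 psi D D' B0 : 0 <= B0 ->
  (forall v r b, 0 < r -> `|pr b (increment psi0 v r)| <= B0 * Gammabar p v r) ->
  difference_solution p psi0 psi D -> difference_solution p psi0 psi D' ->
  forall t v r, 0 <= t -> 0 < r -> D' t v r = D t v r.
Proof.
move=> B00 hB0 sD sD'.
have [B1 B10 hB1] := difference_tame B00 hB0 sD.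
have [B2 B20 hB2] := difference_tame B00 hB0 sD'.
have tD : tame p D by apply: Gammabar_tame; [exists B1 | case: sD].
have tD' : tame p D' by apply: Gammabar_tame; [exists B2 | case: sD'].
have [C C0 hC] := weighted_bound adm.
have [G G0 hG] := Gammabar_le adm.
pose lam := C + 1; pose M := (B1 + B2) * G.
pose q t v r b := `|pr b (D t v r) - pr b (D' t v r)| / (expR (lam * t) * (g v * h (v - r))).
have gh v r : 0 < g v * h (v - r) := mulr_gt0 (gwt_gt0 p v) (hwt_gt0 (v - r)).
have egh t v r : 0 < expR (lam * t) * (g v * h (v - r)) by rewrite mulr_gt0 ?expR_gt0.
have M0 : 0 <= M by rewrite mulr_ge0 ?addr_ge0 // ltW.
have decay t v r b : 0 <= t -> 0 < r ->
    q t v r b <= M * expR (- ((Num.max v 0 + Num.max (- (v - r)) 0) / 16)).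
  move=> t0 r0; rewrite /q ler_pdivrMr //.
  apply: (@le_trans _ _ ((B1 + B2) * Gammabar p v r)).
    apply: le_trans (ler_normB _ _) _; rewrite mulrDl.
    by apply: lerD; [exact: hB1 | exact: hB2].
  have e1 : 1 <= expR (lam * t) by rewrite -expR0 ler_expR mulr_ge0 // /lam; lra.
  set e2 := expR (- _).
  have -> : M * e2 * (expR (lam * t) * (g v * h (v - r))) =
    (B1 + B2) * (G * e2 * (g v * h (v - r)) * expR (lam * t)) by rewrite /M; ring.
  rewrite ler_wpM2l ?addr_ge0 //; apply: le_trans (hG _ _ r0) _.
  by rewrite ler_peMr // ltW // !mulr_gt0 // expR_gt0.
pose S := [set y | exists t v r b, [/\ 0 <= t, 0 < r & y = q t v r b]].
have S1 : S (q 0 0 1 true) by exists 0, 0, 1, true.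
have ubS : ubound S M.
  move=> _ [t [v [r [b [t0 r0 ->]]]]]; apply: le_trans (decay _ _ _ _ t0 r0) _.
  rewrite ler_piMr // expR_le1 oppr_le0 divr_ge0 // addr_ge0 //.
    by rewrite le_max lexx orbT.
  by rewrite le_max lexx orbT.
have hubS : has_ubound S by exists M.
have qS t v r b : 0 <= t -> 0 < r -> q t v r b <= sup S.
  by move=> t0 r0; apply: ub_le_sup => //; exists t, v, r, b.
have q0 t v r b : 0 <= q t v r b by rewrite divr_ge0 // ltW.
have S0 : 0 <= sup S by apply: le_trans (q0 0 0 1 true) _; exact: qS.
suff Sz : sup S <= 0.
  move=> t v r t0 r0; apply: complex_eq_pr => b; apply/esym/eqP; rewrite -subr_eq0 -normr_le0.
  have := le_trans (qS t v r b t0 r0) Sz; rewrite /q ler_pdivrMr // mul0r.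
  exact.
rewrite leNgt; apply/negP => Spos.
(* With [x = 2 M / sup S + 1], [e^x >= x] gives [M e^{-x} <= sup S / 2]; the factor 16 undoes the
   rate of [Gammabar_le]. *)
have [rho rho0 hrho] : exists2 rho : R, 0 < rho & M * expR (- (rho / 16)) <= sup S / 2.
  have rr : 0 <= 2 * M / sup S := divr_ge0 (mulr_ge0 (ler0n R 2) M0) S0.
  exists (16 * (2 * M / sup S + 1)); first lra.
  have -> : 16 * (2 * M / sup S + 1) / 16 = 2 * M / sup S + 1 by field; rewrite gt_eqF.
  set x := 2 * M / sup S + 1.
  have x1 : x <= expR x by have := expR_ge1Dx x; lra.
  have x0 : 0 < x by rewrite /x; lra.
  rewrite expRN ler_pdivrMr ?expR_gt0 //.
  apply: (@le_trans _ _ (sup S / 2 * x)); last by rewrite ler_wpM2l // divr_ge0 // ltW.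
  have -> : sup S / 2 * x = M + sup S / 2 by rewrite /x; field; rewrite gt_eqF.
  by rewrite lerDl divr_ge0 // ltW.
have [V hV] := Vt_bounded adm rho.
pose V' := Num.max V 0; pose th := (V' + C) / (V' + lam).
have V'0 : 0 <= V' by rewrite /V' le_max lexx orbT.
have th1 : th < 1 by rewrite /th ltr_pdivrMr /lam; lra.
have th0 : 0 <= th by rewrite /th divr_ge0 /lam; lra.
have contract t v r b : 0 <= t -> 0 < r ->
    q t v r b <= (Vt p v r + C) / (Vt p v r + lam) * sup S.
  move=> t0 r0; rewrite /q ler_pdivrMr // -[leRHS]mulrA [sup S * _]mulrA.
  apply: (difference_contract tD tD' sD sD' hC (ltW C0) _ S0) => //; first by rewrite /lam; lra.
  by move=> t' v' r' b' t0' r0'; rewrite -mulrA -ler_pdivrMr //; exact: qS.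
(* At distance [rho] or more the quotient has decayed below half its supremum; nearer, [Vt] is
   bounded and the contraction factor is at most [th < 1]. Neither is compatible with a positive
   supremum. *)
have : sup S <= Num.max (sup S / 2) (th * sup S).
  apply: ge_sup; first by exists (q 0 0 1 true).
  move=> _ [t [v [r [b [t0 r0 ->]]]]]; rewrite le_max.
  have m1 : v <= Num.max v 0 by rewrite le_max lexx.
  have m2 : - (v - r) <= Num.max (- (v - r)) 0 by rewrite le_max lexx.
  have m3 : 0 <= Num.max v 0 by rewrite le_max lexx orbT.
  have m4 : 0 <= Num.max (- (v - r)) 0 by rewrite le_max lexx orbT.
  have [far|nfar] := leP rho (Num.max v 0 + Num.max (- (v - r)) 0).
    apply/orP; left; apply: le_trans (decay _ _ _ _ t0 r0) _; apply: le_trans hrho.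
    by rewrite ler_wpM2l // ler_expR; lra.
  apply/orP; right; apply: le_trans (contract _ _ _ _ t0 r0) _.
  rewrite ler_wpM2r // /th.
  have V0 := Vt_ge0 adm v r0.
  have VV : Vt p v r <= V' by rewrite /V' le_max hV //; lra.
  rewrite ler_pdivrMr /lam; last lra.
  by rewrite mulrAC ler_pdivlMr; [nra | lra].
by rewrite le_max => /orP[|]; [lra | rewrite leNgt gtr_pMl // th1].
Qed.

End Uniqueness.

(** * The equation for the increments *)

Section Duhamel.
Variable R : realType.
Implicit Types (F G : R -> R) (s t V : R).

Lemma primitive_exists F : continuous F ->
  exists Y : R -> R, forall s, 0 <= s -> is_derive s 1 Y (F s).
Proof.
(* The base point -1 keeps 0 in the interior, so that the derivative at [s = 0] is two-sided. *)
move=> cF; exists (fun s => rint `[-1, s] F) => s s0.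
have s1 : s < s + 1 by rewrite ltrDl.
have iF : (@lebesgue_measure R).-integrable `[-1, s + 1] (EFin \o F).
  apply: continuous_compact_integrable; first exact: segment_compact.
  exact: continuous_subspaceT.
have m1 : (-1 < s :> R) by lra.
have [d e] := continuous_FTC1_closed s1 iF m1 (cF s).
split; first exact: d.
by rewrite -[RHS]e derive1E.
Qed.

(** The formula is the integrated form of [x' = - V x + F], and
    [- V x + F = - V' x + (F + (V' - V) x)]. It brings [psi v] and [psi (v - r)], whose natural
    rates differ, to a common rate. *)
Lemma duhamel_rate V V' (x : R -> R) (x0 : R) F : continuous F -> continuous x ->
  (forall t, 0 <= t -> x t = expR (- (t * V)) * x0 + rint `[0, t] (fun s => kern V t s * F s)) ->
  forall t, 0 <= t -> x t = expR (- (t * V')) * x0 +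
    rint `[0, t] (fun s => kern V' t s * (F s + (V' - V) * x s)).
Proof.
move=> cF cx hx.
have cexp c : continuous (fun s => expR (c * s)).
  by apply: cont_expR; apply: contM; [exact: cont_cst | exact: cont_id].
have pull c t G : continuous G ->
    rint `[0, t] (fun s => kern c t s * G s) =
    expR (- (t * c)) * rint `[0, t] (fun s => expR (c * s) * G s).
  move=> cG; rewrite /rint -RintegralZl //; last first.
    by apply: seg_integrable; apply: contM; [exact: cexp | exact: cG].
  apply: eq_Rintegral => s _; rewrite mulrA -expRD /kern; congr (expR _ * _); ring.
have cG : continuous (fun s => expR (V * s) * F s) by apply: contM; [exact: cexp | exact: cF].
have [Y dY] := primitive_exists cG.
have xE t : 0 <= t -> x t = expR (- (t * V)) * (x0 + (Y t - Y 0)).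
  move=> t0; rewrite hx // (pull _ _ _ cF) mulrDr; congr (_ + _ * _).
  by apply: rint_seg_FTC => // s /andP[s0 _]; exact: dY.
move=> t t0; have cH : continuous (fun s => F s + (V' - V) * x s).
  by apply: contD => //; apply: contM => //; exact: cont_cst.
rewrite (pull _ _ _ cH).
pose Z s := expR ((V' - V) * s) * (x0 + (Y s - Y 0)).
rewrite (_ : rint _ _ = Z t - Z 0); last first.
  apply: (rint_seg_FTC t0); first by apply: contM; [exact: cexp | exact: cH].
  move=> s /andP[s0 _]; have dYs := dY _ s0.
  have d1 := is_deriveB dYs (is_derive_cst (Y 0) s 1).
  have d2 := is_deriveD (is_derive_cst x0 s 1) d1.
  have d3 := is_deriveM (is_derive_expRZ (V' - V) s) d2.
  apply: (is_derive_eq d3); rewrite /GRing.scale /= xE //.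
  have -> : expR (V' * s) = expR ((V' - V) * s) * expR (V * s).
    by rewrite -expRD; congr expR; ring.
  have h : expR (V * s) * expR (- (s * V)) = 1 by rewrite [s * V]mulrC expRxMexpNx_1.
  move: (expR ((V' - V) * s)) (expR (V * s)) (expR (- (s * V))) h => A B C h.
  rewrite [RHS]mulrDr [A * B * F s]mulrAC.
  have -> : A * B * ((V' - V) * (C * (x0 + (Y s - Y 0)))) =
     A * ((V' - V) * (x0 + (Y s - Y 0))) * (B * C) by ring.
  rewrite h (_ : (cst x0 + (Y - cst (Y 0))) s = x0 + (Y s - Y 0)) //.
  by ring.
rewrite /Z mulr0 expR0 subrr addr0 mul1r xE //.
have -> : expR (- (t * V)) = expR (- (t * V')) * expR ((V' - V) * t).
  by rewrite -expRD; congr expR; ring.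
by move: (expR _) (expR _) => A B; ring.
Qed.

End Duhamel.

Section Evolution.
Variables (R : realType) (p : params R).
Hypothesis adm : admissible p.
Variables (psi0 : R -> R[i]) (psi : R -> R -> R[i]).
Hypothesis sol : evolution_solution p psi0 psi.
Local Notation K := (kap p).
Local Notation E := (eps p).
Implicit Types (u v w r s t : R) (b : bool).

Lemma psi_bound : exists2 B : R, 0 <= B &
  forall t v b, 0 <= t -> `|pr b (psi t v)| <= B * Gammat p v.
Proof.
have [_ sB _] := sol; have [B B0 hB] := ereal_sup_lt_bound sB.
exists B => // t v b t0; apply: le_trans (pr_le_cabs _ _) _.
by apply: (@normX_bound _ p (psi t) B); apply: hB; exists t.
Qed.

Lemma psi_exp_bound : exists2 B : R, 0 <= B &
  forall t v b, 0 <= t -> `|pr b (psi t v)| <= B * expR (`|v| / 4).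
Proof.
have [B B0 hB] := psi_bound; have [C C0 hC] := Gammat_le adm.
exists (B * C) => [|t v b t0]; first by rewrite mulr_ge0 // ltW.
by apply: le_trans (hB _ _ _ t0) _; rewrite -mulrA ler_wpM2l.
Qed.

Lemma psi_within b (S : set R) (f1 f2 : R -> R) : continuous f1 -> continuous f2 ->
  (forall x, S x -> 0 <= f1 x) -> {within S, continuous (fun x => pr b (psi (f1 x) (f2 x)))}.
Proof.
have [cpsi _ _] := sol; move=> c1 c2 hS; apply: pr_within.
apply: (@within_comp _ _ _ _ S _ (fun x => (f1 x, f2 x)) cpsi) => //.
apply: continuous_subspaceT => x; exact: (cvg_pair (c1 x) (c2 x)).
Qed.

Lemma max0_ge0 s : 0 <= Num.max s 0. Proof. by rewrite le_max lexx orbT. Qed.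

Lemma psi_time b v : continuous (fun s => pr b (psi (Num.max s 0) v)).
Proof.
apply: within_setT; apply: (@psi_within b setT (fun s => Num.max s 0) (fun=> v)).
- by apply: cont_max; [exact: cont_id | exact: cont_cst].
- exact: cont_cst.
- by move=> x _; exact: max0_ge0.
Qed.

Lemma psi_space b t : 0 <= t -> continuous (fun v => pr b (psi t v)).
Proof.
move=> t0; apply: within_setT; apply: (@psi_within b setT (fun=> t) (fun v => v)) => //.
- exact: cont_cst.
- exact: cont_id.
Qed.

Lemma subexp_psi b t : 0 <= t -> subexp (fun w => pr b (psi t w)).
Proof.
move=> t0; split; first exact: (mf_cont (@psi_space b t t0)).
have [B B0 hB] := psi_exp_bound; exists B => // w; apply: le_trans (hB _ _ _ t0) _.
rewrite ler_wpM2l // ler_expR; have := normr_ge0 w; lra.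
Qed.

Lemma goodk_self v : goodk p v 1 (K v).
Proof. by apply: (@goodk_kap _ _ adm v 1 v); right. Qed.

Lemma ig_gker b t v : 0 <= t -> ig (fun w => K v w * pr b (psi t w)).
Proof. by move=> t0; apply: (ig_goodk adm (goodk_self v)); exact: subexp_psi. Qed.

Lemma gker_continuous b v :
  continuous (fun s => Int (fun w => K v w * pr b (psi (Num.max s 0) w))).
Proof.
have [B B0 hB] := psi_exp_bound.
apply: (@Int_cont _ _ (fun w => B * (K v w * expR (`|w| / 2)))).
- by move=> s; apply: ig_mf; apply: ig_gker; exact: max0_ge0.
- by move=> w; apply: contM; [exact: cont_cst | exact: psi_time].
- by apply: igZ; exact: ig_kap_exp.
- move=> s w; rewrite normrM (ger0_norm (kap_ge0 adm _ _)) mulrCA ler_wpM2l ?kap_ge0 //.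
  apply: le_trans (hB _ _ _ (max0_ge0 s)) _; rewrite ler_wpM2l // ler_expR.
  by have := normr_ge0 w; lra.
Qed.

Lemma VeE v : Ve p v = Int (K v).
Proof.
rewrite /Ve -/(Int _); apply: (@Int_off _ _ _ v v); first exact: ig_mf (ig_kap adm v).
by move=> w wv _; exact: K3e_kap.
Qed.

Lemma pr_gker b t v : 0 <= t ->
  pr b (cint setT (fun w => (K3e p v w)%:C%C * psi t w)) = Int (fun w => K v w * pr b (psi t w)).
Proof.
move=> t0; rewrite pr_cint -/(Int _); apply: (@Int_off _ _ _ v v).
  exact: ig_mf (ig_gker b v t0).
by move=> w wv _; rewrite pr_scale K3e_kap.
Qed.

Lemma pr_L3e b t v : 0 <= t -> pr b (L3e p (psi t) v) =
  Ve p v * pr b (psi t v) - Int (fun w => K v w * pr b (psi t w)).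
Proof.
move=> t0; rewrite VeE mulrC -IntZ; last exact: ig_kap.
have i1 : ig (fun w => pr b (psi t v) * K v w) by apply: igZ; exact: ig_kap.
rewrite -IntB //; last exact: ig_gker.
rewrite /L3e pr_cint -/(Int _); apply: (@Int_off _ _ _ v v).
  by apply: ig_mf; apply: igB => //; exact: ig_gker.
by move=> w wv _; rewrite pr_scale prB K3e_kap // mulrBr [pr b (psi t v) * _]mulrC.
Qed.

Lemma pr_psi b t v : 0 <= t -> pr b (psi t v) = expR (- (t * Ve p v)) * pr b (psi0 v) +
  rint `[0, t] (fun s => kern (Ve p v) t s * Int (fun w => K v w * pr b (psi (Num.max s 0) w))).
Proof.
have [_ _ eq] := sol; move=> t0; rewrite eq // prD pr_scale pr_cint; congr (_ + _).
by apply: eq_rint_seg => s s0; rewrite pr_scale pr_gker // max_l.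
Qed.

Lemma pr_L3e_continuous b v : continuous (fun s => pr b (L3e p (psi (Num.max s 0)) v)).
Proof.
under [X in continuous X]eq_fun do rewrite (pr_L3e _ _ (max0_ge0 _)).
apply: contB; last exact: gker_continuous.
by apply: contM; [exact: cont_cst | exact: psi_time].
Qed.

(** The rate is left free: [Vt v r] leads to the equation for the increments, and [Ve v] to their
    Hoelder bound. *)
Lemma pr_psi_rate b t v V : 0 <= t -> pr b (psi t v) = expR (- (t * V)) * pr b (psi0 v) +
  rint `[0, t] (fun s => kern V t s *
    (V * pr b (psi (Num.max s 0) v) - pr b (L3e p (psi (Num.max s 0)) v))).
Proof.
move=> t0; pose x s := pr b (psi (Num.max s 0) v).
have := @duhamel_rate R (Ve p v) V x (pr b (psi0 v)) _ (@gker_continuous b v) (@psi_time b v).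
move=> /(_ _ t t0); rewrite /x max_l // => -> //; last first.
  by move=> s s0; rewrite max_l // (pr_psi _ _ s0).
congr (_ + _); apply: eq_rint_seg => s s0; congr (_ * _).
by rewrite pr_L3e ?max0_ge0 //; ring.
Qed.

Lemma increment_tame : tame p (fun t v r => increment (psi t) v r).
Proof.
split.
  have [B B0 hB] := psi_exp_bound; have [C C0 hC] := exp_quarter_GG adm.
  exists (2 * B * C) => [|t v r b t0 r0]; first by rewrite !mulr_ge0 // ltW.
  have uv : v - r <= v by rewrite lerBlDr lerDl ltW.
  have [h1 h2] := hC _ _ uv; rewrite /increment prB.
  apply: le_trans (ler_normB _ _) _; rewrite -!mulrA; apply: le_double.
    by apply: le_trans (hB _ _ _ t0) _; rewrite ler_wpM2l.
  by apply: le_trans (hB _ _ _ t0) _; rewrite ler_wpM2l.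
have [cpsi _ _] := sol.
have c11 : continuous (fun x : R * R * R => x.1.1).
  by move=> x; apply: (@cvg_comp _ _ _ fst fst _ (nbhs x.1)); exact: cvg_fst.
have c12 : continuous (fun x : R * R * R => x.1.2).
  by move=> x; apply: (@cvg_comp _ _ _ fst snd _ (nbhs x.1)); [exact: cvg_fst | exact: cvg_snd].
have c2 : continuous (fun x : R * R * R => x.2) by move=> x; exact: cvg_snd.
have c12B : continuous (fun x : R * R * R => x.1.2 - x.2).
  by move=> x; apply: cvgB; [exact: c12 | exact: c2].
have cw (f : R * R * R -> R) : continuous f ->
    {within [set x : R * R * R | 0 <= x.1.1 /\ 0 < x.2],
      continuous ((fun x => psi x.1.1 (f x)) : R * R * R -> R[i]^o)}.
  move=> cf; apply: (within_comp (phi := fun x : R * R * R => (x.1.1, f x)) cpsi) => [|x []] //.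
  by apply: continuous_subspaceT => x; exact: (cvg_pair (c11 x) (cf x)).
have /subspace_continuousP h1 := cw _ c12; have /subspace_continuousP h2 := cw _ c12B.
apply/subspace_continuousP => x Ax; apply: pr_cvgE => b.
rewrite /increment prB; under eq_fun do rewrite prB.
by apply: cvgB; apply: pr_cvg; [exact: h1 | exact: h2].
Qed.

(** At the common rate [Vt v r] the sources at [v] and [v - r] differ by
    [Vt D - (L3e psi v - L3e psi (v - r))], which is [Ku D - Ls D - Kb psi] by the definition of
    [Kb]. *)
Lemma increment_equation t v r : 0 <= t -> 0 < r ->
  let semigroup s := (expR (- ((t - s) * Vt p v r)))%:C%C in
  let D t v r := increment (psi t) v r in
  D t v r =
    semigroup 0 * increment psi0 v r
    + cint `[0, t] (fun s => semigroup s * Ku p (D s) v r)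
    - cint `[0, t] (fun s => semigroup s * Ls p (D s) v r)
    - cint `[0, t] (fun s => semigroup s * Kb p (psi s) v r).
Proof.
move=> t0 r0 /=; pose D t v r := increment (psi t) v r.
apply: complex_eq_pr => b.
rewrite (prB b (_ - _)) (prB b (_ + _)) (prD b (_ * _)) !pr_cint pr_scale subr0.
set V := Vt p v r.
have cK := @Ku_continuous _ _ adm v r b D r0 increment_tame.
have cL := @Ls_continuous _ _ adm v r b D r0 increment_tame.
have c3 := @pr_L3e_continuous b.
have cp := @psi_time b.
have ck := @cont_kern R V t.
pose k s := pr b (Ku p (D (Num.max s 0)) v r).
pose l s := pr b (Ls p (D (Num.max s 0)) v r).
pose d s := pr b (psi (Num.max s 0) v) - pr b (psi (Num.max s 0) (v - r)).
pose L s := pr b (L3e p (psi (Num.max s 0)) v) - pr b (L3e p (psi (Num.max s 0)) (v - r)).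
have cd : continuous d by apply: contB.
have cL3 : continuous L by apply: contB.
have cB : continuous (fun s => L s - (V * d s - k s + l s)).
  apply: contB => //; apply: contD => //; apply: contB => //.
  by apply: contM => //; exact: cont_cst.
have -> : rint `[0, t] (fun s => pr b ((expR (- ((t - s) * V)))%:C%C * Ku p (D s) v r)) =
    rint `[0, t] (fun s => kern V t s * k s).
  by apply: eq_rint_seg => s s0; rewrite pr_scale /k max_l.
have -> : rint `[0, t] (fun s => pr b ((expR (- ((t - s) * V)))%:C%C * Ls p (D s) v r)) =
    rint `[0, t] (fun s => kern V t s * l s).
  by apply: eq_rint_seg => s s0; rewrite pr_scale /l max_l.
have -> : rint `[0, t] (fun s => pr b ((expR (- ((t - s) * V)))%:C%C * Kb p (psi s) v r)) =
    rint `[0, t] (fun s => kern V t s * (L s - (V * d s - k s + l s))).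
  apply: eq_rint_seg => s s0; rewrite pr_scale /L /d /k /l max_l //; congr (_ * _).
  rewrite /Kb (prB b (_ - _)) (prD b (_ - _)) (prB b (_ * _)) pr_scale.
  by rewrite (prB b (L3e _ _ _)) (prB b (psi s v)).
rewrite /increment !prB (pr_psi_rate b v V t0) (pr_psi_rate b (v - r) V t0).
have -> (x y z w : R) : x + y - (z + w) = x - z + (y - w) by ring.
rewrite -mulrBr -!addrA; congr (_ + _).
have cV v' : continuous (fun s => kern V t s *
    (V * pr b (psi (Num.max s 0) v') - pr b (L3e p (psi (Num.max s 0)) v'))).
  apply: contM; first exact: ck.
  by apply: contB; [apply: contM; [exact: cont_cst | exact: cp] | exact: c3].
rewrite -rint_segB // addrA -rint_segB //; [|exact: contM..].
rewrite -rint_segB; [|by apply: contB; exact: contM|exact: contM].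
have alg (q V' x y z z' k' l' : R) : q * (V' * x - z) - q * (V' * y - z') =
  q * k' - q * l' - q * (z - z' - (V' * (x - y) - k' + l')) by ring.
by apply: eq_rint_seg => s s0; exact: alg.
Qed.

End Evolution.

(** * Coupled and uncoupled jumps *)

Section NearFar.
Variables (R : realType) (p : params R).
Hypothesis adm : admissible p.
Local Notation K := (kap p).
Local Notation E := (eps p).
Implicit Types (u v w x y r s t l rho : R).

Lemma close_max rho a b c d : close rho a b -> close rho c d ->
  close rho (Num.max a c) (Num.max b d) :> Prop.
Proof.
have e := expR_ge0 rho; move=> [h1 h2] [h3 h4].
by split; rewrite ge_max; apply/andP; split; (apply: le_trans; first eassumption);
  rewrite ler_wpM2l // le_max lexx ?orbT.
Qed.

Lemma max_dist v w v' w' r : `|v - v'| <= r -> `|w - w'| <= r ->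
  `|Num.max v w - Num.max v' w'| <= r.
Proof.
rewrite !ler_norml => /andP[h1 h2] /andP[h3 h4].
by case: (leP v w) => ?; case: (leP v' w') => ?; apply/andP; split; lra.
Qed.

Lemma min_dist v w v' w' r : `|v - v'| <= r -> `|w - w'| <= r ->
  `|Num.min v w - Num.min v' w'| <= r.
Proof.
rewrite !ler_norml => /andP[h1 h2] /andP[h3 h4].
by case: (leP v w) => ?; case: (leP v' w') => ?; apply/andP; split; lra.
Qed.

(** The factors contribute 3/2, 1, 2 and 6 times [r], rounded up to 11; the singular denominator
    contributes [rho]. *)
Lemma close_kap v w v' w' r rho : 0 <= rho -> `|v - v'| <= r -> `|w - w'| <= r ->
  close rho (width p v w) (width p v' w') -> close (11 * r + rho) (K v w) (K v' w').
Proof.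
move=> rho0 vr wr cw; have r0 : 0 <= r by apply: le_trans vr; exact: normr_ge0.
have n0 := nbar_gt0 adm; have n4 : 0 <= 4 * par_nbar p by lra.
have pos v1 := ltW (om_gt0 v1 : 0 < om v1).
have pos2 v1 := ltW (lnp_gt0 v1 : 0 < lnp v1 :> R).
have pos3 m x : 0 <= sig m x :> R := ltW (sig_gt0 m x).
have wid v1 w1 : 0 <= (1 - expR (- width p v1 w1))^-1 by rewrite invr_ge0 ltW // den_gt0.
have c1 : close 0 (4 * par_nbar p) (4 * par_nbar p) by exact: closexx.
have c2 : close (3 / 2 * r) (om v) (om v').
  by apply: close_le (close_om v v') => //; rewrite ler_wpM2l.
have c3 : close r (lnp w) (lnp w') by apply: close_le (close_lnp w w').
have c4 : close (2 * r) (expR (v - Num.max v w)) (expR (v' - Num.max v' w')).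
  apply: close_expR; have := max_dist vr wr; move: vr.
  by rewrite !ler_norml => /andP[? ?] /andP[? ?]; apply/andP; split; lra.
have c5 : close (6 * r) (sig (Num.min v w) `|v - w|) (sig (Num.min v' w') `|v' - w'|).
  apply: close_le (close_sig _ _ _ _) => //.
  have h1 := min_dist vr wr.
  have h2 : `| `|v - w| - `|v' - w'| | <= 2 * r.
    apply: le_trans (ler_dist_dist _ _) _.
    have -> : v - w - (v' - w') = (v - v') - (w - w') by ring.
    by apply: le_trans (ler_normB _ _) _; lra.
  lra.
have c6 : close rho (1 - expR (- width p v w))^-1 (1 - expR (- width p v' w'))^-1.
  apply: closeV; [exact: den_gt0 | exact: den_gt0 |].
  by apply: close_subr1_expRN => //; apply: ltW; exact: width_gt0.
have e0 x : 0 <= expR x := expR_ge0 x.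
rewrite kap.unlock -!/(width p _ _).
have m2 := closeM n4 n4 (pos v) (pos v') c1 c2.
have p2 v1 : 0 <= 4 * par_nbar p * om v1 := mulr_ge0 n4 (pos v1).
have m3 := closeM (p2 v) (p2 v') (pos2 w) (pos2 w') m2 c3.
have p3 v1 w1 : 0 <= 4 * par_nbar p * om v1 * lnp w1 := mulr_ge0 (p2 v1) (pos2 w1).
have m4 := closeM (p3 v w) (p3 v' w') (e0 _) (e0 _) m3 c4.
have p4 v1 w1 x := mulr_ge0 (p3 v1 w1) (e0 x).
have m5 := closeM (p4 v w _) (p4 v' w' _) (pos3 _ _) (pos3 _ _) m4 c5.
have p5 v1 w1 x m y := mulr_ge0 (p4 v1 w1 x) (pos3 m y).
have m6 := closeM (p5 v w _ _ _) (p5 v' w' _ _ _) (wid v w) (wid v' w') m5 c6.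
apply: close_le m6; [exact: mulr_ge0 (p5 _ _ _ _ _) (wid _ _)|exact: mulr_ge0 (p5 _ _ _ _ _) (wid _ _)|].
lra.
Qed.

(** A common translation keeps the distance [|v - w|], so the singular denominator changes only
    through [eps]. *)
Lemma kap_translate v w r : 0 <= r -> close ((11 + gam p) * r) (K v w) (K (v - r) (w - r)).
Proof.
move=> r0; rewrite mulrDl; have g0 := gam_gt0 adm.
have e (x : R) : x - (x - r) = r by ring.
have gr : 0 <= gam p * r by rewrite mulr_ge0 // ltW.
apply: close_kap => //; rewrite ?e ?ger0_norm //.
have -> : width p (v - r) (w - r) = Num.max `|v - w| (E (Num.max v w - r)).
  rewrite /width; congr (Num.max `|_| (E _)); first by ring.
  by case: (leP v w) => vw; [rewrite max_r | rewrite max_l]; lra.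
apply: close_max; first exact: closexx.
apply: close_le (close_eps adm _ _); [exact: ltW (eps_gt0 adm _)..|].
by rewrite e ger0_norm.
Qed.

(** A Lipschitz cutoff between near and far jumps. It vanishes linearly at 0, which cancels the
    [1 / |x|] in the relative variation of the kernel. *)
Definition cut l x : R := Num.min 1 (`|x| / l).

Lemma cut_bounds l x : 0 < l -> [/\ 0 <= cut l x, cut l x <= 1 & cut l x <= `|x| / l].
Proof.
move=> l0; rewrite /cut; split; last 2 first.
- by rewrite ge_min lexx.
- by rewrite ge_min lexx orbT.
by rewrite le_min ler01 divr_ge0 // ltW.
Qed.

Lemma cut_lipschitz l x y : 0 < l -> `|cut l x - cut l y| <= `|x - y| / l.
Proof.
move=> l0; apply: min_dist; first by rewrite subrr normr0 divr_ge0 // ltW.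
rewrite -mulrBl normrM [`|l^-1|]ger0_norm ?invr_ge0 ?(ltW l0) //.
by rewrite ler_pM2r ?invr_gt0 // ler_dist_dist.
Qed.

Lemma cut_out l x : 0 < l -> l <= `|x| -> cut l x = 1.
Proof. by move=> l0 lx; rewrite /cut min_l // ler_pdivlMr // mul1r. Qed.

(** Moving [v] by [r] changes its distance to [w] by a relative amount of order [r / |w - (v - r)|],
    and [eps] by a factor of at most [e^{gam r}]. *)
Lemma width_close_far v w r : 0 < r -> 2 * r < `|w - (v - r)| ->
  close (gam p * r + 2 * r / `|w - (v - r)|) (width p v w) (width p (v - r) w).
Proof.
move=> r0 far; set u := v - r in far *; set x : R := `|w - u| in far *.
have x0 : 0 < x by lra.
have g0 := gam_gt0 adm; have gr : 0 <= gam p * r by rewrite mulr_ge0 // ltW.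
have rx : 0 <= r / x by rewrite divr_ge0 // ltW.
have hx : r / x * x = r by rewrite divfK // gt_eqF.
have d1 : `|v - w| <= x + r.
  have -> : v - w = - (w - u) + r by rewrite /u; ring.
  by apply: le_trans (ler_normD _ _) _; rewrite normrN (gtr0_norm r0).
have d2 : x <= `|v - w| + r.
  have -> : x = `|- (v - w) + r| by rewrite /x /u; congr `|_|; ring.
  by apply: le_trans (ler_normD _ _) _; rewrite normrN (gtr0_norm r0).
have -> : 2 * r / x = 2 * (r / x) by rewrite mulrA.
apply: close_max; last first.
  apply: close_le (close_eps adm _ _); [exact: ltW (eps_gt0 adm _)..|].
  have : `|Num.max v w - Num.max u w| <= r.
    by apply: max_dist; rewrite ?subrr ?normr0 ?(ltW r0) // /u; rewrite subKr gtr0_norm.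
  by move=> h; have := ler_wpM2l (ltW g0) h; lra.
apply: (@close_le _ (2 * (r / x))) => //; first by lra.
have e1 := expR_ge1Dx (2 * (r / x)).
have -> : `|u - w| = x by rewrite /x distrC.
split.
  apply: (@le_trans _ _ ((1 + 2 * (r / x)) * x)); last by rewrite ler_pM2r.
  by rewrite mulrDl -mulrA hx; lra.
apply: (@le_trans _ _ ((1 + 2 * (r / x)) * `|v - w|)); last by rewrite ler_wpM2r.
have h2 : x / 2 <= `|v - w| by lra.
have h3 := ler_wpM2l rx h2.
have h4 : r / x * (x / 2) = r / 2 by rewrite mulrA hx.
by rewrite mulrDl -mulrA; lra.
Qed.

Lemma kap_far_lipschitz l : 0 < l -> exists2 C : R, 0 < C & forall v w r, 0 < r -> r <= 1 ->
  `|cut l (w - v) * K v w - cut l (w - (v - r)) * K (v - r) w| <= C * r * (K v w + K (v - r) w).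
Proof.
move=> l0; have g0 := gam_gt0 adm; have li : 0 < l^-1 by rewrite invr_gt0.
pose A := (11 + gam p + 2 * l^-1) * expR (12 + gam p).
have A0 : 0 < A by rewrite mulr_gt0 ?expR_gt0 //; lra.
exists (3 * l^-1 + A); first lra.
move=> v w r r0 r1; set u := v - r; set x := `|w - u|.
have Kv := kap_gt0 adm v w; have Ku := kap_gt0 adm u w.
have [cv0 cv1 cvx] := cut_bounds (w - v) l0; have [cu0 cu1 cux] := cut_bounds (w - u) l0.
rewrite -/x in cux; set cv := cut l (w - v) in cv0 cv1 cvx *; set cu := cut l (w - u) in cu0 cu1 cux *.
have [near|far] := leP x (2 * r).
  have hv : cv <= 3 * r * l^-1.
    apply: le_trans cvx _; rewrite ler_pM2r //.
    have -> : w - v = (w - u) - r by rewrite /u; ring.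
    by apply: le_trans (ler_normB _ _) _; rewrite (gtr0_norm r0) -/x; lra.
  have hu : cu <= 3 * r * l^-1 by apply: le_trans cux _; rewrite ler_pM2r //; lra.
  apply: (@le_trans _ _ (3 * r * l^-1 * K v w + 3 * r * l^-1 * K u w)).
    apply: le_trans (ler_normB _ _) _; rewrite !normrM !(ger0_norm (ltW Kv)) !(ger0_norm (ltW Ku)).
    by rewrite (ger0_norm cv0) (ger0_norm cu0); apply: lerD; rewrite ler_pM2r.
  rewrite -mulrDr ler_pM2r; last lra.
  by have := mulr_gt0 A0 r0; lra.
have x0 : 0 < x by lra.
pose rho := 11 * r + (gam p * r + 2 * r / x).
have rx : 0 <= r / x by rewrite divr_ge0 // ltW.
have ck : close rho (K v w) (K u w).
  apply: close_kap; last exact: width_close_far.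
  - by have := mulr_gt0 g0 r0; rewrite -mulrA; lra.
  - by rewrite /u subKr gtr0_norm.
  - by rewrite subrr normr0 ltW.
have rho0 : 0 <= rho by rewrite /rho -[2 * r / x]mulrA; have := mulr_gt0 g0 r0; lra.
have h1 := close_dist ck (ltW Kv) (ltW Ku) rho0.
have h2 : expR rho <= expR (12 + gam p).
  have gr : gam p * r <= gam p by rewrite ler_piMr // ltW.
  have : 2 * r / x <= 1 by rewrite ler_pdivrMr // mul1r ltW.
  by rewrite ler_expR /rho; lra.
have h3 : cu * rho <= (11 + gam p + 2 * l^-1) * r.
  have -> : cu * rho = cu * ((11 + gam p) * r) + cu * (2 * (r / x)) by rewrite /rho; ring.
  have i1 : cu * ((11 + gam p) * r) <= (11 + gam p) * r.
    by rewrite ler_piMl // mulr_ge0 ?ltW //; lra.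
  have i2 : cu * (2 * (r / x)) <= 2 * l^-1 * r.
    apply: (@le_trans _ _ (x / l * (2 * (r / x)))); first by rewrite ler_wpM2r //; lra.
    have -> : x / l * (2 * (r / x)) = 2 * l^-1 * (r / x * x) by ring.
    by rewrite divfK ?gt_eqF.
  by rewrite !mulrDl in i1 *; lra.
have -> : cv * K v w - cu * K u w = (cv - cu) * K v w + cu * (K v w - K u w) by ring.
have j1 : `|cv - cu| <= r * l^-1.
  apply: le_trans (cut_lipschitz _ _ l0) _.
  have -> : w - v - (w - u) = - r by rewrite /u; ring.
  by rewrite normrN gtr0_norm.
apply: (@le_trans _ _ (r * l^-1 * K v w + A * r * K u w)).
  apply: le_trans (ler_normD _ _) _; rewrite !normrM (ger0_norm (ltW Kv)) (ger0_norm cu0).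
  apply: lerD; first by rewrite ler_pM2r.
  apply: (@le_trans _ _ (cu * (rho * expR rho * K u w))); first by rewrite ler_wpM2l.
  have -> : cu * (rho * expR rho * K u w) = cu * rho * expR rho * K u w by ring.
  rewrite ler_pM2r // /A [leRHS]mulrAC; apply: ler_pM => //; exact: mulr_ge0.
have p1 := mulr_gt0 (mulr_gt0 A0 r0) Kv; have p2 := mulr_gt0 (mulr_gt0 li r0) Kv.
have p3 := mulr_gt0 (mulr_gt0 li r0) Ku.
have -> : (3 * l^-1 + A) * r * (K v w + K u w) = 3 * (l^-1 * r * K v w) +
  3 * (l^-1 * r * K u w) + A * r * K v w + A * r * K u w by ring.
have -> : r * l^-1 * K v w = l^-1 * r * K v w by ring.
lra.
Qed.

Lemma Ve_translate v r : 0 <= r -> r <= 1 ->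
  Int (K (v - r)) <= expR (11 + gam p) * Int (K v).
Proof.
move=> r0 r1; have g0 := gam_gt0 adm.
rewrite -(Int_shift (- r) (ig_kap adm (v - r))) -IntZ; last exact: ig_kap.
apply: Int_le; [exact: (@ig_shift _ (- r)) (ig_kap adm (v - r))|by apply: igZ; exact: ig_kap|].
move=> w; have [_ h] := kap_translate v w r0; apply: le_trans h _.
by rewrite ler_wpM2r ?kap_ge0 // ler_expR ler_piMr //; lra.
Qed.

End NearFar.

(** * The share of short jumps *)

Section Rates.
Variables (R : realType) (p : params R).
Hypothesis adm : admissible p.
Local Notation K := (kap p).
Local Notation E := (eps p).
Local Notation nbar := (par_nbar p).
Local Notation eps0 := (par_eps0 p).
Implicit Types (u v w x y r s t l e : R).

(** One side of the model singularity [1 / (|x| + e)]; its integral is logarithmic in [e]. *)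
Definition hyp e x : R := chi R (0 <= x <= 1) * (`|x| + e)^-1.

Lemma hyp_ge0 e x : 0 <= e -> 0 <= hyp e x.
Proof. by move=> e0; rewrite mulr_ge0 ?ler0n // invr_ge0 addr_ge0. Qed.

Lemma cont_hyp e : 0 < e -> continuous (fun x => (`|x| + e)^-1).
Proof.
move=> e0; apply: contV => [x|]; first by rewrite gt_eqF //; have := normr_ge0 x; lra.
by apply: contD; [apply: cont_norm; exact: cont_id | exact: cont_cst].
Qed.

Lemma ig_hyp e : 0 < e -> ig (hyp e).
Proof.
move=> e0; apply: (@ig_mkcond _ `[0, 1]).
by apply: seg_integrable; exact: cont_hyp.
Qed.

Lemma Int_hyp e : 0 < e -> Int (hyp e) = ln (1 + e) - ln e.
Proof.
move=> e0; have := @rint_chi R `[0, 1] (fun x => (`|x| + e)^-1); rewrite /hyp.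
under [X in _ = Int X -> _]eq_fun do rewrite in_itv /=.
move=> <-; have h := @rint_seg_FTC R (fun x => ln (x + e)) (fun x => (`|x| + e)^-1) 1 ler01 (cont_hyp e0).
rewrite -[X in _ - ln X](add0r e); apply: h => s /andP[s0 _]; have se : 0 < s + e by lra.
have d1 := is_deriveD (is_derive_id s (1 : R)) (is_derive_cst e s (1 : R)).
have d2 := @is_derive1_comp R (@ln R) (fun x => x + e) s _ _ (is_derive1_ln se) d1.
by apply: (is_derive_eq d2); rewrite addr0 mulr1 ger0_norm.
Qed.

(** Hence [ln (1 / eps)] grows only linearly, which keeps the mass of short jumps comparable to that
    of long ones. *)
Lemma eps_log v : a1 p <= v -> ln (E v) = ln eps0 - gam p * v.
Proof.
move=> av; have e0 := eps0_gt0 adm.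
by rewrite /eps max_r // lnM ?posrE ?expR_gt0 // expRK.
Qed.

(** In this window [lnp w >= v / 2], [sig >= 1/3] and the singular factor is at least 1; its length
    is at least [v / 4]. *)
Lemma Int_kap_ge : forall v, 4 <= v ->
  nbar / 6 * (om v * v ^+ 2) <= Int (fun w => chi R (v / 2 <= w <= v - 1) * K v w).
Proof.
move=> v v4; have n0 := nbar_gt0 adm; have o0 := om_gt0 v.
have c0 : 0 <= nbar / 6 * (om v * v) * 4 by rewrite !mulr_ge0 //; lra.
apply: (@le_trans _ _ (Int (fun w => nbar / 6 * (om v * v) * 4 * chi R (v / 2 <= w <= v - 1)))).
  rewrite IntZ; last exact: ig_seg.
  rewrite Int_seg; last lra.
  have -> : nbar / 6 * (om v * v ^+ 2) = nbar / 6 * (om v * v) * 4 * (v / 4) by field.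
  by rewrite ler_wpM2l //; lra.
apply: Int_le; first by apply: igZ; exact: ig_seg.
  apply: ig_chiM; last exact: ig_kap.
  by apply: meas_and; apply: meas_le; by [exact: mf_cst | exact: mf_id].
move=> w; rewrite mulrC; have [/andP[w1 w2]|] := boolP (v / 2 <= w <= v - 1); last by rewrite /chi !mul0r.
rewrite /chi !mul1r kap_below; last lra.
have l1 : v / 2 <= lnp w by apply: le_trans w1 (lnp_ge_id w).
have s1 : 1 / 3 <= sig w (v - w).
  apply: le_trans (sig_ge w _); last lra.
  have := expR_ge1Dx w; move: (expR w) => X hX; rewrite ler_pdivlMr; lra.
have i1 : 1 <= (1 - expR (- Num.max (v - w) (E v)))^-1.
  rewrite invf_ge1; last by apply: subr1_expRN_gt0; rewrite lt_max; apply/orP; left; lra.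
  by rewrite gerBl expR_ge0.
apply: (@le_trans _ _ (4 * nbar * om v * (v / 2) * (1 / 3) * 1)).
  by rewrite le_eqVlt; apply/orP; left; apply/eqP; field.
apply: ler_pM => //; first by rewrite !mulr_ge0 ?(ltW o0) //; lra.
apply: ler_pM => //; first by rewrite !mulr_ge0 ?(ltW o0) //; lra.
by rewrite ler_wpM2l // !mulr_ge0 ?(ltW o0) //; lra.
Qed.

Lemma Ve_ge : exists2 c : R, 0 < c & forall v, 4 <= v -> c <= Int (K v).
Proof.
have n0 := nbar_gt0 adm; exists (nbar / 24); first lra.
move=> v v4; have o0 := om_gt0 v; have lv := lnp_ge_id v; have lv' := @lnp_le_1D R v ltac:(lra).
have [_ h1] := andP (@om_lnp_le1 R v ltac:(lra)).
apply: (@le_trans _ _ (nbar / 6 * (om v * v ^+ 2))).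
  have : om v * lnp v ^+ 2 <= om v * (4 * v ^+ 2).
    rewrite ler_wpM2l ?(ltW o0) // (_ : 4 * v ^+ 2 = (2 * v) ^+ 2); last by rewrite exprMn; ring.
    by rewrite ler_sqr ?nnegrE; lra.
  by nra.
apply: le_trans (Int_kap_ge v4) _; apply: Int_le; last 1 first.
- by move=> w; have := kap_ge0 adm v w; case: (_ <= _ <= _); rewrite /chi ?mul1r ?mul0r.
- apply: ig_chiM; last exact: ig_kap.
  by apply: meas_and; apply: meas_le; by [exact: mf_cst | exact: mf_id].
- exact: ig_kap.
Qed.

Lemma meas_ball v l : measurable_fun [set: R] (fun w => `|w - v| < l).
Proof.
apply: meas_lt; last exact: mf_cst.
by apply: mf_norm; apply: mfB; [exact: mf_id | exact: mf_cst].
Qed.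

(** One factor [v] comes from [lnp w], the other from the logarithmic integral of the singularity
    cut off at [eps]. *)
Lemma near_le : exists2 C : R, 0 < C & forall v, a1 p + 2 <= v ->
  Int (fun w => chi R (`|w - v| < 1) * K v w) <= C * (om v * v ^+ 2).
Proof.
have n0 := nbar_gt0 adm; have e0 := eps0_gt0 adm; have g0 := gam_gt0 adm.
have a17 := a1_ge17 adm.
pose k2 := 32 * nbar * expR (1 + eps0).
have k20 : 0 < k2 by rewrite mulr_gt0 ?expR_gt0 //; lra.
pose k3 := 2 * (eps0 + `|ln eps0| + 2 * gam p).
have nl := normr_ge0 (ln eps0); have k30 : 0 < k3 by rewrite /k3; lra.
exists (k2 * k3) => [|v va]; first exact: mulr_gt0.
(* As [eps] is nonincreasing, [e] is a lower bound for its values on the jumps shorter than 1. *)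
have o0 := om_gt0 v; pose e := E (v + 1); have ee : 0 < e := eps_gt0 adm _.
have ele : e <= eps0 := eps_le0 adm _.
have kov : 0 <= k2 * (om v * v) by apply: mulr_ge0 (ltW k20) (mulr_ge0 (ltW o0) _); lra.
have i1 : ig (fun w => hyp e (w + - v)) := ig_shift (- v) (ig_hyp ee).
have i2 : ig (fun w => hyp e (v - w)) := ig_refl v (ig_hyp ee).
apply: (@le_trans _ _ (Int (fun w => k2 * (om v * v) * (hyp e (w + - v) + hyp e (v - w))))).
  apply: Int_le; last 1 first.
  - move=> w; have [wv|_] := ltP `|w - v| 1; last first.
      by rewrite /chi mul0r mulr_ge0 // addr_ge0 // hyp_ge0 // ltW.
    rewrite /chi mul1r; set x : R := `|w - v| in wv *.
    have x0 : 0 <= x := normr_ge0 _.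
    have xe : 0 < x + e by lra.
    have mw : Num.max v w <= v + 1.
      by rewrite ge_max; have := ler_norm (w - v); rewrite -/x => h; apply/andP; split; lra.
    have wd : (x + e) / 2 <= width p v w.
      have h1 : x <= width p v w by rewrite /width le_max /x distrC lexx.
      have h2 : e <= width p v w by rewrite /width le_max; apply/orP; right; exact: eps_le.
      lra.
    have lw : lnp w * expR (v - Num.max v w) <= 2 * v.
      have h1 : lnp w <= 2 * v.
        apply: (@le_trans _ _ (lnp (v + 1))); first by apply: lnp_le; apply: le_trans mw; rewrite le_max lexx orbT.
        by have := @lnp_le_1D R (v + 1) ltac:(lra); lra.
      apply: le_trans h1; rewrite ler_piMr ?(ltW (lnp_gt0 _)) // expR_le1 subr_le0.
      by rewrite le_max lexx.
    have xe2 : 0 < (x + e) / 2 by lra.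
    apply: le_trans (kap_le_factors adm (lexx (om v)) lw xe2 wd) _.
    have den : (x + e) / 2 * expR (- (1 + eps0)) <= 1 - expR (- ((x + e) / 2)).
      apply: le_trans (subr1_expRN_ge _); rewrite ler_pM2l // ler_expR; lra.
    have den0 : 0 < (x + e) / 2 * expR (- (1 + eps0)) by rewrite mulr_gt0 ?expR_gt0.
    have inv : (1 - expR (- ((x + e) / 2)))^-1 <= 2 * expR (1 + eps0) * (x + e)^-1.
      apply: (@le_trans _ _ ((x + e) / 2 * expR (- (1 + eps0)))^-1).
        by rewrite lef_pV2 ?posrE //; exact: lt_le_trans den.
      rewrite !invfM invrK -expRN opprK; lra.
    have H : (x + e)^-1 <= hyp e (w + - v) + hyp e (v - w).
      have hy y : 0 <= hyp e y by rewrite hyp_ge0 // ltW.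
      have := hy (w + - v); have := hy (v - w); have [wv0|wv0] := leP v w.
        have -> : hyp e (w + - v) = (x + e)^-1.
          rewrite /hyp -/x chiT ?mul1r //; apply/andP; split; first by rewrite subr_ge0.
          by have := ler_norm (w - v); rewrite -/x; lra.
        by lra.
      have -> : hyp e (v - w) = (x + e)^-1.
        rewrite /hyp distrC -/x chiT ?mul1r //; apply/andP; split; first by rewrite subr_ge0 ltW.
        by have := ler_norm (v - w); rewrite distrC -/x; lra.
      by lra.
    apply: (@le_trans _ _ (8 * nbar * om v * (2 * v) * (2 * expR (1 + eps0) * (x + e)^-1))).
      by rewrite ler_wpM2l // !mulr_ge0 ?(ltW o0) //; lra.
    have -> : 8 * nbar * om v * (2 * v) * (2 * expR (1 + eps0) * (x + e)^-1) =
      k2 * (om v * v) * (x + e)^-1 by rewrite /k2; ring.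
    by rewrite ler_wpM2l.
  - by apply: ig_chiM; [exact: meas_ball | exact: ig_kap].
  - by apply: igZ; exact: igD.
rewrite IntZ; last exact: igD.
rewrite IntD // (Int_shift (- v) (ig_hyp ee)) (Int_refl v (ig_hyp ee)) Int_hyp //.
have -> : k2 * k3 * (om v * v ^+ 2) = k2 * (om v * v) * (k3 * v) by ring.
rewrite ler_wpM2l // /e eps_log; last lra.
rewrite -/e.
have l1 : ln (1 + e) <= eps0 by apply: le_trans ele; have := @le_ln1Dx R e; apply; lra.
have l2 : - ln eps0 <= `|ln eps0| by rewrite -normrN ler_norm.
have g1 : gam p * (v + 1) <= gam p * (2 * v) by rewrite ler_pM2l //; lra.
have v1 : 1 <= v by lra.
have : eps0 <= eps0 * v by rewrite ler_peMr // ltW.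
have : `|ln eps0| <= `|ln eps0| * v by rewrite ler_peMr.
rewrite /k3; lra.
Qed.

(** The short jumps have at most [B] times the mass of the disjoint window of [Int_kap_ge], hence at
    most the share [B / (1 + B)] of the total. *)
Lemma near_share : exists th : R, [/\ 0 < th, th < 1 & forall v, a1 p + 2 <= v ->
  Int (fun w => chi R (`|w - v| < 1) * K v w) <= th * Int (K v)].
Proof.
have [C C0 hC] := near_le; have n0 := nbar_gt0 adm; have a17 := a1_ge17 adm.
pose B := C * 6 / nbar; have B0 : 0 < B by rewrite /B divr_gt0 //; lra.
exists (B / (1 + B)); split; [by rewrite divr_gt0 //; lra|by rewrite ltr_pdivrMr; lra|].
move=> v va; set N := Int _; set V := Int (K v).
pose F := Int (fun w => chi R (v / 2 <= w <= v - 1) * K v w).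
have NF : N + F <= V.
  have m1 : ig (fun w => chi R (`|w - v| < 1) * K v w).
    by apply: ig_chiM; [exact: meas_ball | exact: ig_kap].
  have m2 : ig (fun w => chi R (v / 2 <= w <= v - 1) * K v w).
    apply: ig_chiM; last exact: ig_kap.
    by apply: meas_and; apply: meas_le; by [exact: mf_cst | exact: mf_id].
  rewrite /N /F -IntD //; apply: Int_le; [exact: igD | exact: ig_kap |].
  move=> w; have k0 := kap_ge0 adm v w; have [wv|_] := ltP `|w - v| 1.
    rewrite [chi R (_ <= _ <= _)]chiF; first by rewrite /chi mul1r mul0r addr0.
    apply/negbTE/negP => /andP[_ w2].
    by have := ler_norm (v - w); rewrite distrC; lra.
  rewrite {1}/chi mul0r add0r; case: (_ <= _ <= _); by rewrite /chi ?mul1r ?mul0r.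
have hN : N <= B * F.
  apply: le_trans (hC _ va) _.
  have h := @Int_kap_ge v ltac:(lra).
  have -> : C * (om v * v ^+ 2) = B * (nbar / 6 * (om v * v ^+ 2)).
    by rewrite /B; field; rewrite gt_eqF.
  by rewrite ler_pM2l.
by rewrite mulrAC ler_pdivlMr; [nra | lra].
Qed.

(* [e^{v/3}] is affordable in Hoelder estimates because [1/3 <= mu]. *)
Lemma kap_exp_quarter : exists2 C : R, 0 < C & forall v w, 1 <= v ->
  K v w * expR (`|w| / 4) <=
  C * expR (v / 3) * (K v w + expR (- (1 / 4 * `|w - v|)) + expR (- (1 / 4 * `|w|))).
Proof.
have n0 := nbar_gt0 adm.
have i0 : 0 < (1 - expR (- 1) : R)^-1 by rewrite invr_gt0 subr1_expRN_gt0.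
pose A := 8 * nbar * om 0 * (1 - expR (- 1))^-1.
have A0 : 0 < A by rewrite !mulr_gt0 ?om_gt0.
exists (expR 1 + 12 * A); first exact: addr_gt0 (expR_gt0 _) (mulr_gt0 _ A0).
move=> v w v1; have k0 := kap_ge0 adm v w; have e1 := expR_gt0 (1 : R).
have d0 : 0 < expR (- (1 / 4 * `|w - v|)) := expR_gt0 _.
have d1 : 0 < expR (- (1 / 4 * `|w|)) := expR_gt0 _.
have v3 : 1 <= expR (v / 3) by have := expR_ge1Dx (v / 3); lra.
have v30 : 0 < expR (v / 3) := expR_gt0 _.
have suff1 x : 0 <= x -> x <= K v w * (expR 1 * expR (v / 3)) \/
    x <= 12 * A * expR (v / 3) * expR (- (1 / 4 * `|w - v|)) \/
    x <= 12 * A * expR (- (1 / 4 * `|w|)) ->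
    x <= (expR 1 + 12 * A) * expR (v / 3) * (K v w + expR (- (1 / 4 * `|w - v|)) + expR (- (1 / 4 * `|w|))).
  clearbody A; move: d0 d1 v3 v30 k0 => {i0}.
  move: (expR (- (1 / 4 * `|w - v|))) (expR (- (1 / 4 * `|w|))) (expR (v / 3)) (K v w) (expR 1) e1.
  move=> X Y V k e0 e00 X0 Y0 V1 V0 k00 x0.
  have := (ltW e00, ltW X0, ltW Y0, ltW V0, ltW A0) => -[[[[? ?] ?] ?] ?] [h|[h|h]].
  - apply: le_trans h _; have -> : (e0 + 12 * A) * V * (k + X + Y) = k * (e0 * V) +
      (e0 * V * (X + Y) + 12 * A * V * (k + X + Y)) by ring.
    by rewrite lerDl !(addr_ge0, mulr_ge0).
  - apply: le_trans h _; have -> : (e0 + 12 * A) * V * (k + X + Y) = 12 * A * V * X +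
      (e0 * V * (k + X + Y) + 12 * A * V * (k + Y)) by ring.
    by rewrite lerDl !(addr_ge0, mulr_ge0).
  - apply: le_trans h _; apply: (@le_trans _ _ (12 * A * V * Y)).
      by rewrite ler_wpM2r // ler_peMr // !mulr_ge0.
    have -> : (e0 + 12 * A) * V * (k + X + Y) = 12 * A * V * Y +
      (e0 * V * (k + X + Y) + 12 * A * V * (k + X)) by ring.
    by rewrite lerDl !(addr_ge0, mulr_ge0).
have kle l : lnp w * expR (v - Num.max v w) <= l -> 1 <= `|v - w| -> K v w <= A * l.
  move=> hl vw; have := @kap_le_factors _ _ adm v w (om 0) l 1.
  move=> h; apply: le_trans (h _ hl _ _) _ => //.
  - by apply: om_le; lra.
  - by rewrite /width le_max vw.
  by rewrite /A; have -> : 8 * nbar * om 0 * l / (1 - expR (- 1)) =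
    8 * nbar * om 0 * (1 - expR (- 1))^-1 * l by ring.
apply: suff1; first by rewrite mulr_ge0 ?expR_ge0.
have [w0|w0] := ltP w 0.
  right; right; rewrite (ltr0_norm w0).
  have hk : K v w <= A * expR w.
    apply: kle; last by rewrite ger0_norm; lra.
    by rewrite max_l ?subrr ?expR0 ?mulr1 ?lnp_le_expR //; lra.
  apply: (@le_trans _ _ (A * expR w * expR (- w / 4))); first by rewrite ler_pM2r ?expR_gt0.
  rewrite -(mulrA A) -expRD.
  apply: (@le_trans _ _ (A * expR (- (1 / 4 * - w)))); first by rewrite ler_pM2l // ler_expR; lra.
  by rewrite ler_pM2r ?expR_gt0 //; lra.
rewrite (ger0_norm w0).
have [wv|wv] := leP w (v + 1).
  left; rewrite ler_wpM2l // -expRD ler_expR; lra.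
right; left; rewrite (@ger0_norm _ (w - v)); last lra.
(* The linear growth of [lnp w] is paid with [e^{w/12}]; together with [e^{v-w}] and [e^{w/4}] the
   exponent becomes [v - 2w/3 = v/3 - 2(w - v)/3]. *)
have hk : K v w <= A * (12 * expR (w / 12) * expR (v - w)).
  apply: kle; last by rewrite ltr0_norm; lra.
  rewrite max_r; last lra.
  rewrite ler_pM2r ?expR_gt0 //; apply: le_trans (lnp_le_1D w0) _.
  by have := expR_ge1Dx (w / 12); lra.
apply: (@le_trans _ _ (A * (12 * expR (w / 12) * expR (v - w)) * expR (w / 4))).
  by rewrite ler_pM2r ?expR_gt0.
have -> : A * (12 * expR (w / 12) * expR (v - w)) * expR (w / 4) =
  12 * A * (expR (w / 12) * expR (v - w) * expR (w / 4)) by ring.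
have A12 : 0 < 12 * A by lra.
by rewrite -[leRHS]mulrA (ler_pM2l A12) -!expRD ler_expR; lra.
Qed.

End Rates.

(** * The source of the increment equation *)

(** A simpler equivalent of [Gammabar] for [r <= 1] and large [v], with [r] as a parameter: it is
    compared at different points [v] for one and the same [r]. *)
HB.lock Definition hw (R : realType) (p : params R) (r v : R) : R :=
  expR (par_mu p * v) * hol p (r + eps p v).

Section HoelderWeight.
Variables (R : realType) (p : params R).
Hypothesis adm : admissible p.
Local Notation E := (eps p).
Local Notation mu := (par_mu p).
Local Notation W := (hw p).
Implicit Types (u v w x y r s t l e : R).

Lemma hol_le x y : 0 <= x -> x <= y -> hol p x <= hol p y.
Proof.
move=> x0 xy; have k7 := kappa_ge7 adm; have /andP[g1 _] := gamma0_bounds adm.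
have /andP[h1 _] := hol_base adm x0; have /andP[h2 _] := hol_base adm (le_trans x0 xy).
rewrite /hol; apply: ge0_ler_powR; rewrite ?nnegrE //; first by rewrite divr_ge0 // ltW.
by rewrite lerD2l lerN2 ler_expR lerN2 ler_pM2l //; lra.
Qed.

Lemma hol_growth rho x y : 0 <= rho -> 0 <= x -> 0 <= y -> close rho x y ->
  hol p x <= expR rho * hol p y.
Proof.
move=> rho0 x0 y0 [xy yx]; have k7 := kappa_ge7 adm; have /andP[g1 g2] := gamma0_bounds adm.
have /andP[h1 _] := hol_base adm x0; have /andP[h2 _] := hol_base adm y0.
have k0 : 0 <= par_kappa p by lra.
have c1 : close rho (par_kappa p * x) (par_kappa p * y).
  by split; rewrite mulrCA ler_wpM2l.
have [c2 _] := close_subr1_expRN (mulr_ge0 k0 x0) (mulr_ge0 k0 y0) rho0 c1.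
rewrite /hol; set q := par_gamma0 p / 2; have q0 : 0 <= q by rewrite /q; lra.
apply: (@le_trans _ _ ((expR rho * (1 - expR (- (par_kappa p * y)))) `^ q)).
  by apply: ge0_ler_powR => //; rewrite nnegrE // mulr_ge0 ?expR_ge0.
rewrite powRM ?expR_ge0 // ler_wpM2r ?powR_ge0 // -expRM ler_expR ler_piMr // /q; lra.
Qed.

(** A number in [(0, 1]] does not decrease when raised to the power [gamma0 / 2 <= 1]. Errors that
    are Lipschitz in [r] are thereby affordable in the Hoelder weight. *)
Lemma hol_ge_id r e : 0 < r -> r <= 1 -> 0 <= e -> expR (- 1) * r <= hol p (r + e).
Proof.
move=> r0 r1 e0; have k7 := kappa_ge7 adm; have /andP[g1 g2] := gamma0_bounds adm.
have b0 : 0 < 1 - expR (- (par_kappa p * (r + e))).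
  by apply: subr1_expRN_gt0; rewrite mulr_gt0 //; lra.
have b1 : 1 - expR (- (par_kappa p * (r + e))) <= 1 by rewrite gerBl expR_ge0.
apply: (@le_trans _ _ (1 - expR (- (par_kappa p * (r + e))))).
  apply: (@le_trans _ _ (1 - expR (- r))).
    apply: le_trans (subr1_expRN_ge r); rewrite mulrC ler_pM2l // ler_expR; lra.
  rewrite lerD2l lerN2 ler_expR lerN2; nra.
rewrite -[leLHS]powRr1; last exact: ltW.
rewrite /hol; apply: ger_powR; first by rewrite b0.
lra.
Qed.

Lemma hw_gt0 r v : 0 < r -> 0 < W r v.
Proof.
move=> r0; rewrite hw.unlock mulr_gt0 ?expR_gt0 // hol_gt0 //.
by have := eps_gt0 adm v; lra.
Qed.

Lemma hw_near r v w l : 0 < r -> 0 <= l -> `|w - v| <= l ->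
  W r w <= expR ((1 + gam p) * l) * W r v.
Proof.
move=> r0 l0 wv; have /andP[mu1 mu2] := mu_bounds adm; have g0 := gam_gt0 adm.
have gl : 0 <= gam p * l by rewrite mulr_ge0 // ltW.
have h2 : expR (mu * w) <= expR l * expR (mu * v).
  have h3 : w - v <= l := le_trans (ler_norm _) wv.
  rewrite -expRD ler_expR; nra.
have ew := eps_gt0 adm w; have ev := eps_gt0 adm v.
have c1 : close (gam p * l) (r + E w) (r + E v).
  apply: closeD; first by apply: closexx => //; exact: ltW.
  apply: close_le (close_eps adm w v); [exact: ltW..|].
  by rewrite ler_pM2l.
have h1 : hol p (r + E w) <= expR (gam p * l) * hol p (r + E v).
  by apply: hol_growth => //; lra.
have hh y : 0 <= hol p y by rewrite /hol powR_ge0.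
rewrite hw.unlock; have -> : expR ((1 + gam p) * l) * (expR (mu * v) * hol p (r + E v)) =
  (expR l * expR (mu * v)) * (expR (gam p * l) * hol p (r + E v)).
  by rewrite mulrDl mul1r expRD; ring.
by apply: ler_pM => //; exact: expR_ge0.
Qed.

Lemma hw_ge r v : 0 < r -> r <= 1 -> 0 <= v -> expR (v / 3) * r <= expR 1 * W r v.
Proof.
move=> r0 r1 v0; have /andP[mu1 mu2] := mu_bounds adm; have ev := eps_gt0 adm v.
have h1 := hol_ge_id r0 r1 (ltW ev).
have h2 : expR (v / 3) <= expR (mu * v) by rewrite ler_expR; nra.
apply: (@le_trans _ _ (expR (mu * v) * r)); first by rewrite ler_pM2r.
rewrite hw.unlock mulrCA ler_pM2l ?expR_gt0 //.
have := ler_wpM2l (expR_ge0 1) h1.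
by rewrite mulrA expRxMexpNx_1 mul1r.
Qed.

(** The left side is free of [eps], so for fixed [r] the bound on [psi] of order [e^{v/3}] is at
    most a constant times the weight, uniformly in [v]. *)
Lemma hw_ge_hol r v : 0 < r -> 0 <= v -> expR (v / 3) * hol p r <= W r v.
Proof.
move=> r0 v0; have /andP[mu1 mu2] := mu_bounds adm; have ev := eps_gt0 adm v.
rewrite hw.unlock; apply: ler_pM; [exact: expR_ge0 | by rewrite /hol powR_ge0 | | ].
  by rewrite ler_expR; nra.
by apply: hol_le; lra.
Qed.

End HoelderWeight.

Section Source.
Variables (R : realType) (p : params R).
Hypothesis adm : admissible p.
Variables (psi0 : R -> R[i]) (psi : R -> R -> R[i]).
Hypothesis sol : evolution_solution p psi0 psi.
Local Notation K := (kap p).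
Local Notation E := (eps p).
Local Notation W := (hw p).
Implicit Types (u v w x y r s t l : R) (b : bool).

Lemma quarter_le_third (x y : R) : `|x| <= y + 1 -> 1 <= y -> `|x| / 4 <= 1 + y / 3.
Proof. lra. Qed.

Definition jump b r t v : R := pr b (psi t v) - pr b (psi t (v - r)).

(** At the rate [Ve v] the value of [psi] at [v] drops out, and the value at [v - r] serves as
    reference for both kernels. *)
Lemma source_eq b r t v : 0 <= t ->
  Ve p v * jump b r t v - (pr b (L3e p (psi t) v) - pr b (L3e p (psi t) (v - r))) =
  Int (fun w => (K v w - K (v - r) w) * (pr b (psi t w) - pr b (psi t (v - r)))).
Proof.
move=> t0; set c := pr b (psi t (v - r)).
have i1 v' := ig_gker adm sol b v' t0.
have i2 v' : ig (fun w => c * K v' w) by apply: igZ; exact: ig_kap.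
have -> : (fun w => (K v w - K (v - r) w) * (pr b (psi t w) - c)) =
  (fun w => (K v w * pr b (psi t w) - c * K v w) -
            (K (v - r) w * pr b (psi t w) - c * K (v - r) w)).
  by apply/funext => w; ring.
rewrite IntB; [|exact: igB..].
rewrite !IntB // !IntZ; [|exact: ig_kap..].
have alg (L L' V V' X X' x z Y Y' : R) : V = X -> V' = X' -> L = V * x - Y -> L' = V' * z - Y' ->
    V * (x - z) - (L - L') = Y - z * X - (Y' - z * X').
  by move=> -> -> -> ->; ring.
exact: (alg _ _ _ _ _ _ _ _ _ _ (VeE adm v) (VeE adm (v - r))
  (pr_L3e adm sol b v t0) (pr_L3e adm sol b (v - r) t0)).
Qed.

Lemma cut_cont l : continuous (fun x : R => cut l x).
Proof.
apply: cont_min; first exact: cont_cst.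
by apply: contM; [apply: cont_norm; exact: cont_id | exact: cont_cst].
Qed.

Lemma cont_shift (f : R -> R) c : continuous f -> continuous (fun w => f (w - c)).
Proof.
move=> cf w; apply: (@cvg_comp _ _ _ (fun w => w - c) f _ (nbhs (w - c))); last exact: cf.
by apply: cvgB; [exact: cvg_id | exact: cvg_cst].
Qed.

(* The jumps near [v] are coupled with those near [v - r] by translation, so that
   only the increments of [psi] enter; the jumps far away are not coupled, and
   the smoothness of the kernel yields the factor [r]. *)
Lemma source_split b r t v l : 0 <= t -> 0 < l ->
  let c := pr b (psi t (v - r)) in let phi w := pr b (psi t w) in
  Int (fun w => (K v w - K (v - r) w) * (phi w - c)) =
  Int (fun w => (1 - cut l (w - v)) *
    (K v w * (phi w - phi (w - r)) + (K v w - K (v - r) (w - r)) * (phi (w - r) - c))) +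
  Int (fun w => (cut l (w - v) * K v w - cut l (w - (v - r)) * K (v - r) w) * (phi w - c)).
Proof.
move=> t0 l0 c phi.
pose n v' w := (1 - cut l (w - v')) * K v' w * (phi w - c).
pose f v' w := cut l (w - v') * K v' w * (phi w - c).
have mcut v' : mf (fun w => cut l (w - v')).
  by apply: mf_cont; apply: cont_shift; exact: cut_cont.
have ik v' : ig (fun w => K v' w * (phi w - c)).
  have -> : (fun w => K v' w * (phi w - c)) = (fun w => K v' w * phi w - c * K v' w).
    by apply/funext => w; ring.
  by apply: igB; [exact: (ig_gker adm sol b v' t0) | apply: igZ; exact: ig_kap].
have iff v' : ig (f v').
  apply: (ig_dom _ (ig_norm (ik v'))).
    have -> : f v' = fun w => cut l (w - v') * (K v' w * (phi w - c)).
      by apply/funext => w; rewrite /f mulrA.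
    by apply: mfM => //; exact: ig_mf.
  move=> w; have [h0 h1 _] := cut_bounds (w - v') l0.
  by rewrite /f -mulrA normrM ler_piMl // ger0_norm.
have inn v' : ig (n v').
  have -> : n v' = fun w => K v' w * (phi w - c) - f v' w.
    by apply/funext => w; rewrite /n /f; ring.
  exact: igB.
have ish : ig (fun w => n (v - r) (w + - r)) := ig_shift (- r) (inn (v - r)).
have -> : (fun w => (K v w - K (v - r) w) * (phi w - c)) =
  (fun w => (n v w - n (v - r) w) + (f v w - f (v - r) w)).
  by apply/funext => w; rewrite /n /f; ring.
rewrite IntD; [|exact: igB..]; congr (_ + _); last first.
  by apply: eq_Int => w; rewrite /f; ring.
rewrite IntB // -(Int_shift (- r) (inn (v - r))) -IntB //.
apply: eq_Int => w; rewrite /n.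
have -> : w - r - (v - r) = w - v by ring.
by ring.
Qed.

(** [th] is the share of the jumps shorter than 1, slightly enlarged by the variation of [hw] over a
    distance [l]. [Ca] collects what the growth bound on [psi] controls without any information on
    increments, so neither constant depends on [r]. *)
Lemma source_bound : exists Ca th : R, [/\ 0 <= Ca, 0 <= th, th < 1 &
  forall b r (N : R) t v, 0 < r -> r <= 1 -> 0 <= N -> 0 <= t -> a1 p + 2 <= v ->
    (forall w, a1 p + 1 <= w -> `|jump b r t w| <= N * W r w) ->
    `|Ve p v * jump b r t v - (pr b (L3e p (psi t) v) - pr b (L3e p (psi t) (v - r)))| <=
      Ve p v * ((Ca + th * N) * W r v)].
Proof.
have [q [q0 q1 hq]] := near_share adm; have g0 := gam_gt0 adm; have a17 := a1_ge17 adm.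
have [B B0 hB] := psi_exp_bound adm sol; have [c c0 hc] := Ve_ge adm.
have [Q Q0 hQ] := kap_exp_quarter adm.
(* Over a distance [l] the weight [hw] varies by a factor of at most [(1 + q) / (2 q)], which brings
   [th] to at most [(1 + q) / 2 < 1]. *)
pose l := Num.min 1 (ln ((1 + q) / (2 * q)) / (1 + gam p)).
have qq : 1 < (1 + q) / (2 * q) by rewrite ltr_pdivlMr; lra.
have l0 : 0 < l by rewrite lt_min ltr01 /= divr_gt0 ?ln_gt0 //; lra.
have l1 : l <= 1 by rewrite ge_min lexx.
pose th := expR ((1 + gam p) * l) * q.
have th1 : th <= (1 + q) / 2.
  have e1 : expR ((1 + gam p) * l) <= (1 + q) / (2 * q).
    rewrite -ler_ln ?posrE ?expR_gt0 //; last lra.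
    rewrite expRK mulrC -ler_pdivlMr; last lra.
    by rewrite ge_min lexx orbT.
  apply: (@le_trans _ _ ((1 + q) / (2 * q) * q)); first by rewrite ler_pM2r.
  by rewrite le_eqVlt; apply/orP; left; apply/eqP; field; rewrite gt_eqF.
have th0 : 0 <= th by rewrite mulr_ge0 ?expR_ge0 // ltW.
have [F F0 hF] := kap_far_lipschitz adm l0.
pose T := 11 + gam p; pose D := Int (fun w : R => expR (- (1 / 4 * `|w|))).
have D0 : 0 <= D by apply: Int_ge0 => w; exact: expR_ge0.
pose C1 := T * expR T * (2 * (B * expR 1)).
pose C2 := F * (B * (1 + Q) * (1 + expR T) + 4 * (B * (Q * (D / c)))).
have T0 : 0 < T by rewrite /T; lra.
have eT := expR_gt0 T; have e1 := expR_gt0 (1 : R).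
have C10 : 0 <= C1 by rewrite !mulr_ge0 // ltW.
have Dc : 0 <= D / c by rewrite divr_ge0 // ltW.
have C20 : 0 <= C2.
  have QQ := mulr_ge0 (ltW Q0) Dc.
  have BQ : 0 <= B * (1 + Q) * (1 + expR T) by apply: mulr_ge0; [apply: mulr_ge0 => //; lra | lra].
  by apply: mulr_ge0 (ltW F0) (addr_ge0 BQ (mulr_ge0 _ (mulr_ge0 B0 QQ))).
exists ((C1 + C2) * expR 1), th; split => //; [exact: mulr_ge0 (addr_ge0 C10 C20) (ltW e1) | lra |].
move=> b r N t v r0 r1 N0 t0 va hN; have W0 := hw_gt0 adm v r0.
rewrite source_eq // (source_split b r v t0 l0) /=.
set phi := fun w => pr b (psi t w); set u := v - r; rewrite -/(phi u).
pose V := Int (K v); have V0 : c <= V by apply: hc; lra.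
have hphi w : `|phi w| <= B * expR (`|w| / 4) by exact: hB.
have u1 : 1 <= u by rewrite /u; lra.
have uv : u <= v by rewrite gerBl ltW.
have v1 : 1 <= v := le_trans u1 uv.
have absu : `|u| <= v by rewrite ger0_norm // (le_trans ler01).
have ev3 := expR_gt0 (v / 3).
have hu : `|phi u| <= B * expR (v / 3).
  apply: le_trans (hphi u) _; rewrite ler_wpM2l // ler_expR.
  by apply: ler_pM => //; rewrite lef_pV2 ?posrE // ler_nat.
have cphi : continuous phi := @psi_space _ _ _ _ sol b t t0.
have cK v' : continuous (K v') := @continuous_kap _ _ adm v'.
have ccut v' : continuous (fun w => cut l (w - v')) := @cont_shift (cut l) v' (@cut_cont l).
(* Only [phi w - phi (w - r)], an increment, costs [N]. In the other term the kernels differ by a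
   translation, which supplies the factor [r], and [phi] is bounded by a multiple of [e^{v/3}]. *)
have near : `|Int (fun w => (1 - cut l (w - v)) *
    (K v w * (phi w - phi (w - r)) + (K v w - K u (w - r)) * (phi (w - r) - phi u)))| <=
    V * (th * N * W r v + C1 * (expR (v / 3) * r)).
  pose el := expR ((1 + gam p) * l); pose X := el * N * W r v; pose Y := C1 * (expR (v / 3) * r).
  have X0 : 0 <= X by rewrite !mulr_ge0 ?expR_ge0 // ltW.
  have Y0 : 0 <= Y by rewrite !mulr_ge0 ?expR_ge0 // ltW.
  have i1 : ig (fun w => chi R (`|w - v| < 1) * K v w).
    by apply: ig_chiM; [exact: meas_ball | exact: ig_kap].
  apply: (@le_trans _ _ (Int (fun w => X * (chi R (`|w - v| < 1) * K v w) + Y * K v w))); last first.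
    rewrite IntD ?IntZ //; [|exact: ig_kap|exact: igZ|by apply: igZ; exact: ig_kap].
    rewrite -/V [leRHS]mulrDr; apply: lerD; last by rewrite mulrC.
    have h := ler_wpM2l X0 (hq v va); rewrite -/V in h; apply: le_trans h _.
    by rewrite le_eqVlt; apply/orP; left; apply/eqP; rewrite /X /th /el; ring.
  apply: Int_norm_le.
  - apply: mf_cont; apply: contM; first by apply: contB; [exact: cont_cst | exact: ccut].
    apply: contD; apply: contM => //.
    + by apply: contB => //; exact: cont_shift.
    + by apply: contB => //; exact: cont_shift.
    + by apply: contB; [exact: cont_shift | exact: cont_cst].
  - by apply: igD; apply: igZ => //; exact: ig_kap.
  move=> w; have k0 := kap_ge0 adm v w; have [h0 h1 _] := cut_bounds (w - v) l0.
  have [wl|wl] := ltP `|w - v| l; last first.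
    rewrite cut_out // subrr mul0r normr0 addr_ge0 //; apply: mulr_ge0 => //.
    by apply: mulr_ge0 => //; rewrite ler0n.
  rewrite (chiT R (lt_le_trans wl l1)) mul1r.
  rewrite normrM; apply: (@le_trans _ _ (1 * (X * K v w + Y * K v w))); last by rewrite mul1r.
  apply: ler_pM => //; first by rewrite ger0_norm ?subr_ge0 // gerBl.
  apply: le_trans (ler_normD _ _) _; rewrite !normrM (ger0_norm k0); apply: lerD.
    rewrite mulrC ler_wpM2r //.
    have wlow : a1 p + 1 <= w.
      have : v - w <= l by apply: ltW; apply: le_lt_trans wl; rewrite distrC ler_norm.
      lra.
    apply: le_trans (hN w wlow) _; rewrite /X -[leRHS]mulrA [el * _]mulrC -mulrA ler_wpM2l //.
    by rewrite mulrC; apply: hw_near => //; exact: ltW.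
  have Tr0 : 0 <= T * r by rewrite mulr_ge0 // ltW.
  have ck := close_sym (kap_translate adm v w (ltW r0)).
  have h2 := close_dist ck (kap_ge0 adm _ _) k0 Tr0.
  rewrite distrC in h2.
  have h3 : expR (T * r) <= expR T by rewrite ler_expR ler_piMr // ltW.
  have h4 : `|phi (w - r) - phi u| <= 2 * (B * (expR 1 * expR (v / 3))).
    apply: le_trans (ler_normB _ _) _; apply: le_double.
      apply: le_trans (hphi _) _; rewrite ler_wpM2l // -expRD ler_expR.
      apply: quarter_le_third v1; have -> : w - r = u + (w - v) by rewrite /u; ring.
      apply: le_trans (ler_normD _ _) _; apply: le_trans (lerD absu (lexx _)) _.
      by rewrite lerD2l ltW // (lt_le_trans wl l1).
    apply: le_trans hu _; rewrite ler_wpM2l // ler_peMl ?expR_ge0 //.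
    by rewrite -[leLHS]expR0 ler_expR.
  apply: (@le_trans _ _ ((T * r * expR T * K v w) * (2 * (B * (expR 1 * expR (v / 3)))))).
    apply: ler_pM => //; apply: le_trans h2 _; rewrite ler_wpM2r // ler_wpM2l //.
  by rewrite le_eqVlt; apply/orP; left; apply/eqP; rewrite /Y /C1; ring.
(* No increment appears: the factor [r] comes from [kap_far_lipschitz], and the growth of [phi] is
   reduced to [e^{v/3}] by [kap_exp_quarter]. The integrals [D] of its tails are at most
   [D / c * V], as [c <= V]. *)
have far : `|Int (fun w => (cut l (w - v) * K v w - cut l (w - u) * K u w) * (phi w - phi u))| <=
    V * (C2 * (expR (v / 3) * r)).
  pose d w := expR (- (1 / 4 * `|w|)) : R.
  have idd : ig d by apply: ig_decay; lra.
  have iv : ig (fun w => d (w + - v)) := ig_shift (- v) idd.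
  have iu : ig (fun w => d (w + - u)) := ig_shift (- u) idd.
  have ik := ig_kap adm.
  pose Z := F * r * (B * expR (v / 3)).
  have Z0 : 0 <= Z by rewrite !mulr_ge0 ?expR_ge0 // ltW.
  have i1 : ig (fun w => K v w + K u w) by exact: igD.
  have i2 : ig (fun w => d (w + - v) + d (w + - u)) by exact: igD.
  have i3 : ig (fun w => d (w + - v) + d (w + - u) + (d w + d w)) by apply: igD; last exact: igD.
  have i4 : ig (fun w => (1 + Q) * (K v w + K u w)) by exact: igZ.
  have i5 : ig (fun w => Q * (d (w + - v) + d (w + - u) + (d w + d w))) by exact: igZ.
  apply: (@le_trans _ _ (Int (fun w => Z * ((1 + Q) * (K v w + K u w) +
     Q * (d (w + - v) + d (w + - u) + (d w + d w)))))); last first.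
    rewrite IntZ; last exact: igD.
    rewrite IntD // !IntZ // IntD // (IntD i2 (igD idd idd)) (IntD iv iu) (IntD idd idd).
    rewrite (Int_shift (- v) idd) (Int_shift (- u) idd) -/V -/D.
    have hVu : Int (K u) <= expR T * V := Ve_translate adm v (ltW r0) r1.
    have hD : D <= D / c * V.
      by rewrite mulrAC ler_pdivlMr // ler_wpM2l.
    have -> : V * (C2 * (expR (v / 3) * r)) =
      Z * ((1 + Q) * (V + expR T * V) + Q * (4 * (D / c * V))) by rewrite /C2 /Z; ring.
    rewrite ler_wpM2l //; apply: lerD.
      by rewrite ler_wpM2l ?lerD2l //; lra.
    by rewrite ler_wpM2l ?(ltW Q0) //; move: (D / c * V) hD => DD; lra.
  apply: Int_norm_le.
  - apply: mf_cont; apply: contM; last by apply: contB; [exact: cphi | exact: cont_cst].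
    by apply: contB; apply: contM.
  - by apply: igZ; exact: igD.
  move=> w; rewrite normrM; have kv := kap_ge0 adm v w; have ku := kap_ge0 adm u w.
  have h1 := hF v w r r0 r1; rewrite -/u in h1.
  have h2 : `|phi w - phi u| <= B * expR (`|w| / 4) + B * expR (v / 3).
    by apply: le_trans (ler_normB _ _) _; exact: lerD.
  apply: (@le_trans _ _ (F * r * (K v w + K u w) * (B * expR (`|w| / 4) + B * expR (v / 3)))).
    exact: ler_pM.
  have qv := hQ v w v1; have qu := hQ u w u1.
  have eu : expR (u / 3) <= expR (v / 3) by rewrite ler_expR ler_pM2r.
  have dd y : 0 <= d y := expR_ge0 _.
  rewrite -/(d (w - v)) -/(d w) in qv; rewrite -/(d (w - u)) -/(d w) in qu.
  have qu' : K u w * expR (`|w| / 4) <= Q * expR (v / 3) * (K u w + d (w - u) + d w).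
    apply: le_trans qu _; rewrite ler_wpM2r ?addr_ge0 // ler_wpM2l // ltW //.
  have -> : F * r * (K v w + K u w) * (B * expR (`|w| / 4) + B * expR (v / 3)) =
    F * r * B * (K v w * expR (`|w| / 4) + K u w * expR (`|w| / 4)) + Z * (K v w + K u w).
    by rewrite /Z; ring.
  apply: (@le_trans _ _ (F * r * B * (Q * expR (v / 3) * (K v w + d (w - v) + d w) +
      Q * expR (v / 3) * (K u w + d (w - u) + d w)) + Z * (K v w + K u w))).
    rewrite lerD2r ler_wpM2l ?lerD //; by rewrite !mulr_ge0 // ltW.
  by rewrite le_eqVlt; apply/orP; left; apply/eqP; rewrite /Z; ring.
apply: le_trans (ler_normD _ _) _; apply: le_trans (lerD near far) _.
rewrite (VeE adm) -/V -mulrDr ler_wpM2l ?(le_trans (ltW c0)) //.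
have h := @hw_ge _ _ adm r v r0 r1 ltac:(lra).
have -> : ((C1 + C2) * expR 1 + th * N) * W r v = th * N * W r v + (C1 + C2) * (expR 1 * W r v) by ring.
rewrite -addrA lerD2l -mulrDl; apply: ler_wpM2l => //; exact: addr_ge0.
Qed.

End Source.

(** * The Hoelder bound *)

Section HoelderBound.
Variables (R : realType) (p : params R).
Hypothesis adm : admissible p.
Variables (psi0 : R -> R[i]) (psi : R -> R -> R[i]).
Hypothesis sol : evolution_solution p psi0 psi.
Local Notation E := (eps p).
Local Notation W := (hw p).
Local Notation mu := (par_mu p).
Local Notation jump := (jump psi).
Implicit Types (u v w x y r s t : R) (b : bool).

(** At the rate [V = Ve v], Duhamel's formula weights the initial value by [e^{-tV}] and the source
    divided by [V] by [1 - e^{-tV}]: a convex combination, hence no growth in time. *)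
Lemma jump_step b r t v (A X : R) : 0 < r -> 0 <= t -> 4 <= v -> 0 <= X ->
  `|pr b (increment psi0 v r)| <= A ->
  (forall s, 0 <= s -> `|Ve p v * jump b r s v -
     (pr b (L3e p (psi s) v) - pr b (L3e p (psi s) (v - r)))| <= Ve p v * X) ->
  `|jump b r t v| <= Num.max A X.
Proof.
move=> r0 t0 v4 X0 hA hX.
have [c c0 hc] := Ve_ge adm; have V0 : 0 < Ve p v by rewrite (VeE adm); apply: lt_le_trans (hc _ v4).
set V := Ve p v in V0 hX *.
pose k v' s := V * pr b (psi (Num.max s 0) v') - pr b (L3e p (psi (Num.max s 0)) v').
have ck v' : continuous (k v').
  apply: contB; last exact: (@pr_L3e_continuous _ _ adm _ _ sol b v').
  by apply: contM; [exact: cont_cst | exact: (@psi_time _ _ _ _ sol b v')].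
have cn := @cont_kern R V t.
have eq : jump b r t v = expR (- (t * V)) * pr b (increment psi0 v r) +
    rint `[0, t] (fun s => kern V t s * (k v s - k (v - r) s)).
  have -> : rint `[0, t] (fun s => kern V t s * (k v s - k (v - r) s)) =
    rint `[0, t] (fun s => kern V t s * k v s - kern V t s * k (v - r) s).
    by apply: eq_rint_seg => s _; rewrite [LHS]mulrBr.
  rewrite rint_segB; [|by apply: contM; [|exact: ck]..].
  have alg (x y e z w I J : R) : x = e * z + I -> y = e * w + J -> x - y = e * (z - w) + (I - J).
    by move=> -> ->; ring.
  rewrite /increment prB.
  exact: (alg _ _ _ _ _ _ _ (pr_psi_rate adm sol b v V t0) (pr_psi_rate adm sol b (v - r) V t0)).
have hI : `|rint `[0, t] (fun s => kern V t s * (k v s - k (v - r) s))| <= X * (1 - expR (- (t * V))).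
  have h := @rint_kern_le R V 0 t (V * X) (fun s => k v s - k (v - r) s).
  have := h t0; rewrite addr0 => {}h; apply: le_trans (h V0 _ _ _) _.
  - by rewrite mulr_ge0 // ltW.
  - by apply: contB; exact: ck.
  - move=> s /andP[s0 _]; rewrite mul0r expR0 mulr1; apply: le_trans (hX s s0).
    rewrite /k max_l // /jump le_eqVlt; apply/orP; left; apply/eqP; congr `|_|.
    have alg (x y L L' : R) : V * x - L - (V * y - L') = V * (x - y) - (L - L') by ring.
    exact: alg.
  - by rewrite mul0r expR0 [V * X]mulrC mulfK // gt_eqF.
have e0 := expR_gt0 (- (t * V)); have e1 : expR (- (t * V)) <= 1.
  by rewrite expR_le1 oppr_le0 mulr_ge0 // ltW.
rewrite eq; apply: le_trans (ler_normD _ _) _; rewrite normrM (gtr0_norm e0).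
move: e0 e1 hI hA => {eq}; move: (expR _) (`|pr b _|) (`|rint _ _|) => e a I e0 e1 hI hA.
have m1 : A <= Num.max A X by rewrite le_max lexx.
have m2 : X <= Num.max A X by rewrite le_max lexx orbT.
nra.
Qed.

(** In both cases [r + eps v] is bounded below, so the Hoelder factor of [Gammabar] costs only a
    constant. *)
Lemma jump_bound_trivial M : exists2 C : R, 0 < C & forall b r t v, 0 < r -> 0 <= t ->
  v <= M \/ 1 <= r -> `|jump b r t v| <= C * Gammabar p v r.
Proof.
have [B B0 hB] := psi_bound sol; pose h0 := hol p (Num.min 1 (E M)).
have m0 : 0 < Num.min 1 (E M) by rewrite lt_min ltr01 eps_gt0.
have h00 : 0 < h0 := hol_gt0 adm m0.
have /andP[mu1 mu2] := mu_bounds adm; have a9 := a_ge9 adm.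
have mu0 : 0 < mu by lra.
exists ((B + 1) / h0); first by rewrite divr_gt0 //; lra.
move=> b r t v r0 t0 vr; set u := v - r.
have hh : h0 <= hol p (r + E v).
  apply: hol_le => //; first exact: ltW.
  have ev := eps_gt0 adm v; rewrite ge_min; case: vr => [vM|r1]; apply/orP; [right | left; lra].
  by have := eps_le adm vM; lra.
apply: (@le_trans _ _ (B * Gammat p v + B * Gammat p u)).
  by apply: le_trans (ler_normB _ _) _; apply: lerD; exact: hB.
rewrite GammabarE -/u.
set X := expR _; have X0 : 0 < X := expR_gt0 _.
have fv := lt_le_trans (f0_gt0 p) (fweight_ge p v); have fu := lt_le_trans (f0_gt0 p) (fweight_ge p u).
have gv : Gammat p v <= fweight p v * X.
  rewrite /Gammat (ler_pM2l fv) ler_expR (ler_pM2l mu0).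
  by rewrite ge_max !le_max !lexx ?orbT.
have gu : Gammat p u <= fweight p u * X.
  rewrite /Gammat (ler_pM2l fu) ler_expR (ler_pM2l mu0) {gv fv fu hh}.
  rewrite c0_bounds ge_max !le_max lexx /=.
  by case: (leP 0 u) => u0; apply/or3P; [apply: Or33 | apply: Or31]; lra.
move: gv gu fv fu hh; move: (Gammat p v) (Gammat p u) (fweight p v) (fweight p u) (hol p _).
move=> G1 G2 f1 f2 h g1 g2 f10 f20 hh.
have Y0 : 0 < (f1 + f2) * X by rewrite mulr_gt0 // addr_gt0.
apply: (@le_trans _ _ ((B + 1) * ((f1 + f2) * X))).
  have g3 : G1 + G2 <= (f1 + f2) * X by rewrite mulrDl; exact: lerD.
  rewrite -mulrDr; apply: le_trans (ler_wpM2l B0 g3) _.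
  by rewrite ler_pM2r // lerDl.
have -> : (B + 1) / h0 * ((f1 + f2) * X * h) = (B + 1) * ((f1 + f2) * X) * (h / h0) by ring.
by rewrite ler_peMr ?ler_pdivlMr ?mul1r // mulr_ge0 ?(ltW Y0) //; lra.
Qed.

(** In this range [fweight] is constant and the maximum in the exponent of [Gammabar] lies between
    [v - 1] and [v]. *)
Lemma hw_Gammabar : exists2 C : R, 0 < C & forall v r, 0 < r -> r <= 1 -> a1 p + 1 <= v ->
  Gammabar p v r <= C * W r v /\ W r v <= C * Gammabar p v r.
Proof.
have f00 := f0_gt0 p; have /andP[mu1 mu2] := mu_bounds adm; have a17 := a1_ge17 adm.
have a1a := a1E p.
pose C := 2 * f0 p + expR 1 / (2 * f0 p).
have i0 : 0 < expR 1 / (2 * f0 p) by rewrite divr_gt0 ?expR_gt0 //; lra.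
exists C => [|v r r0 r1 va]; first by rewrite /C; lra.
have Wv := hw_gt0 adm v r0; have Gv := Gammabar_gt0 adm v r0.
have fE y : 0 <= y -> fweight p y = f0 p.
  move=> y0; apply/eqP; rewrite eq_le fweight_ge andbT.
  by apply: le_trans (fweight_le adm y) _; rewrite max_r ?mul0r ?expR0 ?mulr1 //; lra.
have GE : Gammabar p v r = 2 * f0 p * expR (mu * Num.max (par_a p) (Num.max (c0 R * v) (v - r))) * hol p (r + E v).
  have v0 : 0 <= v by lra.
  have u0 : 0 <= v - r by lra.
  have ff : f0 p + f0 p = 2 * f0 p by ring.
  by rewrite GammabarE (fE v v0) (fE (v - r) u0) ff.
have WE : W r v = expR (mu * v) * hol p (r + E v) by rewrite hw.unlock.
have hp : 0 < hol p (r + E v) by apply: hol_gt0 => //; have := eps_gt0 adm v; lra.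
have m1 : Num.max (par_a p) (Num.max (c0 R * v) (v - r)) <= v.
  by rewrite c0_bounds !ge_max; apply/and3P; split; lra.
have m2 : v - 1 <= Num.max (par_a p) (Num.max (c0 R * v) (v - r)).
  by rewrite !le_max; apply/or3P; apply: Or33; lra.
move: (Num.max _ _) m1 m2 GE => m m1 m2 GE.
have e1 : expR (mu * m) <= expR (mu * v) by rewrite ler_expR; nra.
have e2 : expR (mu * v) <= expR 1 * expR (mu * m) by rewrite -expRD ler_expR; nra.
split.
  apply: (@le_trans _ _ (2 * f0 p * W r v)); last by rewrite ler_pM2r // /C lerDl ltW.
  by rewrite GE WE -[leLHS]mulrA ler_pM2l ?mulr_gt0 // ler_pM2r.
apply: (@le_trans _ _ (expR 1 / (2 * f0 p) * Gammabar p v r)).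
  rewrite WE GE.
  have -> : expR 1 / (2 * f0 p) * (2 * f0 p * expR (mu * m) * hol p (r + E v)) =
    (expR 1 * expR (mu * m)) * hol p (r + E v) * ((2 * f0 p) / (2 * f0 p)) by ring.
  by rewrite divff ?mulr1 ?ler_pM2r // gt_eqF //; lra.
by rewrite ler_pM2r // /C lerDr mulr_ge0 // ltW.
Qed.

Lemma hoelder_bound (B0 : R) : 0 <= B0 ->
  (forall v r b, 0 < r -> `|pr b (increment psi0 v r)| <= B0 * Gammabar p v r) ->
  exists2 C : R, 0 < C & forall b r t v, 0 < r -> 0 <= t -> `|jump b r t v| <= C * Gammabar p v r.
Proof.
move=> B00 hB0; have a17 := a1_ge17 adm.
have big1 y : a1 p + 1 <= y -> 4 <= y by move=> ?; lra.
have big2 y : a1 p + 2 < y -> a1 p + 1 <= y by move=> ?; lra.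
have [C1 C10 h1] := jump_bound_trivial (a1 p + 2); have [G G0 hG] := hw_Gammabar.
have [Ca [th [Ca0 th0 th1 hS]]] := source_bound adm sol.
have [B B1 hB] := psi_exp_bound adm sol.
pose A := Ca + B0 * G + C1 * G.
have A0 : 0 <= A by rewrite !addr_ge0 // mulr_ge0 // ltW.
have th1' : 0 < 1 - th by lra.
have BG := mulr_ge0 B00 (ltW G0); have CG := mulr_ge0 (ltW C10) (ltW G0).
have A1 : C1 * G <= A by rewrite /A; lra.
have A2 : B0 * G <= A by rewrite /A; lra.
have A3 : Ca <= A by rewrite /A; lra.
exists (C1 + A / (1 - th) * G).
  by rewrite ltr_wpDr // mulr_ge0 ?(ltW G0) // divr_ge0 // ltW.
move=> b r t v r0 t0; have Gv := Gammabar_gt0 adm v r0.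
have AG : 0 <= A / (1 - th) * G by rewrite mulr_ge0 ?(ltW G0) // divr_ge0 // ltW.
have [r1|r1] := leP 1 r.
  apply: le_trans (h1 _ _ _ _ r0 t0 (or_intror r1)) _.
  by rewrite ler_pM2r // lerDl.
have [vM|vM] := leP v (a1 p + 2).
  apply: le_trans (h1 _ _ _ _ r0 t0 (or_introl vM)) _.
  by rewrite ler_pM2r // lerDl.
have Wr y := hw_gt0 adm y r0; have rle := ltW r1.
(* The supremum starts one unit below the range [a1 + 2] of [source_bound], which looks at
   increments up to distance [l <= 1] from [v]; the gap is covered by the bound for bounded [v]. *)
pose S := [set y | exists s w, [/\ 0 <= s, a1 p + 1 <= w & y = `|jump b r s w| / W r w]].
have hr : 0 < hol p r := hol_gt0 adm r0.
(* This bound degenerates as [r] tends to 0; it only ensures that the supremum is finite. *)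
have ubS : ubound S (2 * (B / hol p r)).
  move=> _ [s [w [s0 wa ->]]]; rewrite ler_pdivrMr //.
  apply: (@le_trans _ _ (2 * (B * expR (w / 3)))).
    apply: le_trans (ler_normB _ _) _; apply: le_double.
      by apply: le_trans (hB _ _ _ s0) _; rewrite ler_wpM2l // ler_expR ger0_norm; lra.
    by apply: le_trans (hB _ _ _ s0) _; rewrite ler_wpM2l // ler_expR ger0_norm; lra.
  have hw0 := @hw_ge_hol _ _ adm r w r0 ltac:(lra).
  have := ler_wpM2l (divr_ge0 B1 (ltW hr)) hw0.
  have -> : B / hol p r * (expR (w / 3) * hol p r) = B * expR (w / 3) * (hol p r / hol p r) by ring.
  rewrite divff ?mulr1 ?gt_eqF // => h.
  by rewrite -[leRHS]mulrA ler_pM2l.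
have hubS : has_ubound S by exists (2 * (B / hol p r)).
have S1 : S (`|jump b r t v| / W r v) by exists t, v; split => //; exact: big2.
have N0 : 0 <= sup S by apply: le_trans (ub_le_sup hubS S1); rewrite divr_ge0 // ltW.
have hN s w : 0 <= s -> a1 p + 1 <= w -> `|jump b r s w| <= sup S * W r w.
  by move=> s0 wa; rewrite -ler_pdivrMr //; apply: ub_le_sup => //; exists s, w.
have step : sup S <= A + th * sup S.
  have tS : 0 <= th * sup S by rewrite mulr_ge0.
  apply: ge_sup; first by exists (`|jump b r t v| / W r v).
  move=> _ [s [w [s0 wa ->]]]; rewrite ler_pdivrMr //.
  have [hGW hWG] := hG w r r0 rle wa.
  have [wM|wM] := leP w (a1 p + 2).
    apply: le_trans (h1 _ _ _ _ r0 s0 (or_introl wM)) _.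
    apply: (@le_trans _ _ (C1 * G * W r w)); first by rewrite -mulrA ler_pM2l.
    by rewrite ler_pM2r //; apply: le_trans A1 _; rewrite lerDl.
  apply: (@le_trans _ _ (Num.max (B0 * G * W r w) ((Ca + th * sup S) * W r w))).
    apply: jump_step => //; first exact: big1.
    - by rewrite mulr_ge0 ?(ltW (Wr w)) // addr_ge0.
    - apply: le_trans (hB0 _ _ _ r0) _; rewrite -mulrA ler_wpM2l //.
    - by move=> s' s0'; apply: (hS b r (sup S) s' w) => //; [exact: ltW | move=> w' wa'; exact: hN].
  rewrite ge_max; apply/andP; split; rewrite ler_pM2r //; last by rewrite lerD2r.
  by apply: le_trans A2 _; rewrite lerDl.
have supA : sup S <= A / (1 - th).
  by rewrite ler_pdivlMr // mulrBr mulr1 lerBlDr [sup S * th]mulrC.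
apply: le_trans (hN t v t0 (big2 v vM)) _.
have [_ hWG] := hG v r r0 rle (big2 v vM).
apply: (@le_trans _ _ (A / (1 - th) * (G * Gammabar p v r))).
  apply: ler_pM => //; exact: ltW.
by rewrite mulrA ler_pM2r // lerDr ltW.
Qed.

End HoelderBound.

(** * Existence and uniqueness of the difference solution *)

Theorem theorem3p4 (R : realType) (p : params R) (psi0 : R -> R[i])
    (psi : R -> R -> R[i]) :
  admissible p ->
  in_X p psi0 ->
  (normYbar p (increment psi0) < +oo)%E ->
  evolution_solution p psi0 psi ->
  exists D : R -> R -> R -> R[i],
    difference_solution p psi0 psi D /\
    forall D' : R -> R -> R -> R[i], difference_solution p psi0 psi D' ->
      forall t v r : R, 0 <= t -> 0 < r -> D' t v r = D t v r.
Proof.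
move=> adm _ Y0 sol.
have [B B0 hB] : exists2 B : R, 0 <= B & (normYbar p (increment psi0) <= B%:E)%E.
  have [|B B0 hB] := @ereal_sup_lt_bound R [set normYbar p (increment psi0)].
    by rewrite ereal_sup1.
  by exists B => //; exact: hB.
have hinit v r b : 0 < r -> `|pr b (increment psi0 v r)| <= B * Gammabar p v r.
  move=> r0; apply: le_trans (pr_le_cabs _ _) _; exact: (normYbar_bound adm hB).
have [C C0 hC] := hoelder_bound adm sol B0 hinit.
pose D t v r := increment (psi t) v r.
have sD : difference_solution p psi0 psi D.
  split.
  - by have [_ ] := increment_tame adm sol.
  - apply: (@bound_ereal_sup R _ (2 * C)) => _ [t /= t0 <-].
    apply: (bound_normYbar adm) => v r r0; rewrite -mulrA; apply: cabs_le_pr => b.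
    by rewrite /D /increment prB; apply: hC => //; exact: ltW.
  - by move=> t v r t0 r0; exact: increment_equation.
by exists D; split => // D' sD'; exact: (difference_unique adm B0 hinit sD sD').
Qed.
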